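(* Let $n=3$. The multiplicities $\mathrm{mult}_3(\lambda)$ (defined in the context) satisfy $$\mathrm{mult}_3(\lambda)=\begin{cases}1 & \text{for }\lambda=(3,2),\ \lambda=(4,2),\ \text{and }\lambda=(2,2,2);\\ 0&\text{for all other partitions }\lambda.\end{cases}$$ For $m\ge 2$ the elements $J_{3,2},J_{4,2}\in\mathcal F_{3,m}^3$ generate irreducible $\mathrm{GL}_m$-submodules $N^m_{(3,2)}\cong V_{(3,2)}$ and $N^m_{(4,2)}\cong V_{(4,2)}$ in $K_{3,m}=\ker(\varphi_{3,m}^3)$, and for $m\ge 3$ the element $J_{2,2,2}\in\mathcal F_{3,m}^3$ generates an irreducible $\mathrm{GL}_m$-submodule $N^m_{(2,2,2)}\cong V_{(2,2,2)}$ in $K_{3,m}$. Furthermore, choose arbitrary $\mathbb C$-bases $\mathcal G^m_{(3,2)},\mathcal G^m_{(4,2)},\mathcal G^m_{(2,2,2)}$ of $N^m_{(3,2)},N^m_{(4,2)},N^m_{(2,2,2)}$, respectively, and set $\mathcal G^m:=\mathcal G^m_{(3,2)}\cup\mathcal G^m_{(4,2)}\cup\mathcal G^m_{(2,2,2)}$ when $m\ge 3$, and $\mathcal G^2:=\mathcal G^2_{(3,2)}\cup\mathcal G^2_{(4,2)}$. Then for every $m\ge 2$, $\mathcal G^m$ is a minimal generating system of the ideal $K_{3,m}$, the kernel of the surjection $\varphi_{3,m}^3:\mathcal F_{3,m}^3\to R_{3,m}$.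
   Context: Notation. $S_n$ acts on $V=\mathbb C^n$ by permuting coordinates and diagonally on $V^m$; $\mathbb C[V^m]=\mathbb C[x_{ij}\mid 1\le i\le n,\,1\le j\le m]$, where $x_{ij}$ is the $i$th coordinate function on the $j$th vector component, and $R_{n,m}=\mathbb C[V^m]^{S_n}$. For a monomial $w=x_1^{\alpha_1}\cdots x_m^{\alpha_m}$ put $[w]=\sum_{i=1}^n x_{i1}^{\alpha_1}\cdots x_{im}^{\alpha_m}\in R_{n,m}$. $\mathcal F_{n,m}^d$ is the polynomial algebra over $\mathbb C$ in independent variables $t(w)$, one for each monomial $w$ in $x_1,\dots,x_m$ with $1\le\deg w\le d$; for $k\le m$ we regard $\mathcal F_{n,k}^d\subseteq\mathcal F_{n,m}^d$. The algebra homomorphism $\varphi_{n,m}^d:\mathcal F_{n,m}^d\to R_{n,m}$ sends $t(w)\mapsto[w]$; it is surjective for $d\ge n$. Put $K_{n,m}=\ker(\varphi_{n,m}^n)$. $\mathrm{GL}_m=\mathrm{GL}_m(\mathbb C)$ acts on $\mathbb C[x_1,\dots,x_m]$ by algebra automorphisms, $g$ sending $x_i$ to the $i$th entry of the row vector $(x_1,\dots,x_m)g$, and on $\mathcal F_{n,m}^d$ by algebra automorphisms with $g\cdot t(w)=t(g\cdot w)$, where $t$ is extended linearly to polynomials. $K_{n,m}$ is a $\mathrm{GL}_m$-submodule of $\mathcal F_{n,m}^n$. The algebra $\mathcal F_{n,m}^n$ is graded by $\deg t(w)=\deg w$; $(\mathcal F_{n,m}^n)^{(+)}$ is the ideal spanned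 by homogeneous elements of positive degree. $K_{n,m}$ is a homogeneous ideal; a minimal generating system of $K_{n,m}$ is a set of homogeneous elements that is an irredundant generating system of the ideal $K_{n,m}$. For a partition $\lambda$, $h(\lambda)$ is its number of non-zero parts; for $h(\lambda)\le m$, $V_\lambda$ is the irreducible polynomial $\mathrm{GL}_m$-module of highest weight $\lambda$. For $h(\lambda)\le m$, $\mathrm{mult}_{n,m}(\lambda)$ is the multiplicity of $V_\lambda$ in the $\mathrm{GL}_m$-module $K_{n,m}/\big((\mathcal F_{n,m}^n)^{(+)}K_{n,m}\big)$, and $\mathrm{mult}_n(\lambda):=\mathrm{mult}_{n,h(\lambda)}(\lambda)$. Explicit elements ($n=3$; write $x=x_1$, $y=x_2$): $$\begin{aligned}J_{3,2}=\;&6t(x^2y)t(xy)-3t(xy^2)t(x^2)-2t(x^2y)t(x)t(y)+t(xy^2)t(x)^2-4t(xy)^2t(x)\\&+2t(xy)t(x)^2t(y)-3t(x^3)t(y^2)+4t(x^2)t(x)t(y^2)-t(x)^3t(y^2)+t(x^3)t(y)^2-t(x^2)t(x)t(y)^2,\end{aligned}$$ $$\begin{aligned}J_{4,2}=\;&6t(x^2y)^2+t(xy)^2t(x^2)-3t(xy)^2t(x)^2-6t(x^3)t(xy^2)+2t(x^2)t(xy^2)t(x)+4t(x^3)t(xy)t(y)\\&-2t(x^2)t(xy)t(x)t(y)+2t(xy)t(x)^3t(y)-4t(x^2y)t(x^2)t(y)-t(x^2)^2t(y^2)+t(x^2)^2t(y)^2\\&+4t(x^2)t(x)^2t(y^2)-t(x^2)t(x)^2t(y)^2-t(x)^4t(y^2)-2t(x^3)t(x)t(y^2),\end{aligned}$$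 $$J_{2,2,2}=\det\begin{pmatrix}t(x_1^2)&t(x_1x_2)&t(x_1x_3)&t(x_1)\\t(x_2x_1)&t(x_2^2)&t(x_2x_3)&t(x_2)\\t(x_3x_1)&t(x_3x_2)&t(x_3^2)&t(x_3)\\t(x_1)&t(x_2)&t(x_3)&3\end{pmatrix}.$$ *)

(* Defs.v *)
From HB Require Import structures.
From mathcomp Require Import all_boot all_order all_algebra.
From mathcomp Require Import perm generic_quotient ring_quotient complex.
From mathcomp Require Import mpoly.
From mathcomp Require Import boolp classical_sets reals.

Set Implicit Arguments.
Unset Strict Implicit.
Unset Printing Implicit Defensive.

Import GRing.Theory.

Local Open Scope ring_scope.
Local Open Scope classical_set_scope.
Local Open Scope quotient_scope.

Section GLModules.
Variables (C : fieldType) (m : nat).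

(* GL_m is the set of g : 'M[C]_m with g \in unitmx; the values of gl_act at
   singular matrices are irrelevant. *)
Record glmod := GLMod {
  gl_car :> lmodType C;
  gl_act : 'M[C]_m -> gl_car -> gl_car;
  gl_act_linear : forall g, g \in unitmx -> linear (gl_act g);
  gl_act1 : forall v, gl_act 1%:M v = v;
  gl_actM : forall g h, g \in unitmx -> h \in unitmx ->
    forall v, gl_act (g *m h) v = gl_act g (gl_act h v) }.

Definition is_submod (M : glmod) (N : set M) : Prop :=
  [/\ N 0,
      forall (a : C) u v, N u -> N v -> N (a *: u + v)
    & forall g v, g \in unitmx -> N v -> N (gl_act g v)].

Definition gen_submod (M : glmod) (v : M) : set M :=
  [set u | forall N : set M, is_submod N -> N v -> N u].

Definition is_irreducible (M : glmod) (N : set M) : Prop :=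
  [/\ is_submod N,
      exists2 v, N v & v != 0
    & forall N' : set M, is_submod N' -> N' `<=` N ->
        N' = [set 0] \/ N' = N].

Definition is_basis (V : lmodType C) (N G : set V) : Prop :=
  [/\ G `<=` N,
      forall (s : seq V) (c : V -> C), uniq s -> (forall v, v \in s -> G v) ->
        \sum_(v <- s) c v *: v = 0 -> forall v, v \in s -> c v = 0
    & forall u, N u -> exists (s : seq V) (c : V -> C),
        (forall v, v \in s -> G v) /\ u = \sum_(v <- s) c v *: v].

(* N is finite dimensional and, in some basis, the entries of the matrix of g
   acting on N are polynomials in the entries of g. *)
Definition is_polynomial_module (M : glmod) (N : set M) : Prop :=
  exists (r : nat) (e : 'I_r -> M) (P : 'I_r -> 'I_r -> {mpoly C[m * m]}),
    [/\ injective e,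
        is_basis N (range e)
      & forall g, g \in unitmx -> forall j,
          gl_act g (e j) =
            \sum_(i < r) (P i j).@[fun k => mxvec g 0 k] *: e i].

Definition upper_unitriangular (u : 'M[C]_m) : Prop :=
  forall i j : 'I_m, (j <= i)%N -> u i j = (i == j)%:R.

Definition highest_weight_vector (M : glmod) (lam : seq nat) (v : M) : Prop :=
  [/\ v != 0,
      forall u, upper_unitriangular u -> gl_act u v = v
    & forall z : 'rV[C]_m, (forall i, z 0 i != 0) ->
        gl_act (diag_mx z) v = (\prod_(i < m) z 0 i ^+ nth 0%N lam i) *: v].

(* N is isomorphic to V_lam: by the theorem of the highest weight, the
   irreducible polynomial GL_m-module of highest weight lam is determined up to
   isomorphism by the properties below. *)
Definition isom_V (M : glmod) (lam : seq nat) (N : set M) : Prop :=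
  [/\ (size lam <= m)%N,
      is_irreducible N,
      is_polynomial_module N
    & exists2 v, N v & highest_weight_vector lam v].

Definition is_direct_sum (M : glmod) (A : set M)
    (I : choiceType) (N : I -> set M) : Prop :=
  [/\ forall i, N i `<=` A,
      forall v, A v -> exists (s : seq I) (u : I -> M),
        [/\ uniq s, forall i, N i (u i) & v = \sum_(i <- s) u i]
    & forall (s : seq I) (u : I -> M), uniq s -> (forall i, N i (u i)) ->
        \sum_(i <- s) u i = 0 -> forall i, i \in s -> u i = 0].

(* The multiplicity of V_lam in the submodule A of M is k: A is a direct sum of
   irreducible submodules of which exactly k are isomorphic to V_lam. By the
   Krull-Schmidt theorem k does not depend on the decomposition. *)
Definition has_multiplicity (M : glmod) (A : set M)
    (lam : seq nat) (k : nat) : Prop :=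
  exists (I : choiceType) (N : I -> set M),
    [/\ forall i, is_irreducible (N i),
        is_direct_sum A N
      & exists s : seq I, [/\ uniq s, size s = k
          & forall i, i \in s <-> isom_V lam (N i)]].

Record submod (M : glmod) := Submod {
  sub_set :> set M;
  sub_setP : is_submod sub_set }.

Section Quotient.
Variables (M : glmod) (B : submod M).

Definition sub_pred : {pred M} := fun v => `[< sub_set B v >].

Lemma sub_predP v : v \in sub_pred <-> sub_set B v.
Proof. by split=> [/asboolP|/asboolP]. Qed.

Lemma sub_pred_zmod_closed : zmod_closed sub_pred.
Proof.
have [B0 BL _] := sub_setP B.
split=> [|u v /sub_predP Bu /sub_predP Bv]; first exact/sub_predP.
by apply/sub_predP; rewrite addrC -scaleN1r; exact: BL.
Qed.

HB.instance Definition _ :=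
  GRing.isZmodClosed.Build M sub_pred sub_pred_zmod_closed.

Definition quot_car : Type := Quotient.quot (sub_pred : zmodClosed M).
HB.instance Definition _ := GRing.Zmodule.on quot_car.
HB.instance Definition _ : EqQuotient M _ quot_car := EqQuotient.on quot_car.

Definition quot_pi (v : M) : quot_car := \pi_quot_car v.

Lemma quot_pi_surj q : exists v, q = quot_pi v.
Proof. by exists (repr q); rewrite /quot_pi reprK. Qed.

Lemma quot_pi_eq u v : quot_pi u = quot_pi v <-> sub_set B (u - v).
Proof.
rewrite -sub_predP Quotient.idealrBE.
by split=> [/eqP|/eqP].
Qed.

Lemma quot_piD u v : quot_pi (u + v) = quot_pi u + quot_pi v.
Proof. exact: Quotient.pi_add. Qed.

Lemma quot_pi_map (f : M -> M) : linear f ->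
  (forall v, sub_set B v -> sub_set B (f v)) ->
  forall v, quot_pi (f (repr (quot_pi v))) = quot_pi (f v).
Proof.
move=> lf Bf v; apply/quot_pi_eq.
have -> : f (repr (quot_pi v)) - f v = f (repr (quot_pi v) - v).
  by rewrite addrC -scaleN1r -lf scaleN1r addrC.
by apply/Bf/quot_pi_eq; rewrite /quot_pi reprK.
Qed.

Definition quot_scale (a : C) (q : quot_car) := quot_pi (a *: repr q).

Lemma quot_piZ a v : quot_scale a (quot_pi v) = quot_pi (a *: v).
Proof.
have [B0 BL _] := sub_setP B.
apply: (@quot_pi_map ( *:%R a)) => [b x y|x Bx].
  by rewrite scalerDr !scalerA mulrC.
by rewrite -[a *: x]addr0; exact: BL.
Qed.

Lemma quot_scaleA a b q : quot_scale a (quot_scale b q) = quot_scale (a * b) q.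
Proof. by have [v ->] := quot_pi_surj q; rewrite !quot_piZ scalerA. Qed.

Lemma quot_scale1 : left_id 1 quot_scale.
Proof. by move=> q; have [v ->] := quot_pi_surj q; rewrite quot_piZ scale1r. Qed.

Lemma quot_scaleDr : right_distributive quot_scale +%R.
Proof.
move=> a p q; have [u ->] := quot_pi_surj p; have [v ->] := quot_pi_surj q.
by rewrite -quot_piD !quot_piZ scalerDr quot_piD.
Qed.

Lemma quot_scaleDl q : {morph quot_scale^~ q : a b / a + b}.
Proof.
move=> a b; have [v ->] := quot_pi_surj q.
by rewrite !quot_piZ scalerDl quot_piD.
Qed.

HB.instance Definition _ := GRing.Zmodule_isLmodule.Build C quot_car
  quot_scaleA quot_scale1 quot_scaleDr quot_scaleDl.

Lemma quot_pi_linear : linear quot_pi.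
Proof. by move=> a u v; rewrite quot_piD -quot_piZ. Qed.

Definition quot_act (g : 'M[C]_m) (q : quot_car) : quot_car :=
  quot_pi (gl_act g (repr q)).

Lemma quot_pi_act g v : g \in unitmx ->
  quot_act g (quot_pi v) = quot_pi (gl_act g v).
Proof.
move=> gu; have [_ _ BG] := sub_setP B.
by apply: quot_pi_map => [|x]; [exact: gl_act_linear | exact: BG].
Qed.

Lemma quot_act_linear g : g \in unitmx -> linear (quot_act g).
Proof.
move=> gu a p q; have [u ->] := quot_pi_surj p; have [v ->] := quot_pi_surj q.
by rewrite -quot_pi_linear !quot_pi_act // gl_act_linear // quot_pi_linear.
Qed.

Lemma quot_act1 q : quot_act 1%:M q = q.
Proof.
by have [v ->] := quot_pi_surj q; rewrite quot_pi_act ?unitmx1 // gl_act1.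
Qed.

Lemma quot_actM g h : g \in unitmx -> h \in unitmx ->
  forall q, quot_act (g *m h) q = quot_act g (quot_act h q).
Proof.
move=> gu hu q; have [v ->] := quot_pi_surj q.
by rewrite !quot_pi_act ?unitmx_mul ?gu // gl_actM.
Qed.

Definition quot_glmod : glmod :=
  @GLMod quot_car quot_act quot_act_linear quot_act1 quot_actM.

End Quotient.

End GLModules.

Section Ideals.
Variable A : comNzRingType.

Definition gen_ideal (S : set A) : set A :=
  [set f | exists (r : nat) (a s : 'I_r -> A),
     (forall i, S (s i)) /\ f = \sum_(i < r) a i * s i].

Definition ideal_mul (I J : set A) : set A :=
  [set f | exists (r : nat) (a b : 'I_r -> A),
     [/\ forall i, I (a i), forall i, J (b i) & f = \sum_(i < r) a i * b i]].

End Ideals.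

Lemma comp_mpoly_comp (C : comNzRingType) (n k l : nat)
    (lq : n.-tuple {mpoly C[k]}) (lr : k.-tuple {mpoly C[l]}) p :
  (p \mPo lq) \mPo lr = p \mPo [tuple tnth lq i \mPo lr | i < n].
Proof.
rewrite [p]mpolyE [RHS]raddf_sum [X in X \mPo lr]raddf_sum raddf_sum /=.
apply: eq_bigr => w _.
rewrite !comp_mpolyZ !comp_mpolyX rmorph_prod /=; congr (_ *: _).
by apply: eq_bigr => i _; rewrite tnth_mktuple rmorphXn.
Qed.

Section Generic.
Variable C : fieldType.

(* Indices of the variables t(w): monomials w in x_1, ..., x_m, encoded by
   their exponent vectors, with 1 <= deg w <= d. *)
Definition tmon (d m : nat) := {w : 'X_{1..m < d.+1} | (0 < mdeg w)%N}.

Definition tmon_mnm d m (w : tmon d m) : 'X_{1..m} := bmnm (val w).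

Definition ntmon d m := #|{: tmon d m}|.

(* the monomial w such that the variable 'X_j of F^d_m is t(w) *)
Definition mon_of d m (j : 'I_(ntmon d m)) : 'X_{1..m} := tmon_mnm (enum_val j).

(* F^d_{n,m}, which does not depend on n *)
Definition Falg d m := {mpoly C[ntmon d m]}.

(* t, extended linearly to polynomials; monomials of degree 0 or > d, for
   which there is no variable, are sent to 0. *)
Definition t d m (p : {mpoly C[m]}) : Falg d m :=
  \sum_(w : tmon d m) p@_(tmon_mnm w) *: 'X_(enum_rank w).

Definition mon_act m (g : 'M[C]_m) (p : {mpoly C[m]}) : {mpoly C[m]} :=
  p \mPo [tuple \sum_(k < m) g k i *: 'X_k | i < m].

Definition F_act d m (g : 'M[C]_m) (f : Falg d m) : Falg d m :=
  f \mPo [tuple t d (mon_act g 'X_[mon_of j]) | j < ntmon d m].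

(* the coordinate function x_ij on V^m *)
Definition xvar n m (i : 'I_n) (j : 'I_m) : {mpoly C[n * m]} :=
  'X_(mxvec_index i j).

Definition perm_act n m (s : 'S_n) (f : {mpoly C[n * m]}) : {mpoly C[n * m]} :=
  f \mPo [tuple mxvec (\matrix_(i < n, j < m) xvar (s i) j) 0 k | k < n * m].

(* the algebra R_{n,m} *)
Definition invariants n m : set {mpoly C[n * m]} :=
  [set f | forall s : 'S_n, perm_act s f = f].

(* [w] *)
Definition psum n m (w : 'X_{1..m}) : {mpoly C[n * m]} :=
  \sum_(i < n) \prod_(j < m) xvar i j ^+ w j.

Definition phi n m d (f : Falg d m) : {mpoly C[n * m]} :=
  f \mPo [tuple psum n (mon_of j) | j < ntmon d m].

Definition K n m : set (Falg n m) := [set f | phi n f = 0].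
Arguments K n m : clear implicits.

Definition tdeg d m (u : 'X_{1..ntmon d m}) : nat :=
  (\sum_(j < ntmon d m) u j * mdeg (mon_of j))%N.

Lemma tdeg0 d m : @tdeg d m 0%MM = 0%N.
Proof. by rewrite /tdeg big1 // => j _; rewrite mnm0E. Qed.

Lemma tdegD d m : {morph @tdeg d m : u v / (u + v)%MM >-> (u + v)%N}.
Proof.
move=> u v; rewrite /tdeg -big_split /=.
by apply: eq_bigr => j _; rewrite mnmDE mulnDl.
Qed.

HB.instance Definition _ d m :=
  isMeasure.Build (ntmon d m) (@tdeg d m) (@tdeg0 d m) (@tdegD d m).

Definition homogeneous d m (e : nat) (f : Falg d m) : Prop :=
  f \is e.-homog for (@tdeg d m).

(* the ideal spanned by the homogeneous elements of positive degree *)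
Definition Fplus d m : set (Falg d m) :=
  [set f | exists (r : nat) (h : 'I_r -> Falg d m),
     (forall i, exists2 e, (0 < e)%N & homogeneous e (h i)) /\
     f = \sum_(i < r) h i].
Arguments Fplus d m : clear implicits.

Definition is_min_gen_system d m (I G : set (Falg d m)) : Prop :=
  [/\ forall f, G f -> exists e, homogeneous e f,
      gen_ideal G = I
    & forall G', G' `<=` G -> gen_ideal G' = I -> G' = G].

Lemma t_is_linear d m : linear (@t d m).
Proof.
move=> a p q; rewrite /t scaler_sumr -big_split /=.
by apply: eq_bigr => w _; rewrite mcoeffD mcoeffZ scalerDl scalerA.
Qed.

HB.instance Definition _ d m :=
  GRing.isLinear.Build C {mpoly C[m]} (Falg d m) _ (@t d m) (@t_is_linear d m).

Lemma t_mon_of d m (j : 'I_(ntmon d m)) : t d 'X_[mon_of j] = 'X_j.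
Proof.
rewrite /t (bigD1 (enum_val j)) //= mcoeffX eqxx scale1r enum_valK.
rewrite big1 ?addr0 // => w; rewrite mcoeffX /mon_of /tmon_mnm -bmeqP => wj.
by rewrite val_eqE eq_sym (negbTE wj) scale0r.
Qed.

Lemma mon_ofP d m (w : 'X_{1..m}) : (0 < mdeg w <= d)%N ->
  exists j : 'I_(ntmon d m), mon_of j = w.
Proof.
case/andP=> w0 wd.
exists (enum_rank (exist _ (BMultinom (wd : mdeg w < d.+1)%N) w0 : tmon d m)).
by rewrite /mon_of enum_rankK.
Qed.

Lemma mon_of_deg d m (j : 'I_(ntmon d m)) : (0 < mdeg (mon_of j) <= d)%N.
Proof.
rewrite /mon_of /tmon_mnm; apply/andP; split; first exact: (valP (enum_val j)).
by rewrite -ltnS; apply: (valP (val (enum_val j))).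
Qed.

Lemma t_homog0 d m e (p : {mpoly C[m]}) : p \is e.-homog ->
  ~~ (0 < e <= d)%N -> t d p = 0.
Proof.
move=> hp he; rewrite /t big1 // => w _.
rewrite (dhomog_nemf_coeff hp) ?scale0r //.
apply: contra he => /eqP <-.
by have := mon_of_deg (enum_rank w); rewrite /mon_of enum_rankK.
Qed.

Lemma mon_act_homog m (g : 'M[C]_m) w : mon_act g 'X_[w] \is (mdeg w).-homog.
Proof.
rewrite /mon_act comp_mpolyX mdegE.
elim/big_rec2: _ => [|i e p _ hp]; first exact: dhomog1.
apply: dhomogM => //; rewrite -[X in X.-homog]mul1n; apply: dhomogMn.
rewrite tnth_mktuple; apply: rpred_sum => k _; apply: rpredZ.
by rewrite dhomogX /= mdeg1.
Qed.

Lemma mon_act1 m (p : {mpoly C[m]}) : mon_act 1%:M p = p.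
Proof.
rewrite /mon_act -[RHS]comp_mpoly_id; congr (p \mPo _).
apply: eq_from_tnth => i; rewrite !tnth_mktuple (bigD1 i) //= mxE eqxx scale1r.
by rewrite big1 ?addr0 // => k ki; rewrite mxE (negbTE ki) scale0r.
Qed.

Lemma mon_actM m (g h : 'M[C]_m) (p : {mpoly C[m]}) :
  mon_act (g *m h) p = mon_act g (mon_act h p).
Proof.
rewrite /mon_act comp_mpoly_comp; congr (p \mPo _).
apply: eq_from_tnth => i; rewrite !tnth_mktuple raddf_sum /=.
under [RHS]eq_bigr => k _.
  rewrite comp_mpolyZ comp_mpolyXU -tnth_nth tnth_mktuple scaler_sumr.
  over.
rewrite exchange_big /=; apply: eq_bigr => k _.
by rewrite mxE scaler_suml; apply: eq_bigr => l _; rewrite scalerA mulrC.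
Qed.

Lemma F_act_linear d m (g : 'M[C]_m) : linear (@F_act d m g).
Proof. by move=> a p q; rewrite /F_act linearP. Qed.

Lemma F_act_t d m (g : 'M[C]_m) (p : {mpoly C[m]}) :
  F_act g (t d p) = t d (mon_act g p).
Proof.
have tX w : F_act g (t d 'X_[w]) = t d (mon_act g 'X_[w]).
  have [/mon_ofP[j <-]|wd] := boolP (0 < mdeg w <= d)%N.
    by rewrite t_mon_of /F_act comp_mpolyXU -tnth_nth tnth_mktuple.
  rewrite (t_homog0 (mon_act_homog g w) wd).
  by rewrite (t_homog0 _ wd) ?dhomogX // /F_act raddf0.
rewrite [p]mpolyE [X in F_act g X]linear_sum /mon_act [X in t d X]linear_sum.
rewrite [RHS]linear_sum /F_act linear_sum /=; apply: eq_bigr => w _.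
by rewrite !linearZ /=; congr (_ *: _); exact: tX.
Qed.

Lemma F_act1 d m (f : Falg d m) : F_act 1%:M f = f.
Proof.
rewrite /F_act -[RHS]comp_mpoly_id; congr (f \mPo _).
by apply: eq_from_tnth => j; rewrite !tnth_mktuple mon_act1 t_mon_of.
Qed.

Lemma F_actM d m (g h : 'M[C]_m) (f : Falg d m) :
  F_act (g *m h) f = F_act g (F_act h f).
Proof.
rewrite /F_act comp_mpoly_comp; congr (f \mPo _).
apply: eq_from_tnth => j; rewrite !tnth_mktuple mon_actM.
by rewrite -F_act_t.
Qed.

Definition F_glmod d m : glmod C m :=
  @GLMod C m (Falg d m) (@F_act d m) (fun g _ => F_act_linear g)
    (@F_act1 d m) (fun g h _ _ => F_actM g h).

Lemma phi_invariant n m d (f : Falg d m) : invariants (phi n f).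
Proof.
move=> s; rewrite /perm_act /phi comp_mpoly_comp; congr (f \mPo _).
apply: eq_from_tnth => j; rewrite !tnth_mktuple /psum raddf_sum /=.
rewrite [RHS](reindex_inj (@perm_inj _ s)) /=; apply: eq_bigr => i _.
rewrite rmorph_prod /=; apply: eq_bigr => k _; rewrite rmorphXn /=.
by rewrite comp_mpolyXU -tnth_nth tnth_mktuple mxvecE mxE.
Qed.

(* GL_m acts on C[V^m] as well; phi is equivariant, so K is a submodule. *)
Definition V_act n m (g : 'M[C]_m) (f : {mpoly C[n * m]}) : {mpoly C[n * m]} :=
  f \mPo [tuple mxvec (\matrix_(i < n, j < m)
                        (\sum_(k < m) g k j *: xvar i k)) 0 l | l < n * m].

Definition psum_lin n m (p : {mpoly C[m]}) : {mpoly C[n * m]} :=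
  \sum_(i < n) (p \mPo [tuple xvar i j | j < m]).

Lemma psum_linX n m (w : 'X_{1..m}) : psum_lin n 'X_[w] = psum n w.
Proof.
apply: eq_bigr => i _; rewrite comp_mpolyX; apply: eq_bigr => j _.
by rewrite tnth_mktuple.
Qed.

Lemma phi_t n m d e (p : {mpoly C[m]}) : (0 < e <= d)%N -> p \is e.-homog ->
  phi n (t d p) = psum_lin n p.
Proof.
move=> ed hp; rewrite [in LHS](mpolyE p) [in RHS](mpolyE p).
rewrite linear_sum /phi linear_sum /psum_lin /=.
under [RHS]eq_bigr => i _ do rewrite linear_sum.
rewrite exchange_big /= big_seq_cond [RHS]big_seq_cond; apply: eq_bigr => w.
rewrite andbT => /(dhomogP _ _ _ hp) we; rewrite !linearZ /=.
have /mon_ofP[j jw] : (0 < mdeg w <= d)%N by rewrite we.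
rewrite -jw t_mon_of comp_mpolyXU -tnth_nth tnth_mktuple -psum_linX scaler_sumr.
by apply: eq_bigr => i _; rewrite linearZ.
Qed.

Lemma phi_equivariant n m d (g : 'M[C]_m) (f : Falg d m) :
  phi n (F_act g f) = V_act g (phi n f).
Proof.
rewrite /phi /F_act /V_act !comp_mpoly_comp; congr (f \mPo _).
apply: eq_from_tnth => j; rewrite !tnth_mktuple.
have := phi_t n (mon_of_deg j) (mon_act_homog g (mon_of j)).
rewrite /phi => ->; rewrite -psum_linX /psum_lin raddf_sum /=.
apply: eq_bigr => i _; rewrite /mon_act !comp_mpoly_comp; congr (_ \mPo _).
apply: eq_from_tnth => k; rewrite !tnth_mktuple raddf_sum /=.
rewrite comp_mpolyXU -tnth_nth tnth_mktuple mxvecE mxE; apply: eq_bigr => l _.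
by rewrite comp_mpolyZ comp_mpolyXU -tnth_nth tnth_mktuple.
Qed.

Lemma K_submod n m : is_submod (K n m : set (F_glmod n m)).
Proof.
split=> [|a u v Ku Kv|g v _ Kv]; rewrite /K /=.
- by rewrite /phi raddf0.
- move: Ku Kv; rewrite /K /phi /= => Ku Kv.
  by rewrite linearP /= Ku Kv scaler0 addr0.
- by rewrite phi_equivariant Kv /V_act raddf0.
Qed.

Lemma t_homogeneous d m e (p : {mpoly C[m]}) :
  p \is e.-homog -> homogeneous e (t d p).
Proof.
move=> hp; rewrite /homogeneous /t; apply: rpred_sum => w _.
have [we|we] := eqVneq (mdeg (tmon_mnm w)) e; last first.
  by rewrite (dhomog_nemf_coeff hp we) scale0r rpred0.
apply: rpredZ; rewrite dhomogX; apply/eqP.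
rewrite /= /tdeg (bigD1 (enum_rank w)) //= mnm1E eqxx.
rewrite mul1n /mon_of enum_rankK we big1 ?addn0 // => j jw.
by rewrite mnm1E eq_sym (negbTE jw).
Qed.

Lemma homogeneous_act d m e (g : 'M[C]_m) (f : Falg d m) :
  homogeneous e f -> homogeneous e (F_act g f).
Proof.
move=> hf; rewrite /homogeneous /F_act comp_mpolyEX big_seq.
apply: rpred_sum => u /(dhomogP _ _ _ hf) <-; apply: rpredZ.
rewrite comp_mpolyX.
suff H (h : 'I_(ntmon d m) -> Falg d m) :
    (forall j, homogeneous (mdeg (mon_of j)) (h j)) ->
    homogeneous (\sum_(j < ntmon d m) u j * mdeg (mon_of j))%N
                (\prod_(j < ntmon d m) h j ^+ u j).
  by apply: H => j; rewrite tnth_mktuple; exact/t_homogeneous/mon_act_homog.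
rewrite /homogeneous => hh; elim/big_rec2: _ => [|j k p _ hp].
  exact: dhomog1.
by apply: dhomogM => //; rewrite mulnC; apply: dhomogMn.
Qed.

Lemma Fplus_act d m (g : 'M[C]_m) (f : Falg d m) :
  Fplus d m f -> Fplus d m (F_act g f).
Proof.
case=> r [h [hh ->]]; exists r, (fun i => F_act g (h i)); split; last first.
  by rewrite /F_act linear_sum.
by move=> i; have [e e0 he] := hh i; exists e => //; exact: homogeneous_act.
Qed.

Lemma FplusK_submod n m :
  is_submod (ideal_mul (Fplus n m) (K n m) : set (F_glmod n m)).
Proof.
have [K0 KL KG] := K_submod n m.
split=> [|a u v|g v _]; rewrite /ideal_mul /=.
- by exists 0%N, (fun=> 0), (fun=> 0); split=> [[]|[]|]//; rewrite big_ord0.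
- move=> [r [p [q [Fp Kq ->]]]] [r' [p' [q' [Fp' Kq' ->]]]].
  exists (r + r')%N.
  exists (fun i => match split i with inl j => p j | inr j => p' j end).
  exists (fun i => match split i with inl j => a *: q j | inr j => q' j end).
  split=> [i|i|].
  + by case: split.
  + by case: split => j //; rewrite -[_ *: _]addr0; exact: KL.
  rewrite big_split_ord /= scaler_sumr; congr (_ + _); apply: eq_bigr => j _.
    by rewrite (unsplitK (inl j)) scalerAr.
  by rewrite (unsplitK (inr j)).
- move=> [r [p [q [Fp Kq ->]]]].
  exists r, (fun i => F_act g (p i)), (fun i => F_act g (q i)); split=> [i|i|].
  + exact: Fplus_act.
  + by move: (Kq i); rewrite /K /= phi_equivariant => ->; rewrite /V_act raddf0.
  by rewrite /F_act linear_sum; apply: eq_bigr => i _; rewrite rmorphM.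
Qed.

(* K_{n,m} / (F^n_{n,m})^(+) K_{n,m}, as a submodule of F / (F^(+) K) *)
Definition FmodFplusK n m : glmod C m := quot_glmod (Submod (FplusK_submod n m)).

Definition minimal_relations n m : set (FmodFplusK n m) :=
  [set quot_pi (Submod (FplusK_submod n m)) f | f in K n m].
Arguments minimal_relations n m : clear implicits.

(* mult_{n,m}(lam) = k *)
Definition mult_nm_is n m (lam : seq nat) (k : nat) : Prop :=
  has_multiplicity (minimal_relations n m) lam k.

(* mult_n(lam) = k; partitions have no zero part, so h(lam) = size lam *)
Definition mult_is n (lam : seq nat) (k : nat) : Prop :=
  mult_nm_is n (size lam) lam k.

(* the variable x_(k+1), to be used for k < m only *)
Definition X m (k : nat) : {mpoly C[m]} :=
  if insub k is Some i then 'X_i else 0.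

Section Elements.
Variable m : nat.
Local Notation x := (X m 0).
Local Notation y := (X m 1).
Local Notation z := (X m 2).
Local Notation t := (@t 3 m).

Definition J32 : Falg 3 m :=
  6 * t (x^+2 * y) * t (x * y)
  - 3 * t (x * y^+2) * t (x^+2)
  - 2 * t (x^+2 * y) * t x * t y
  + t (x * y^+2) * t x ^+ 2
  - 4 * t (x * y) ^+ 2 * t x
  + 2 * t (x * y) * t x ^+ 2 * t y
  - 3 * t (x^+3) * t (y^+2)
  + 4 * t (x^+2) * t x * t (y^+2)
  - t x ^+ 3 * t (y^+2)
  + t (x^+3) * t y ^+ 2
  - t (x^+2) * t x * t y ^+ 2.

Definition J42 : Falg 3 m :=
  6 * t (x^+2 * y) ^+ 2
  + t (x * y) ^+ 2 * t (x^+2)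
  - 3 * t (x * y) ^+ 2 * t x ^+ 2
  - 6 * t (x^+3) * t (x * y^+2)
  + 2 * t (x^+2) * t (x * y^+2) * t x
  + 4 * t (x^+3) * t (x * y) * t y
  - 2 * t (x^+2) * t (x * y) * t x * t y
  + 2 * t (x * y) * t x ^+ 3 * t y
  - 4 * t (x^+2 * y) * t (x^+2) * t y
  - t (x^+2) ^+ 2 * t (y^+2)
  + t (x^+2) ^+ 2 * t y ^+ 2
  + 4 * t (x^+2) * t x ^+ 2 * t (y^+2)
  - t (x^+2) * t x ^+ 2 * t y ^+ 2
  - t x ^+ 4 * t (y^+2)
  - 2 * t (x^+3) * t x * t (y^+2).

Definition J222 : Falg 3 m :=
  \det (\matrix_(i < 4, j < 4)
    (nth [::]
      [:: [:: t (x * x); t (x * y); t (x * z); t x];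
          [:: t (y * x); t (y * y); t (y * z); t y];
          [:: t (z * x); t (z * y); t (z * z); t z];
          [:: t x;       t y;       t z;       3  ]] i)`_j).

Definition N32 : set (F_glmod 3 m) := gen_submod (J32 : F_glmod 3 m).
Definition N42 : set (F_glmod 3 m) := gen_submod (J42 : F_glmod 3 m).
Definition N222 : set (F_glmod 3 m) := gen_submod (J222 : F_glmod 3 m).

End Elements.

End Generic.

Arguments K C n m : clear implicits.
Arguments N32 C m : clear implicits.
Arguments N42 C m : clear implicits.
Arguments N222 C m : clear implicits.

(* Partitions are represented without trailing zeros. *)
Definition is_partition (lam : seq nat) : bool :=
  sorted geq lam && (0%N \notin lam).

(* Main.v *)
(** Let w be a primitive cube root of unity and write the rows of a point of V^m
    as s + w^i u + w^(2i) v for i = 0, 1, 2. Every [w] of degree at most 3 is then a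
    polynomial in s_j, in p_jk = (u_j v_k + u_k v_j)/2 and in
    c_jkl = u_j u_k u_l + v_j v_k v_l. If I is an ideal of F containing the GL_m-orbits
    of J32, J42 and J222, the polarizations of these relations suffice to define a
    C-linear map sigma from C[s, u, v] to F/I, determined by the values that
    u^a v^b + v^a u^b would have as a polynomial in the p and c, such that
    sigma (phi f * h) = f * sigma h and sigma 1 = 2. Hence phi f = 0 forces 2 f = 0
    in F/I, and the three orbits generate the kernel K.

    The J are highest weight vectors. F carries a positive definite form with
    <g f, h> = <f, g^* h>; with the LU decomposition it shows that in the module
    generated by a highest weight vector v, only 0 is fixed by the unitriangular
    matrices and orthogonal to v, so this module is irreducible and has no highest
    weight vector of another weight. The J are not in F^+ K: this is seen in degree 5
    for J32, and in degree 6 modulo the variables t(x_i) for J42 and J222. As their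
    weights differ, the three modules are independent modulo F^+ K, which gives both
    the multiplicities and the minimality of the generating systems. *)

Require Import Defs.
From HB Require Import structures.
From mathcomp Require Import all_boot all_order all_algebra.
From mathcomp Require Import ring zify.
From mathcomp Require Import generic_quotient ring_quotient complex mpoly.
From mathcomp Require Import boolp classical_sets reals.

Set Implicit Arguments.
Unset Strict Implicit.
Unset Printing Implicit Defensive.

Import GRing.Theory Num.Theory.
Local Open Scope ring_scope.
Local Open Scope classical_set_scope.

(** * Words in the letters u and v *)

(** The group S_3 acts on s, u, v through u -> w u, v -> w^2 v and the exchange of u and v. So twice
    the Reynolds operator kills u^a v^b if |a| and |b| differ modulo 3, and otherwise gives u^a v^b
    + v^a u^b. The map sigma is this operator followed by the inverse of F/I -> R that the theorem
    predicts; hence sigma 1 = 2. The rank condition J222 and the relation J32 give this for short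
    words and for a single factor c; exchanging letters between two factors c takes J42. With more
    factors the exchange follows from the shorter cases, which is why no generator of degree above 6
    is needed. *)

Lemma adjacent_swap_perm (T : eqType) (A : Type) (f : seq T -> A) (n : nat) :
  (forall s1 x y s2, size (s1 ++ x :: y :: s2) = n ->
     f (s1 ++ x :: y :: s2) = f (s1 ++ y :: x :: s2)) ->
  forall s t, size s = n -> perm_eq s t -> f s = f t.
Proof.
move=> fswap s0 t0 sz0 st0.
(* The prefix r collects the letters already matched, so that the swaps of the induction still take
   place inside a word of length n. *)
suff: forall s t r, size (r ++ s) = n -> perm_eq s t -> f (r ++ s) = f (r ++ t).
  by move=> /(_ s0 t0 [::]); apply.
elim=> [|x s IHs] t r sz st; first by rewrite (size0nil (esym (perm_size st))).
have xt : x \in t by rewrite -(perm_mem st) mem_head.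
case/splitPr: xt st => t1 t2 st.
have {}st : perm_eq s (t1 ++ t2).
  by rewrite -(perm_cons x) (permPl st) -cat_rcons -cats1 -catA perm_catCA.
have -> : f (r ++ t1 ++ x :: t2) = f (r ++ x :: t1 ++ t2).
  have : size (r ++ x :: t1 ++ t2) = n.
    by rewrite -sz !size_cat /= (perm_size st) size_cat.
  elim: t1 r {st sz} => //= y t1 IHt r sz.
  rewrite fswap // -!(cat_rcons y) IHt // -sz !size_cat !size_rcons /= !size_cat.
  by rewrite !addSn !addnS.
by rewrite -!cat_rcons; apply: IHs => //; rewrite -sz cat_rcons.
Qed.

Section Products.
Variables (A : comNzRingType) (T : eqType).
Variables (p : T -> T -> A) (c : T -> T -> T -> A).

(** The Kulkarni-Nomizu product of the symmetric forms p and f. In the model f is a combination of u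
    u and v v, and the mixed discriminant of the binary forms uv and alpha u^2 + beta v^2 is
    zero. *)
Definition R1 (f : T -> T -> A) (j k l n : T) : A :=
  p j l * f k n - p k l * f j n - p j n * f k l + p k n * f j l.

(** The minor of the matrix p with rows a, b, d and columns e, f, g; in the model p has rank at most
    2. *)
Definition minor3 (a b d e f g : T) : A :=
  p a e * (p b f * p d g - p b g * p d f)
  - p a f * (p b e * p d g - p b g * p d e)
  + p a g * (p b e * p d f - p b f * p d e).

(* If p j k stands for (u_j v_k + u_k v_j)/2 and c i j k for
   u_i u_j u_k + v_i v_j v_k, then Xw (Hw n) a b, meant for
   size a = size b + 3n, stands for u^a v^b + v^a u^b: the recursion removes a
   letter of b by u_k u_l v_j = p_jk u_l + p_jl u_k - p_kl u_j. *)
Fixpoint Xw (H : seq T -> A) (a b : seq T) : A :=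
  match b with
  | [::] => H a
  | j :: b' =>
    match a with
    | k :: l :: a' => p j k * Xw H (l :: a') b' + p j l * Xw H (k :: a') b'
                      - p k l * Xw H (j :: a') b'
    | [:: k] => 2 * p k j
    | [::] => 0
    end
  end.

(** Stands for u^a + v^a with |a| = 3n. The recursion multiplies u^a' + v^a' by c i j k and
    subtracts the mixed terms u^a' v_i v_j v_k + v^a' u_i u_j u_k, whose words again differ in
    length by a multiple of 3. *)
Fixpoint Hw (n : nat) (a : seq T) : A :=
  match n with
  | 0 => 2
  | n1.+1 =>
    match a with
    | i :: j :: k :: a' =>
      match n1 with
      | 0 => c i j k
      | n2.+1 => c i j k * Hw n1 a' - Xw (Hw n2) a' [:: i; j; k]
      end
    | _ => 0
    end
  end.

Arguments Xw : simpl never.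
Arguments Hw : simpl never.

Hypothesis two_reg : forall x : A, 2 * x = 0 -> x = 0.
Hypothesis pC : forall i j, p i j = p j i.
Hypothesis c12 : forall i j k, c i j k = c j i k.
Hypothesis c23 : forall i j k, c i j k = c i k j.
Hypothesis E32 : forall j k l n r, R1 (fun x y => c x y r) j k l n = 0.
Hypothesis E222 : forall a b d e f g, minor3 a b d e f g = 0.
(** Both sides stand for u^ijklmn + v^ijklmn: the value does not change when the two triples
    exchange the letters i and l. *)
Hypothesis E42 : forall i j k l m n,
  c i j k * c l m n - Xw (Hw 0) [:: l; m; n] [:: i; j; k]
  = c l j k * c i m n - Xw (Hw 0) [:: i; m; n] [:: l; j; k].

Lemma R1_eq f g j k l n : (forall x y, f x y = g x y) -> R1 f j k l n = R1 g j k l n.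
Proof. by move=> fg; rewrite /R1 !fg. Qed.

Lemma R1_lin f g h (a b d : A) j k l n :
  R1 (fun x y => a * f x y + b * g x y - d * h x y) j k l n
  = a * R1 f j k l n + b * R1 g j k l n - d * R1 h j k l n.
Proof. rewrite /R1; ring. Qed.

Lemma XwS H j k l a b : Xw H (k :: l :: a) (j :: b) =
  p j k * Xw H (l :: a) b + p j l * Xw H (k :: a) b - p k l * Xw H (j :: a) b.
Proof. by []. Qed.

(** * Order independence for a fixed difference of word lengths *)

Section Level.
Variables (H : seq T -> A) (n0 : nat).
Local Notation X := (Xw H).

Definition permA d := forall a a' b, size b = d -> size a = (d + n0)%N ->
  perm_eq a a' -> X a b = X a' b.
Definition R1A d := forall j k l n a b, size b = d -> (size a).+2 = (d + n0)%N ->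
  R1 (fun x y => X (x :: y :: a) b) j k l n = 0.

(** Swapping the first two letters uses the symmetry of p, and a swap beyond the third letter is
    inherited from shorter words. The exchange of the second and third letters is the real case: the
    two expansions differ by an instance of [R1A d]. *)
Lemma permA_S d : permA d -> R1A d -> permA d.+1.
Proof.
move=> Pd Rd a a' [//|j b] [szb] sza.
apply: (adjacent_swap_perm (f := fun a => X a (j :: b)) _ sza).
case=> [|k [|l s1]] x y s2 /= sz.
- by rewrite !XwS (pC x y); ring.
- have E : R1 (fun z w => X (z :: w :: s2) b) j k x y = 0.
    by apply: Rd => //; move: sz; rewrite /= addSn => -[].
  rewrite /R1 in E.
  have sw : X (x :: y :: s2) b = X (y :: x :: s2) b.
    apply: Pd => //; first by move: sz; rewrite /= addSn => -[].
    by apply/permP => z /=; rewrite addnCA.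
  by apply: subr0_eq; rewrite !XwS -[RHS]E sw; ring.
- have E z : X (z :: s1 ++ x :: y :: s2) b = X (z :: s1 ++ y :: x :: s2) b.
    apply: Pd => //; first by move: sz; rewrite /= addSn => -[].
    rewrite perm_cons perm_cat2l.
    by apply/permP => w /=; rewrite addnCA.
  by rewrite !XwS !E.
Qed.

Lemma R1A_S d : (2 < d + n0)%N -> permA d -> permA d.+1 -> R1A d -> R1A d.+1.
Proof.
move=> dn Pd Pd1 Rd j k l n [|u [|v a]] [//|s b] //= [szb].
- by rewrite addSn => -[e]; rewrite -e in dn.
- by rewrite addSn => -[e]; rewrite -e in dn.
rewrite addSn => -[sza].
rewrite (@R1_eq _ (fun x y => p s u * X [:: x, y, v & a] b
   + p s v * X [:: x, y, u & a] b - p u v * X [:: x, y, s & a] b)).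
  by rewrite R1_lin !Rd // !mulr0 addr0 subr0.
move=> x y.
(* With u and v in front, the recursion consumes them and leaves x and y untouched in every term. *)
have -> : X [:: x, y, u, v & a] (s :: b) = X [:: u, v, x, y & a] (s :: b).
  apply: Pd1; rewrite /= ?szb ?addSn //= ?sza //.
  by apply/permP => z /=; ring.
rewrite XwS.
have E z w : perm_eq z w -> size z = (d + n0)%N -> X z b = X w b.
  by move=> zw sz; apply: Pd.
congr (_ * _ + _ * _ - _ * _); apply: E; rewrite //= ?sza //;
  apply/permP => z /=; ring.
Qed.

Hypothesis permA0 : permA 0.
(** [R1A_S] and [X_swapB] use four letters of the first word; these hypotheses supply the shorter
    words. *)
Hypothesis R1A_small : forall d, (d == 0) || (d + n0 <= 3)%N -> permA d -> R1A d.
Hypothesis permB_small : forall a j s b, ((size b).+2 + n0 < 4)%N ->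
  size a = ((size b).+2 + n0)%N -> X a (j :: s :: b) = X a (s :: j :: b).
Hypothesis H_small : n0 = 0 -> H [::] = 2.

Lemma permA_R1A d : permA d /\ R1A d.
Proof.
elim: d => [|d [Pd Rd]]; first by split=> //; apply: R1A_small.
have Pd1 := permA_S Pd Rd; split=> //.
case: (leqP (d.+1 + n0) 3) => [le|lt]; first by apply: R1A_small => //; rewrite le orbT.
by apply: R1A_S => //; rewrite -ltnS -addSn.
Qed.

Lemma X_permA a a' b : size a = (size b + n0)%N -> perm_eq a a' -> X a b = X a' b.
Proof. by have [Pd _] := permA_R1A (size b); apply: Pd. Qed.

(** With four letters k, l, u, v at hand, j can consume k and l while s consumes u and v, whichever
    of j and s comes first. *)
Lemma X_swapB a j s b : size a = ((size b).+2 + n0)%N ->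
  X a (j :: s :: b) = X a (s :: j :: b).
Proof.
move=> sza; case: (ltnP ((size b).+2 + n0) 4) => [lt|]; first exact: permB_small.
rewrite -sza; case: a sza => [|k [|l [|u [|v a]]]] //= sza _.
have {}sza : (size a).+2 = (size b + n0)%N by move: sza; rewrite !addSn => -[].
have F x y z w : X [:: x, y, z & a] (w :: b) =
    p w y * X [:: z, x & a] b + p w z * X [:: y, x & a] b - p y z * X [:: w, x & a] b.
  rewrite -XwS; apply: X_permA; first by rewrite /= addSn -sza.
  by apply/permP => q /=; ring.
have P2 x y : X [:: x, y & a] b = X [:: y, x & a] b.
  by apply: X_permA => //; apply/permP => z /=; rewrite addnCA.
have -> : X [:: k, l, u, v & a] (s :: j :: b) = X [:: u, v, k, l & a] (s :: j :: b).
  apply: X_permA; first by rewrite /= !addSn -sza.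
  by apply/permP => q /=; ring.
rewrite (XwS _ j k l) (XwS _ s u v) !F !(P2 v) !(P2 u).
rewrite (P2 s l) (P2 s k) (P2 s j); ring.
Qed.

Lemma X_permB a b b' : size a = (size b + n0)%N -> perm_eq b b' -> X a b = X a b'.
Proof.
elim: {b}(size b) {-2}b (erefl (size b)) b' a => [|d IHd] b szb b' a sza bb'.
  by move: bb'; rewrite (size0nil szb) => /perm_size/esym/size0nil ->.
rewrite szb in sza.
apply: (adjacent_swap_perm (f := X a) _ szb) bb'.
case=> [|j s1] x y s2 /= sz.
  by apply: X_swapB; rewrite sza -sz.
case: sz => sz; case: a sza => [|k [|l a]].
- by [].
- by rewrite addSn -sz size_cat /= addnS.
rewrite addSn => -[sza]; rewrite !XwS.
have E z : size z = (d + n0)%N -> X z (s1 ++ x :: y :: s2) = X z (s1 ++ y :: x :: s2).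
  move=> sz'; apply: IHd; rewrite ?sz // perm_cat2l.
  by apply/permP => w /=; rewrite addnCA.
by rewrite !E //=.
Qed.

(** In the model this multiplies u^a v^b + v^a u^b by u_i v_j + u_j v_i. *)
Lemma X_q_law i j a b : size a = (size b + n0)%N ->
  X (i :: a) (j :: b) + X (j :: a) (i :: b) = 2 * p i j * X a b.
Proof.
case: a => [|l a] sza.
  case: b sza => //= n00; rewrite -[Xw H [::] [::]]/(H [::]) H_small; last first.
    by rewrite -[n0]add0n -n00.
  rewrite -[Xw _ _ _]/(2 * p i j) -[X in _ + X]/(2 * p j i) (pC j i); ring.
by rewrite !XwS (pC j i) (pC i l) (pC j l); ring.
Qed.

(** The recursion with the roles of the two words exchanged. Its double is a combination of three
    instances of [X_q_law] in which the other terms cancel, so 2 must be regular. *)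
Lemma X_expandB s k l a b : size a = ((size b).+1 + n0)%N ->
  X (s :: a) (k :: l :: b) =
  p s k * X a (l :: b) + p s l * X a (k :: b) - p k l * X a (s :: b).
Proof.
move=> sza; apply: subr0_eq; apply: two_reg.
have q x y z := X_q_law x y (a := a) (b := z :: b) sza.
have sw x y z : X (x :: a) (y :: z :: b) = X (x :: a) (z :: y :: b).
  by apply: X_swapB; rewrite /= sza.
rewrite mulrBr mulrBr mulrDr !mulrA -!q (sw _ s l) (sw _ s k) (sw _ l k); ring.
Qed.

Lemma X_R1B j k l n a b : size a = ((size b).+2 + n0)%N ->
  R1 (fun x y => X a (x :: y :: b)) j k l n = 0.
Proof.
move=> sza; apply: two_reg; rewrite /R1 /=.
have q x y z w := X_q_law x y (a := a) (b := z :: w :: b) sza.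
have sw x y z w : X (x :: a) [:: y, z, w & b] = X (x :: a) [:: w, z, y & b].
  apply: X_permB; first by rewrite /= sza.
  by apply/permP => v /=; ring.
rewrite mulrDr !mulrBr !mulrA -!q.
have sw2 x z : X (x :: a) [:: j, k, z & b] = X (x :: a) [:: k, j, z & b].
  by apply: X_swapB; rewrite /= sza.
by rewrite (sw j l k n) (sw k l j n) (sw2 l n) (sw2 n l); ring.
Qed.

End Level.
Local Notation X K := (Xw (Hw K)).

(** Symmetry and the [R1] relation for [Hw K] alone, that is for an empty second word: the start of
    the induction on the second word at level K. *)
Definition good K := permA (Hw K) (3 * K) 0 /\ R1A (Hw K) (3 * K) 0.

(** For [ring], [p x y] and [p y x] are different atoms; these tactics sort the arguments of p by
    the given list of letters. *)
Ltac psort_with x ys :=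
  match ys with (?y, ?r) => rewrite ?(pC y x); psort_with x r | tt => idtac end.
Ltac psort l :=
  match l with (?x, ?r) => psort_with x r; psort r | tt => idtac end.

Lemma X0_11 i j : X 0 [:: i] [:: j] = 2 * p i j. Proof. by []. Qed.

Lemma R1A_22 j k l n r s : R1 (fun x y => X 0 [:: x; y] [:: r; s]) j k l n = 0.
Proof.
rewrite /R1 /= !XwS !X0_11.
transitivity (2 * minor3 j k n l r s - 2 * minor3 j k l n r s
              - 4 * minor3 j k r l n s).
  by rewrite /minor3; psort (j, (k, (l, (n, (r, (s, tt)))))); ring.
by rewrite !E222 !mulr0 !subr0 ?addr0.
Qed.

Lemma good0 : good 0.
Proof.
split=> [a a' [|//] _ _ _|j k l n a b szb]; first by [].
by [].
Qed.

(** At level 0, words of length 2 and 3 are too short for [R1A_S]; there the relation is a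
    combination of minors. *)
Lemma R1A0_small d : (d == 0%N) || (d + 0 <= 3)%N -> permA (Hw 0) 0 d -> R1A (Hw 0) 0 d.
Proof.
rewrite addn0 => d3 Pd j k l n a b szb; rewrite addn0 => sza.
case: d d3 Pd szb sza => [|[|[|[|]]]] // _ Pd szb [sza].
  move: (size0nil sza) => ->; case: b szb => [|r [|s []]] // _.
  exact: R1A_22.
case: a sza => [|u []] // _; case: b szb => [|r [|s [|t []]]] // _.
rewrite (@R1_eq _ (fun x y => X 0 [:: u; x; y] [:: r; s; t])); last first.
  by move=> x y; apply: Pd => //; apply/permP => z /=; ring.
transitivity (p r u * R1 (fun x y => X 0 [:: x; y] [:: s; t]) j k l n
  + 2 * p t l * minor3 j k s n u r - 2 * p t n * minor3 j k s l u r
  + 2 * p s l * minor3 j k t n u r - 2 * p s n * minor3 j k t l u r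
  + 2 * p s t * minor3 j k n l u r - 2 * p s t * minor3 j k l n u r).
  rewrite /R1 /minor3 /= !XwS !X0_11.
  by psort (j, (k, (l, (n, (u, (r, (s, (t, tt)))))))); ring.
by rewrite !E222 R1A_22 !mulr0 !subr0 !addr0.
Qed.

Lemma permB0_small a j s b : ((size b).+2 + 0 < 4)%N ->
  size a = ((size b).+2 + 0)%N -> X 0 a (j :: s :: b) = X 0 a (s :: j :: b).
Proof.
rewrite addn0; case: b => [|r []] // _ sza.
  case: a sza => [|k [|l []]] // _; rewrite !XwS !X0_11.
  by psort (j, (k, (l, (s, tt)))); ring.
case: a sza => [|k [|l [|u []]]] // _; rewrite !XwS !X0_11.
apply: subr0_eq; transitivity (2 * minor3 k l j u s r - 4 * minor3 k l u j s r
  - 2 * minor3 k l s u j r - 4 * minor3 k u j l s r + 4 * minor3 k u s l j r).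
  by rewrite /minor3; psort (j, (k, (l, (u, (r, (s, tt)))))); ring.
by rewrite !E222 !mulr0 !subr0 ?addr0.
Qed.

Definition laws K :=
  [/\ forall a a' b, size a = (size b + 3 * K)%N -> perm_eq a a' ->
       X K a b = X K a' b,
      forall a b b', size a = (size b + 3 * K)%N -> perm_eq b b' ->
       X K a b = X K a b',
      forall i j a b, size a = (size b + 3 * K)%N ->
       X K (i :: a) (j :: b) + X K (j :: a) (i :: b) = 2 * p i j * X K a b,
      forall s k l a b, size a = ((size b).+1 + 3 * K)%N ->
       X K (s :: a) (k :: l :: b) =
       p s k * X K a (l :: b) + p s l * X K a (k :: b) - p k l * X K a (s :: b)
    & forall j k l n a b, size a = ((size b).+2 + 3 * K)%N ->
       R1 (fun x y => X K a (x :: y :: b)) j k l n = 0].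

(** For K > 0 the first word has at least 3K letters, so the only exceptional case of [R1A] is the
    empty second word, which [good] covers. For K = 0 the short cases follow from [E222]. *)
Lemma good_laws K : good K -> laws K.
Proof.
case=> PK RK.
have RS d : (d == 0%N) || (d + 3 * K <= 3)%N -> permA (Hw K) (3 * K) d ->
    R1A (Hw K) (3 * K) d.
  case: K {PK} RK => [|K] RK; first by rewrite muln0; exact: R1A0_small.
  case: d => [_ _|d]; first exact: RK.
  by rewrite mulnS addnCA -[Y in (_ <= Y)%N](addn0 3) leq_add2l.
have PS a j s b : ((size b).+2 + 3 * K < 4)%N ->
    size a = ((size b).+2 + 3 * K)%N -> X K a (j :: s :: b) = X K a (s :: j :: b).
  case: K {PK RK RS} => [|K]; first by rewrite muln0; exact: permB0_small.
  by rewrite mulnS addnCA -[4%N]/(3 + 1)%N ltn_add2l.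
have HS : (3 * K)%N = 0%N -> Hw K [::] = 2 by case: (K).
split.
- by move=> a a' b; apply: X_permA PK RS _ _ _.
- by move=> a b b'; apply: X_permB PK RS PS _ _ _.
- by move=> i j a b; apply: X_q_law HS _ _ _ _.
- by move=> s k l a b; apply: X_expandB PK RS PS HS _ _ _ _ _.
- by move=> j k l n a b; apply: X_R1B PK RS PS HS _ _ _ _ _ _.
Qed.

Lemma Hw1 i j k a : Hw 1 (i :: j :: k :: a) = c i j k.
Proof. by []. Qed.

Lemma HwSS K i j k a :
  Hw K.+2 (i :: j :: k :: a) = c i j k * Hw K.+1 a - X K a [:: i; j; k].
Proof. by []. Qed.

Lemma Xw0 H a : Xw H a [::] = H a. Proof. by []. Qed.

Lemma X0_sym : laws 0 -> forall a b, size a = size b -> X 0 a b = X 0 b a.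
Proof.
case=> _ _ _ XE _ a b; elim: b a => [|s b IHb] [|u [|v a]] //= [sza].
  by move: (size0nil (esym sza)) => ->; rewrite !X0_11 pC.
by rewrite XwS !IHb ?XE ?sza ?muln0 ?addn0 //=.
Qed.

Lemma X0_c_law : laws 0 -> laws 1 -> forall i j k a b, size a = size b ->
  c i j k * X 0 a b = X 1 (i :: j :: k :: a) b + X 1 (i :: j :: k :: b) a.
Proof.
move=> [_ _ _ E0 _] [PA1 PB1 Q1 E1 _] i j k a b.
have perm4 x a' : perm_eq [:: i, j, k, x & a'] [:: x, i, j, k & a'].
  by apply/permP => z /=; ring.
elim: b a => [|s b IHb] [|u [|v a]] //= sza.
- by rewrite !Xw0 !Hw1 -[Hw 0 _]/2; ring.
- case: sza => sza; move: (size0nil (esym sza)) => ->; rewrite X0_11 mulrC.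
  have := Q1 u s [:: i; j; k] [::] erefl; rewrite [Y in _ = _ * Y]Xw0 Hw1 => <-.
  by congr (_ + _); apply: PA1 => //; rewrite perm_sym.
have {}sza : size b = (size a).+1 by case: sza.
have PA5 : X 1 [:: i, j, k, u, v & a] (s :: b) = X 1 [:: u, v, i, j, k & a] (s :: b).
  apply: PA1; first by rewrite /= sza muln1 addn3.
  by apply/permP => z /=; ring.
rewrite PA5 (PA1 _ _ _ _ (perm4 s b)); last by rewrite /= sza muln1 addn3.
rewrite E1; last by rewrite /= sza muln1 addn3.
rewrite !(XwS _ s u v) mulrBr mulrDr !(mulrCA (c i j k)) !IHb /= ?sza //.
have PA4 x : X 1 [:: x, i, j, k & a] b = X 1 [:: i, j, k, x & a] b.
  by apply/esym/PA1 => //=; rewrite sza muln1 addn3.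
by rewrite !PA4; ring.
Qed.

(** For an empty second word this is the recursion defining [Hw K.+2]. In the induction on b, the
    letters i, j, k are kept out of the way of the expansion by permuting them behind the consumed
    ones. *)
Lemma X_c_law K : laws K -> laws K.+2 ->
  forall i j k a b, size a = (size b + 3 * K.+1)%N ->
  c i j k * X K.+1 a b = X K.+2 (i :: j :: k :: a) b + X K a (i :: j :: k :: b).
Proof.
move=> [_ PB _ _ _] [PA _ _ _ _] i j k a b.
have perm4 x a' : perm_eq [:: x, i, j, k & a'] [:: i, j, k, x & a'].
  by apply/permP => z /=; ring.
elim: b a => [|s b IHb] a sza; first by rewrite !Xw0 HwSS; ring.
case: a sza => [|u [|v a]] sza.
- by [].
- by exfalso; move: sza => /=; lia.
have {}sza : (size a).+1 = (size b + 3 * K.+1)%N by case: sza.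
have PA5 : X K.+2 [:: i, j, k, u, v & a] (s :: b) = X K.+2 [:: u, v, i, j, k & a] (s :: b).
  apply: PA; last by apply/permP => z /=; ring.
  by move: sza => /=; lia.
rewrite PA5 -(PB _ _ _ _ (perm4 s b)); last first.
  by move: sza => /=; lia.
rewrite !(XwS _ s u v) mulrBr mulrDr !(mulrCA (c i j k)) !IHb //=.
have PA4 x : X K.+2 [:: x, i, j, k & a] b = X K.+2 [:: i, j, k, x & a] b.
  by apply: PA => //; move: sza => /=; lia.
by rewrite !PA4; ring.
Qed.

(** By the laws for multiplication by c, both sides are the value attached to a and the six letters
    i, j, k, l, m, n, in which the order of the triples does not matter. Only levels up to K+1
    enter, so the identity is available while level K+2 is being built. *)
Lemma X_c_law_sym K : (forall k, (k <= K.+1)%N -> good k) ->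
  forall i j k l m n a, size a = (3 + 3 * K)%N ->
  c l m n * X K a [:: i; j; k] - X K.+1 (l :: m :: n :: a) [:: i; j; k]
  = c i j k * X K a [:: l; m; n] - X K.+1 (i :: j :: k :: a) [:: l; m; n].
Proof.
move=> gK i j k l m n a sza.
have L1 := good_laws (gK _ (leqnn K.+1)).
have L0 := good_laws (gK _ (leqnSn K)).
have perm6 : perm_eq [:: i; j; k; l; m; n] [:: l; m; n; i; j; k].
  by rewrite (perm_catC [:: i; j; k] [:: l; m; n]).
case: K gK sza L0 L1 => [|K] gK sza L0 L1.
  rewrite !X0_c_law //.
  have [PA _ _ _ _] := L1; rewrite (PA [:: i; j; k; l; m; n] _ _ _ perm6) //=; last by move: sza => /=; lia.
  by ring.
have [_ PB _ _ _] := good_laws (gK K (leqW (leqnSn K))).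
rewrite !(X_c_law _ L1) //; try exact: good_laws (gK K (leqW (leqnSn K))).
rewrite (PB _ _ _ _ perm6); first ring.
by move: sza => /=; lia.
Qed.

Lemma good1 : good 1.
Proof.
split; last first.
  move=> j k l n [|r [|? ?]] [|//] //= _ _.
  by rewrite -(E32 j k l n r); exact: R1_eq.
move=> a a' [|//] _ sza; apply: (adjacent_swap_perm (f := fun a => X 1 a [::]) _ sza).
move=> [|i [|j [|k s1]]] x y s2 /= sz.
- by case: s2 sz => [|z []] // _; rewrite !Xw0 !Hw1.
- by case: s2 sz => [|z []] // _; rewrite !Xw0 !Hw1.
- by case: s2 sz.
- by move: sz; rewrite size_cat /= !addnS.
Qed.

Lemma goodSS K : (forall k, (k <= K.+1)%N -> good k) -> good K.+2.
Proof.
move=> gK; have [PA0 PB0 _ _ RB0] := good_laws (gK _ (leqnSn K)).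
have [PA1 _ _ _ _] := good_laws (gK _ (leqnn K.+1)).
split; last first.
  move=> j k l n [|r a] [|//] _ /= sza; first by exfalso; move: sza; lia.
  rewrite (@R1_eq _ (fun x y => Hw K.+1 a * c x y r + 0 * 0 - 1 * X K a [:: x; y; r])).
    rewrite R1_lin E32 RB0; last by move: sza => /=; lia.
    by rewrite /R1; ring.
  by move=> x y; rewrite Xw0 HwSS; ring.
move=> a a' [|//] _ sza; apply: (adjacent_swap_perm (f := fun a => X K.+2 a [::]) _ sza).
move=> [|i [|j [|k s1]]] x y s2 /=; rewrite !Xw0.
- case: s2 => [|z a2] sz; first by exfalso; move: sz => /=; lia.
  rewrite !HwSS c12 (PB0 _ _ [:: y; x; z]) //; first by move: sz => /=; lia.
  by apply/permP => w /=; ring.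
- move=> sz; rewrite !HwSS c23 (PB0 _ _ [:: i; y; x]) //; first by move: sz => /=; lia.
  by apply/permP => w /=; ring.
(* The exchange of the third and fourth letters crosses the border of the first triple. With six
   letters in all it is [E42]; otherwise three further letters l, m, n are split off as a second
   triple. *)
- move=> sz; case: K gK PA0 PB0 RB0 PA1 sz {sza} => [|K] gK PA0 PB0 RB0 PA1 sz.
    case: s2 sz => [|m [|n [|? ?]]] sz; try by exfalso; move: sz => /=; lia.
    rewrite !HwSS !Hw1 (c12 i j x) (c23 j i x) (c12 j x i) (c12 i j y) (c23 j i y) (c12 j y i).
    have PB3 z a2 : size a2 = 3%N -> X 0 a2 [:: i; j; z] = X 0 a2 [:: z; i; j].
      by move=> sz'; apply: PB0; rewrite ?sz' //; apply/permP => w /=; ring.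
    rewrite !PB3 // (c23 x j i) (c23 y j i); exact: E42.
  case: s2 sz => [|l [|m [|n a2]]] sz; try by exfalso; move: sz => /=; lia.
  have {}sz : size a2 = (2 + 3 * K)%N by move: sz => /=; lia.
  have HA z w : size z = (6 + 3 * K)%N -> perm_eq z w -> Hw K.+2 z = Hw K.+2 w.
    by move=> szz zw; apply: (PA1 z w [::] _ zw); rewrite /= szz; lia.
  have rot z : Hw K.+2 [:: z, l, m, n & a2] = Hw K.+2 [:: l, m, n, z & a2].
    by apply: HA => /=; [lia|apply/permP => w /=; ring].
  have exch : Hw K.+2 [:: i, j, x, y & a2] = Hw K.+2 [:: i, j, y, x & a2].
    by apply: HA => /=; [lia|apply/permP => w /=; ring].
  have PA : X K.+1 [:: i, j, x, y & a2] [:: l; m; n] = X K.+1 [:: i, j, y, x & a2] [:: l; m; n].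
    by apply: PA0 => /=; [lia|apply/permP => w /=; ring].
  have rotX z u v w : X K.+1 [:: z, l, m, n & a2] [:: u; v; w]
                    = X K.+1 [:: l, m, n, z & a2] [:: u; v; w].
    by apply: PA0 => /=; [lia|apply/permP => q /=; ring].
  have S z u v w : size [:: z & a2] = (3 + 3 * K)%N by rewrite /= sz; lia.
  have cs z w := X_c_law_sym (fun k (kK : (k <= K.+1)%N) => gK k (leqW kK)) i j z l m n (a := w :: a2).
  have csx := cs x y; have csy := cs y x.
  rewrite 2!(HwSS K.+1) !rot !rotX 2!(HwSS K l m n).
  rewrite !HwSS in exch.
  apply: subr0_eq.
  (* The first summand vanishes by [exch], the same exchange without l, m, n; the two brackets after
     it are rewritten by [X_c_law_sym]. *)
  transitivity (c l m n * (c i j x * Hw K.+1 (y :: a2) - X K (y :: a2) [:: i; j; x]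
     - (c i j y * Hw K.+1 (x :: a2) - X K (x :: a2) [:: i; j; y]))
     + (c l m n * X K (y :: a2) [:: i; j; x] - X K.+1 [:: l, m, n, y & a2] [:: i; j; x])
     - (c l m n * X K (x :: a2) [:: i; j; y] - X K.+1 [:: l, m, n, x & a2] [:: i; j; y])
     - c i j x * X K (y :: a2) [:: l; m; n] + c i j y * X K (x :: a2) [:: l; m; n]); first by ring.
  by rewrite exch csx ?csy ?PA /= ?sz //; [ring|lia..].
- move=> sz; rewrite !HwSS.
  have perm_xy : perm_eq (s1 ++ x :: y :: s2) (s1 ++ y :: x :: s2).
    by rewrite perm_cat2l; apply/permP => w /=; rewrite addnCA.
  rewrite (PA0 _ _ _ _ perm_xy); last by move: sz => /=; lia.
  congr (_ * _ - _); apply: (PA1 (s1 ++ x :: y :: s2) (s1 ++ y :: x :: s2) [::] _ perm_xy).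
  by move: sz => /=; lia.
Qed.

Lemma all_good K : good K.
Proof.
elim: K {-2}K (leqnn K) => [|K IHK] k; first by rewrite leqn0 => /eqP->; exact: good0.
rewrite leq_eqVlt ltnS => /orP[/eqP->|]; last exact: IHK.
case: K IHK => [|K] IHK; first exact: good1.
exact: goodSS.
Qed.

(* u^a v^b + v^a u^b; words with sizes incongruent mod 3 are killed by the cyclic
   group that permutes the rows. *)
Definition XX (a b : seq T) : A :=
  if (size a == size b %[mod 3])%N then
    if (size b <= size a)%N then X ((size a - size b) %/ 3) a b
    else X ((size b - size a) %/ 3) b a
  else 0.

Lemma XX_sym a b : XX a b = XX b a.
Proof.
rewrite /XX eq_sym; case: ifP => // _; case: (ltngtP (size a) (size b)) => // ab.
by rewrite ab subnn div0n; apply: X0_sym => //; exact: good_laws (all_good 0).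
Qed.

Lemma XXE K a b : size a = (size b + 3 * K)%N -> XX a b = X K a b.
Proof.
by move=> sab; rewrite /XX sab leq_addr addKn mulKn // addnC mulnC modnMDl eqxx.
Qed.

Lemma XX0 a b : (size a != size b %[mod 3])%N -> XX a b = 0.
Proof. by rewrite /XX => /negbTE->. Qed.

Lemma XX_cases (a b : seq T) :
  [\/ exists K, size a = (size b + 3 * K)%N, exists K, size b = (size a + 3 * K.+1)%N
    | (size a != size b %[mod 3])%N].
Proof.
have [ab|ab] := eqVneq (size a %% 3)%N (size b %% 3)%N; last by constructor 3.
case: (leqP (size b) (size a)) => le; [constructor 1|constructor 2].
  by exists ((size a - size b) %/ 3)%N; lia.
by exists ((size b - size a) %/ 3).-1; lia.
Qed.

Lemma XX_perm a a' b b' : perm_eq a a' -> perm_eq b b' -> XX a b = XX a' b'.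
Proof.
move=> aa bb; have sa := perm_size aa; have sb := perm_size bb.
have main K u u' v v' : size u = (size v + 3 * K)%N -> perm_eq u u' -> perm_eq v v' ->
    XX u v = XX u' v'.
  move=> suv uu vv; have [PA PB _ _ _] := good_laws (all_good K).
  rewrite (XXE suv) (PA _ _ _ suv uu) (PB _ _ _ _ vv) -?(perm_size uu) //.
  by rewrite (@XXE K) // -(perm_size uu) -(perm_size vv).
case: (XX_cases a b) => [[K]|[K]|ab]; first by move/main; apply.
  by rewrite XX_sym (XX_sym a') => /main; apply.
by rewrite !XX0 // -sa -sb.
Qed.

Lemma XX_q i j a b : XX (i :: a) (j :: b) + XX (j :: a) (i :: b) = 2 * p i j * XX a b.
Proof.
case: (XX_cases a b) => [[K sab]|[K sab]|ab].
- by have [_ _ Q _ _] := good_laws (all_good K); rewrite !(@XXE K) ?Q //= sab.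
- have [_ _ Q _ _] := good_laws (all_good K.+1).
  by rewrite (XX_sym a) addrC 2!(XX_sym (_ :: a)) !(@XXE K.+1) ?Q //= sab.
by rewrite !XX0 ?mulr0 ?addr0 //=; lia.
Qed.

Lemma XX_c i j k a b :
  XX (i :: j :: k :: a) b + XX a (i :: j :: k :: b) = c i j k * XX a b.
Proof.
have main K u v : size u = (size v + 3 * K)%N ->
    XX (i :: j :: k :: u) v + XX u (i :: j :: k :: v) = c i j k * XX u v.
  move=> suv; have L K1 := good_laws (all_good K1); rewrite (XXE suv).
  case: K suv => [|K] suv; last first.
    by rewrite (X_c_law (L K)) // (@XXE K.+2) ?(@XXE K) //= suv; lia.
  have suv' : size u = size v by lia.
  rewrite X0_c_law // (XX_sym u) !(@XXE 1) //=; lia.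
case: (XX_cases a b) => [[K /main //]|[K /main E]|ab].
  by rewrite addrC !(XX_sym a) (XX_sym _ b) E.
by rewrite !XX0 ?mulr0 ?addr0 //=; lia.
Qed.

End Products.

(** * Polarization of the relations *)

Section Polarization.
Variables (A : comNzRingType) (W : zmodType).
Hypothesis nat_reg : forall (n : nat) (x : A), n.+1%:R * x = 0 -> x = 0.

Let lincomb3 (a b d x y z : A) : x = 0 -> y = 0 -> z = 0 -> a * x + b * y + d * z = 0.
Proof. by move=> -> -> ->; rewrite !mulr0 !addr0. Qed.

Lemma polarize2 (f : W -> W -> A) :
  (forall x y z, f (x + y) z = f x z + f y z) -> (forall x y, f x y = f y x) ->
  (forall x, f x x = 0) -> forall x y, f x y = 0.
Proof.
move=> fD fC f0 x y; apply: (nat_reg (n := 1)).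
have := f0 (x + y); rewrite fD !(fC _ (x + y)) !fD !f0 (fC y x) => E.
by rewrite -[RHS]E; ring.
Qed.

Lemma polarize3 (f : W -> W -> W -> A) :
  (forall x y z w, f (x + y) z w = f x z w + f y z w) ->
  (forall x y z, f x y z = f y x z) -> (forall x y z, f x y z = f x z y) ->
  (forall x, f x x x = 0) -> forall x y z, f x y z = 0.
Proof.
move=> fD f12 f23 f0 x y z; apply: (polarize2 (f := fun x y => f x y z)) => {x y} //.
move=> x.
have fD2 a b d e : f a (b + d) e = f a b e + f a d e by rewrite f12 fD !(f12 _ a).
have fD3 a b d e : f a b (d + e) = f a b d + f a b e by rewrite f23 fD2 !(f23 a _ b).
(* Four times the value at x + z minus the value at x + 2z is 6 f x x z. *)
apply: (nat_reg (n := 5)).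
have E1 := f0 (x + z); have E2 := f0 (x + z + z).
have e1 : f x z x = f x x z by rewrite f23.
have e2 : f z x x = f x x z by rewrite f12.
have g1 : f z x z = f x z z by rewrite f12.
have g2 : f z z x = f x z z by rewrite f23.
move: E1 E2; rewrite !(fD, fD2, fD3) !f0 !(e1, e2, g1, g2) => E1 E2.
by rewrite -[RHS](lincomb3 4 (-1) 0 E1 E2 E2); ring.
Qed.

Lemma polarize4 (f : W -> W -> W -> W -> A) :
  (forall x y z w u, f (x + y) z w u = f x z w u + f y z w u) ->
  (forall x y z w, f x y z w = f y x z w) -> (forall x y z w, f x y z w = f x z y w) ->
  (forall x y z w, f x y z w = f x y w z) ->
  (forall x, f x x x x = 0) -> forall x y z w, f x y z w = 0.
Proof.
move=> fD f12 f23 f34 f0 x y z w.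
apply: (polarize3 (f := fun x y z => f x y z w)) => {x y z} // x.
have fD2 a b d e g : f a (b + d) e g = f a b e g + f a d e g by rewrite f12 fD !(f12 _ a).
have fD3 a b d e g : f a b (d + e) g = f a b d g + f a b e g by rewrite f23 fD2 !(f23 a _ b).
have fD4 a b d e g : f a b d (e + g) = f a b d e + f a b d g.
  by rewrite f34 fD3 !(f34 a b _ d).
(* The values at x + w, x + 2w, x + 3w with coefficients 18, -9, 2 isolate 24 f x x x w. *)
apply: (nat_reg (n := 23)).
have E1 := f0 (x + w); have E2 := f0 (x + w + w); have E3 := f0 (x + w + w + w).
have e1 : f x x w x = f x x x w by rewrite f34.
have e2 : f x w x x = f x x x w by rewrite f23.
have e3 : f w x x x = f x x x w by rewrite f12.
have g1 : f x w x w = f x x w w by rewrite f23.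
have g2 : f x w w x = f x x w w by rewrite f34 g1.
have g3 : f w x x w = f x x w w by rewrite f12 g1.
have g4 : f w x w x = f x x w w by rewrite f12 g2.
have g5 : f w w x x = f x x w w by rewrite f23 g4.
have h1 : f w x w w = f x w w w by rewrite f12.
have h2 : f w w x w = f x w w w by rewrite f23.
have h3 : f w w w x = f x w w w by rewrite f34.
move: E1 E2 E3; rewrite !(fD, fD2, fD3, fD4) !f0.
rewrite !(e1, e2, e3, g1, g2, g3, g4, g5, h1, h2, h3) => E1 E2 E3.
by rewrite -[RHS](lincomb3 18 (-9) 2 E1 E2 E3); ring.
Qed.

Variables (p : W -> W -> A) (c : W -> W -> W -> A).
Hypothesis pD : forall x y z, p (x + y) z = p x z + p y z.
Hypothesis pC : forall x y, p x y = p y x.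
Hypothesis cD : forall x y z w, c (x + y) z w = c x z w + c y z w.
Hypothesis c12 : forall i j k, c i j k = c j i k.
Hypothesis c23 : forall i j k, c i j k = c i k j.

Let pD2 x y z : p x (y + z) = p x y + p x z.
Proof. by rewrite pC pD !(pC _ x). Qed.
Let cD2 x y z w : c x (y + z) w = c x y w + c x z w.
Proof. by rewrite c12 cD !(c12 _ x). Qed.
Let cD3 x y z w : c x y (z + w) = c x y z + c x y w.
Proof. by rewrite c23 cD2 !(c23 x _ y). Qed.

Ltac pc_sort_with x ys :=
  match ys with
  | (?y, ?r) => rewrite ?(pC y x) ?(c12 y x) ?(fun z => c23 z y x); pc_sort_with x r
  | tt => idtac
  end.
Ltac pc_sort l :=
  match l with (?x, ?r) => pc_sort_with x r; pc_sort r | tt => idtac end.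
Ltac pcring l := pc_sort l; pc_sort l; ring.

Section Gram.
Hypothesis gram : forall x y z, minor3 p x y z x y z = 0.

(** The Gram determinant of three vectors is quadratic in each of them; this is its polarization
    along the pairs (a, d), (b, e), (g, f), up to a factor: on the diagonal it is 4 times the
    determinant. *)
Definition gram_polar a d b e g f : A :=
  minor3 p a b g d e f + minor3 p a b f d e g + minor3 p a e g d b f
  + minor3 p a e f d b g.

Lemma gram_polar0 a d b e g f : gram_polar a d b e g f = 0.
Proof.
move: a d; apply: polarize2.
- by move=> x y z; rewrite /gram_polar /minor3 !(pD, pD2); ring.
- by move=> x y; rewrite /gram_polar /minor3; pcring (x, (y, (b, (e, (g, (f, tt)))))).
move=> x; move: b e; apply: polarize2.
- by move=> y z w; rewrite /gram_polar /minor3 !(pD, pD2); ring.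
- by move=> y z; rewrite /gram_polar /minor3; pcring (x, (y, (z, (g, (f, tt))))).
move=> y; move: g f; apply: polarize2.
- by move=> z w b; rewrite /gram_polar /minor3 !(pD, pD2); ring.
- by move=> z w; rewrite /gram_polar /minor3; pcring (x, (y, (z, (w, tt)))).
move=> z; transitivity (4 * minor3 p x y z x y z); last by rewrite gram mulr0.
by rewrite /gram_polar /minor3; pcring (x, (y, (z, tt))).
Qed.

(** Principal minors determine all minors: summing the polarized Gram determinant over the three
    cyclic matchings of rows with columns gives 6 times the minor. *)
Lemma minor3_0 a b d e f g : minor3 p a b d e f g = 0.
Proof.
apply: (nat_reg (n := 5)).
transitivity (gram_polar a e b f d g + gram_polar a f b g d e + gram_polar a g b e d f).
  by rewrite /gram_polar /minor3; pcring (a, (b, (d, (e, (f, (g, tt)))))).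
by rewrite !gram_polar0 !addr0.
Qed.

End Gram.

Section Rel32.
Hypothesis rel : forall x y, p x x * c y y x - 2 * p x y * c x x y + p y y * c x x x = 0.

(** The relation is cubic in one vector and quadratic in the other; these are polarized to x, y, z
    and to u, v. The normalization gives 3 times the relation on the diagonal. *)
Definition polar32 x y z u v : A :=
  p x y * c u v z + p x z * c u v y + p y z * c u v x
  - p x u * c y z v - p x v * c y z u - p y u * c x z v - p y v * c x z u
  - p z u * c x y v - p z v * c x y u + 3 * p u v * c x y z.

Lemma polar32_0 x y z u v : polar32 x y z u v = 0.
Proof.
move: u v; apply: polarize2 => [u v w|u v|u].
- by rewrite /polar32 !(pD, pD2, cD, cD2, cD3); ring.
- by rewrite /polar32; pcring (u, (v, (x, (y, (z, tt))))).
move: x y z; apply: polarize3 => [x y z w|x y z|x y z|x].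
- by rewrite /polar32 !(pD, pD2, cD, cD2, cD3); ring.
- by rewrite /polar32; pcring (u, (x, (y, (z, tt)))).
- by rewrite /polar32; pcring (u, (x, (y, (z, tt)))).
rewrite -(mulr0 3) -(rel x u) /polar32; pcring (u, (x, tt)).
Qed.

(** Antisymmetrizing [polar32] in j, k and in l, n leaves 6 times [R1]. *)
Lemma R1_polar j k l n r : R1 p (fun x y => c x y r) j k l n = 0.
Proof.
apply: (nat_reg (n := 5)).
transitivity (polar32 k n r j l - polar32 k l r j n - polar32 j n r k l + polar32 j l r k n).
  by rewrite /R1 /polar32; pcring (j, (k, (l, (n, (r, tt))))).
by rewrite !polar32_0 !subr0 addr0.
Qed.

End Rel32.

Section Rel42.
Hypothesis rel : forall x y, c x x y ^+ 2 - c x x x * c x y y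
  - 4 * p x x ^+ 2 * p y y + 4 * p x x * p x y ^+ 2 = 0.
Hypothesis minors : forall a b d e f g, minor3 p a b d e f g = 0.

(** Polarization of a relation quartic in one vector and quadratic in the other; [h] is summed over
    the three pairings of x, y, z, w, and on the diagonal the result is 12 times the relation. *)
Definition polar42 x y z w u v : A :=
  let h a b a' b' := 2 * (c a b u * c a' b' v + c a' b' u * c a b v)
    + 4 * (p a b * (p a' u * p b' v + p a' v * p b' u)
           + p a' b' * (p a u * p b v + p a v * p b u))
    - 16 * p a b * p a' b' * p u v in
  h x y z w + h x z y w + h x w y z
  - 3 * (c x y z * c w u v + c x y w * c z u v + c x z w * c y u v + c y z w * c x u v).

Lemma polar42_0 x y z w u v : polar42 x y z w u v = 0.
Proof.
move: u v; apply: polarize2 => [u v a|u v|u].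
- by rewrite /polar42 !(pD, pD2, cD, cD2, cD3); ring.
- by rewrite /polar42; pcring (u, (v, (x, (y, (z, (w, tt)))))).
move: x y z w; apply: polarize4 => [x y z w a|x y z w|x y z w|x y z w|x].
- by rewrite /polar42 !(pD, pD2, cD, cD2, cD3); ring.
- by rewrite /polar42; pcring (u, (x, (y, (z, (w, tt))))).
- by rewrite /polar42; pcring (u, (x, (y, (z, (w, tt))))).
- by rewrite /polar42; pcring (u, (x, (y, (z, (w, tt))))).
rewrite -(mulr0 12) -(rel x u) /polar42; pcring (u, (x, tt)).
Qed.

(* The coefficients were found by solving a linear system. *)
Lemma exchange_polar i j k l m n :
  c i j k * c l m n - Xw p (Hw p c 0) [:: l; m; n] [:: i; j; k]
  = c l j k * c i m n - Xw p (Hw p c 0) [:: i; m; n] [:: l; j; k].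
Proof.
apply/eqP; rewrite -subr_eq0; apply/eqP; apply: (nat_reg (n := 9)).
transitivity (polar42 i k m n j l + polar42 i j m n k l - polar42 k l m n i j
  - polar42 j l m n i k - 20 * minor3 p i j l k m n - 20 * minor3 p i k l j m n).
  rewrite /= /polar42 /minor3; pcring (i, (j, (k, (l, (m, (n, tt)))))).
by rewrite !polar42_0 !minors !mulr0 !subr0 !addr0.
Qed.

End Rel42.
End Polarization.

(** * The forms J *)

Section MonomialExtension.
Variables (C : nzRingType) (n : nat) (V : zmodType) (g : 'X_{1..n} -> C -> V).
Hypothesis gD : forall u a b, g u (a + b) = g u a + g u b.

(** The coefficient is an argument of [g], so that the target need only be an abelian group and no
    scalar action on it is involved. *)
Definition monext (p : {mpoly C[n]}) : V := \sum_(u <- msupp p) g u p@_u.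

Let g0 u : g u 0 = 0.
Proof. by apply: (addrI (g u 0)); rewrite -gD !addr0. Qed.

Lemma monextE (r : seq 'X_{1..n}) p : uniq r -> {subset msupp p <= r} ->
  monext p = \sum_(u <- r) g u p@_u.
Proof.
move=> ur pr; rewrite [RHS](bigID (mem (msupp p))) /= [X in _ + X]big1 ?addr0.
  rewrite -big_filter; apply: perm_big; apply: uniq_perm.
  - exact: msupp_uniq.
  - exact: filter_uniq.
  by move=> u; rewrite mem_filter andb_idr // => /pr.
by move=> u /memN_msupp_eq0->.
Qed.

Lemma monextD p q : monext (p + q) = monext p + monext q.
Proof.
pose r := undup (msupp p ++ msupp q ++ msupp (p + q)).
have sub s : {subset s <= msupp p ++ msupp q ++ msupp (p + q)} -> {subset s <= r}.
  by move=> sr u /sr; rewrite mem_undup.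
rewrite !(@monextE r) ?undup_uniq //; first last.
- by apply: sub => u; rewrite !mem_cat => ->; rewrite ?orbT.
- by apply: sub => u; rewrite !mem_cat => ->; rewrite ?orbT.
- by apply: sub => u; rewrite !mem_cat => ->; rewrite ?orbT.
by rewrite -big_split; apply: eq_bigr => u _; rewrite mcoeffD gD.
Qed.

Lemma monext0 : monext 0 = 0.
Proof. by rewrite /monext msupp0 big_nil. Qed.

Lemma monextZX a u : monext (a *: 'X_[u]) = g u a.
Proof.
have [->|a0] := eqVneq a 0; first by rewrite scale0r monext0 g0.
by rewrite /monext msuppMCX // big_seq1 mcoeffZ mcoeffX eqxx mulr1.
Qed.

End MonomialExtension.

Section Words.
Variable m : nat.

Definition word (i : 'I_3) (u : 'X_{1..3 * m}) : seq 'I_m :=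
  flatten [seq nseq (u (mxvec_index i j)) j | j <- enum 'I_m].

Lemma count_word a i u :
  count a (word i u) = (\sum_j a j * u (mxvec_index i j))%N.
Proof.
rewrite /word count_flatten -map_comp sumnE big_map big_enum /=.
by apply: eq_bigr => j _; rewrite count_nseq.
Qed.

Lemma word0 i : word i 0%MM = [::].
Proof.
apply/nilP; rewrite /nilp -(count_predT (word i _)) count_word big1 // => j _.
by rewrite mnm0E muln0.
Qed.

Lemma mxvec_index_eq (i i' : 'I_3) (j j' : 'I_m) :
  (mxvec_index i j == mxvec_index i' j') = (i == i') && (j == j').
Proof. by rewrite (inj_eq (@cast_ord_inj _ _ _)) (inj_eq enum_rank_inj). Qed.

Lemma word_addU i i' j u :
  perm_eq (word i (u + U_(mxvec_index i' j))) (if i == i' then j :: word i u else word i u).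
Proof.
apply/permP => a.
have -> : count a (if i == i' then j :: word i u else word i u)
    = ((i == i') * a j + count a (word i u))%N by case: eqP => // _; rewrite mul1n.
rewrite !count_word; under eq_bigr => k _.
  rewrite mnmDE mnm1E mxvec_index_eq mulnDr addnC.
  over.
rewrite big_split /=; congr (_ + _)%N.
rewrite (bigD1 j) //= eqxx andbT big1 ?addn0 => [|k kj]; first by rewrite mulnC eq_sym.
by rewrite eq_sym [j == k]eq_sym (negbTE kj) andbF muln0.
Qed.

End Words.

Section LinearForms.
Variables (C : fieldType) (m : nat).

Definition linform (x : 'rV[C]_m) : {mpoly C[m]} := \sum_k x 0 k *: 'X_k.

Lemma linformD x y : linform (x + y) = linform x + linform y.
Proof. by rewrite -big_split; apply: eq_bigr => k _; rewrite mxE scalerDl. Qed.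

Lemma linform_delta j : linform (delta_mx 0 j) = 'X_j.
Proof.
rewrite /linform (bigD1 j) //= mxE !eqxx scale1r big1 ?addr0 // => k kj.
by rewrite mxE (negbTE kj) andbF scale0r.
Qed.

End LinearForms.

Section Relations.
Variable A : comPzRingType.

(** The relations are written over an arbitrary ring, so that the action, [phi], evaluations and
    quotient maps all pass through them as ring morphisms. *)
Definition rel32 (x y xx xy yy xxx xxy xyy : A) : A :=
  6 * xxy * xy - 3 * xyy * xx - 2 * xxy * x * y + xyy * x ^+ 2
  - 4 * xy ^+ 2 * x + 2 * xy * x ^+ 2 * y - 3 * xxx * yy + 4 * xx * x * yy
  - x ^+ 3 * yy + xxx * y ^+ 2 - xx * x * y ^+ 2.

Definition rel42 (x y xx xy yy xxx xxy xyy : A) : A :=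
  6 * xxy ^+ 2 + xy ^+ 2 * xx - 3 * xy ^+ 2 * x ^+ 2 - 6 * xxx * xyy
  + 2 * xx * xyy * x + 4 * xxx * xy * y - 2 * xx * xy * x * y
  + 2 * xy * x ^+ 3 * y - 4 * xxy * xx * y - xx ^+ 2 * yy + xx ^+ 2 * y ^+ 2
  + 4 * xx * x ^+ 2 * yy - xx * x ^+ 2 * y ^+ 2 - x ^+ 4 * yy - 2 * xxx * x * yy.

Definition rel222 (x y z xx xy xz yy yz zz : A) : A :=
  3 * (xx * (yy * zz - yz ^+ 2) - xy * (xy * zz - yz * xz) + xz * (xy * yz - yy * xz))
  - (x ^+ 2 * (yy * zz - yz ^+ 2) + y ^+ 2 * (xx * zz - xz ^+ 2)
     + z ^+ 2 * (xx * yy - xy ^+ 2) + 2 * x * y * (yz * xz - xy * zz)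
     + 2 * x * z * (xy * yz - xz * yy) + 2 * y * z * (xy * xz - xx * yz)).

End Relations.

Section RelMorph.
Variables (A B : comPzRingType) (f : {rmorphism A -> B}).

Lemma rel32_morph x y xx xy yy xxx xxy xyy :
  f (rel32 x y xx xy yy xxx xxy xyy) =
  rel32 (f x) (f y) (f xx) (f xy) (f yy) (f xxx) (f xxy) (f xyy).
Proof. by rewrite /rel32 !(rmorph_nat, rmorphXn, rmorphB, rmorphD, rmorphM). Qed.

Lemma rel42_morph x y xx xy yy xxx xxy xyy :
  f (rel42 x y xx xy yy xxx xxy xyy) =
  rel42 (f x) (f y) (f xx) (f xy) (f yy) (f xxx) (f xxy) (f xyy).
Proof. by rewrite /rel42 !(rmorph_nat, rmorphXn, rmorphB, rmorphD, rmorphM). Qed.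

Lemma rel222_morph x y z xx xy xz yy yz zz :
  f (rel222 x y z xx xy xz yy yz zz) =
  rel222 (f x) (f y) (f z) (f xx) (f xy) (f xz) (f yy) (f yz) (f zz).
Proof. by rewrite /rel222 !(rmorph_nat, rmorphXn, rmorphB, rmorphD, rmorphM). Qed.

End RelMorph.

Section SmallDeterminants.
Variables (A : comPzRingType) (F : nat -> nat -> A).

Lemma det_fun_expand n (G : nat -> nat -> A) :
  \det (\matrix_(i < n.+1, j < n.+1) G i j) =
  \sum_(j < n.+1) (-1) ^+ j * (G 0%N j * \det (\matrix_(i < n, k < n) G i.+1 (bump j k))).
Proof.
rewrite (expand_det_row _ ord0); apply: eq_bigr => j _.
rewrite mxE /cofactor add0n mulrCA; congr (_ * (_ * \det _)).
by apply/matrixP => i k; rewrite !mxE.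
Qed.

Lemma det_fun2 (G : nat -> nat -> A) :
  \det (\matrix_(i < 2, j < 2) G i j) = G 0%N 0%N * G 1%N 1%N - G 0%N 1%N * G 1%N 0%N.
Proof. by rewrite det_fun_expand !big_ord_recl big_ord0 !det_mx11 !mxE /= /bump /=; ring. Qed.

Lemma det_fun3 (G : nat -> nat -> A) :
  \det (\matrix_(i < 3, j < 3) G i j) =
  G 0%N 0%N * (G 1%N 1%N * G 2%N 2%N - G 1%N 2%N * G 2%N 1%N)
  - G 0%N 1%N * (G 1%N 0%N * G 2%N 2%N - G 1%N 2%N * G 2%N 0%N)
  + G 0%N 2%N * (G 1%N 0%N * G 2%N 1%N - G 1%N 1%N * G 2%N 0%N).
Proof.
rewrite det_fun_expand !big_ord_recl big_ord0.
rewrite !(det_fun2 (fun i k => G i.+1 (bump _ k))) /= /bump /=; ring.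
Qed.

Lemma det_fun4 :
  let d a b c := F 1%N a * (F 2%N b * F 3%N c - F 2%N c * F 3%N b)
    - F 1%N b * (F 2%N a * F 3%N c - F 2%N c * F 3%N a)
    + F 1%N c * (F 2%N a * F 3%N b - F 2%N b * F 3%N a) in
  \det (\matrix_(i < 4, j < 4) F i j) =
  F 0%N 0%N * d 1%N 2%N 3%N - F 0%N 1%N * d 0%N 2%N 3%N
  + F 0%N 2%N * d 0%N 1%N 3%N - F 0%N 3%N * d 0%N 1%N 2%N.
Proof.
rewrite /= det_fun_expand !big_ord_recl big_ord0.
rewrite !(det_fun3 (fun i k => F i.+1 (bump _ k))) /= /bump /=; ring.
Qed.

End SmallDeterminants.

Section JForms.
Variables (C : fieldType) (m : nat).
Implicit Types x y z : {mpoly C[m]}.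
Local Notation t := (@t C 3 m).

Definition J32_form x y := rel32 (t x) (t y) (t (x ^+ 2)) (t (x * y)) (t (y ^+ 2))
  (t (x ^+ 3)) (t (x ^+ 2 * y)) (t (x * y ^+ 2)).
Definition J42_form x y := rel42 (t x) (t y) (t (x ^+ 2)) (t (x * y)) (t (y ^+ 2))
  (t (x ^+ 3)) (t (x ^+ 2 * y)) (t (x * y ^+ 2)).
Definition J222_form x y z := rel222 (t x) (t y) (t z) (t (x ^+ 2)) (t (x * y))
  (t (x * z)) (t (y ^+ 2)) (t (y * z)) (t (z ^+ 2)).

Lemma J32E : J32 C m = J32_form (X C m 0) (X C m 1). Proof. by []. Qed.

Lemma J42E : J42 C m = J42_form (X C m 0) (X C m 1). Proof. by []. Qed.

Lemma J222E : J222 C m = J222_form (X C m 0) (X C m 1) (X C m 2).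
Proof.
rewrite /J222 (det_fun4 (fun i j => (nth [::] _ i)`_j)) /=.
rewrite /J222_form /rel222 !expr2 ![X C m 1 * X C m 0]mulrC ![X C m 2 * X C m 0]mulrC.
rewrite ![X C m 2 * X C m 1]mulrC; ring.
Qed.

End JForms.

(** * The kernel is generated by the forms J *)

(** The three rows of variables of C[V^m] are reused as the coordinates s, u and v. *)
Definition row_s : 'I_3 := 0.
Definition row_u : 'I_3 := 1.
Definition row_v : 'I_3 := 2%:R.

Section Centering.
Variables (C : fieldType) (m : nat) (A : comNzRingType).
Hypothesis natC : forall n, n.+1%:R != 0 :> C.
Variable pi : {rmorphism Falg C 3 m -> A}.
Local Notation W := 'rV[C]_m.
Local Notation t := (@t C 3 m).
Local Notation lf := (@linform C m).

Let iota (a : C) : A := pi a%:MP.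

Let iotaD a b : iota (a + b) = iota a + iota b.
Proof. by rewrite /iota mpolyCD rmorphD. Qed.

Let iotaM a b : iota (a * b) = iota a * iota b.
Proof. by rewrite /iota mpolyCM rmorphM. Qed.

Lemma iota_natV n : n.+1%:R * iota (n.+1%:R^-1) = 1.
Proof.
rewrite /iota -(rmorph_nat pi) -rmorphM -(rmorph_nat (@mpolyC _ C)) -mpolyCM.
by rewrite mulfV // mpolyC1 rmorph1.
Qed.

Lemma alg_nat_reg n (x : A) : n.+1%:R * x = 0 -> x = 0.
Proof.
by move=> nx; rewrite -[x]mul1r -(iota_natV n) mulrAC nx mul0r.
Qed.

Let third := iota (3%:R^-1).
Let sixth := iota (6%:R^-1).
Let third3 : 3 * third = 1. Proof. exact: iota_natV 2. Qed.
Let sixth6 : 6 * sixth = 1. Proof. exact: iota_natV 5. Qed.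

(* Values at the images of the centred coordinates: a row of V^m is written
   s + w^i u + w^(2i) v with w a cube root of unity, and s, pol2, pol3 stand for
   s, (u_x v_y + u_y v_x)/2 and u_x u_y u_z + v_x v_y v_z. *)
Definition mean (x : W) : A := third * pi (t (lf x)).
Definition pol2 (x y : W) : A :=
  sixth * pi (t (lf x * lf y)) - sixth * 3 * (mean x * mean y).
Definition pol3 (x y z : W) : A :=
  third * pi (t (lf x * lf y * lf z)) - mean x * mean y * mean z
  - 2 * (mean x * pol2 y z + mean y * pol2 x z + mean z * pol2 x y).

Lemma t1E x : pi (t (lf x)) = 3 * mean x.
Proof. by rewrite /mean mulrA third3 mul1r. Qed.

Lemma t2E x y : pi (t (lf x * lf y)) = 3 * mean x * mean y + 6 * pol2 x y.
Proof.
rewrite /pol2 mulrBr !mulrA sixth6 !mul1r; ring.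
Qed.

Lemma t3E x y z : pi (t (lf x * lf y * lf z)) = 3 * mean x * mean y * mean z
  + 6 * (mean x * pol2 y z + mean y * pol2 x z + mean z * pol2 x y) + 3 * pol3 x y z.
Proof. rewrite /pol3 !mulrBr !mulrA third3 !mul1r; ring. Qed.

Lemma meanD x y : mean (x + y) = mean x + mean y.
Proof. by rewrite /mean linformD linearD rmorphD mulrDr. Qed.

Lemma pol2D x y z : pol2 (x + y) z = pol2 x z + pol2 y z.
Proof. by rewrite /pol2 meanD linformD mulrDl linearD rmorphD; ring. Qed.

Lemma pol2C x y : pol2 x y = pol2 y x.
Proof. by rewrite /pol2 mulrC [_ * (mean x * _)]mulrC [mean x * _]mulrC (mulrC (lf x)); ring. Qed.

Lemma pol3D x y z w : pol3 (x + y) z w = pol3 x z w + pol3 y z w.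
Proof.
rewrite /pol3 meanD linformD !mulrDl linearD rmorphD !(pol2D x y); ring.
Qed.

Lemma pol3_12 x y z : pol3 x y z = pol3 y x z.
Proof. rewrite /pol3 (mulrC (lf x)) (pol2C x y); ring. Qed.

Lemma pol3_23 x y z : pol3 x y z = pol3 x z y.
Proof. rewrite /pol3 mulrAC (pol2C y z); ring. Qed.

(** No mean is left: this relation is invariant under a common translation of the three points. *)
Lemma J32_centred x y : pi (J32_form (lf x) (lf y)) =
  - 54%:R * (pol2 x x * pol3 y y x - 2 * pol2 x y * pol3 x x y + pol2 y y * pol3 x x x).
Proof.
rewrite /J32_form rel32_morph !(exprSr _ 2) !expr2 mulrA !(t1E, t2E, t3E).
by rewrite /rel32 (pol3_23 y y x) (pol3_12 y x y); ring.
Qed.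

(** Unlike [J32_form], this form is not invariant under translation, but its dependence on the means
    is a multiple of [J32_form] and so disappears modulo the ideal. *)
Lemma J42_centred x y : pi (J42_form (lf x) (lf y)) =
  54%:R * (pol3 x x y ^+ 2 - pol3 x x x * pol3 x y y
        - 4 * pol2 x x ^+ 2 * pol2 y y + 4 * pol2 x x * pol2 x y ^+ 2)
  + 4 * mean x * pi (J32_form (lf x) (lf y)).
Proof.
rewrite J32_centred /J42_form rel42_morph !(exprSr _ 2) !expr2 mulrA !(t1E, t2E, t3E).
by rewrite /rel42 (pol3_23 y y x) (pol3_12 y x y); ring.
Qed.

Lemma J222_centred x y z : pi (J222_form (lf x) (lf y) (lf z)) =
  648%:R * minor3 pol2 x y z x y z.
Proof.
rewrite /J222_form rel222_morph !expr2 !(t1E, t2E).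
by rewrite /rel222 /minor3 (pol2C y x) (pol2C z x) (pol2C z y); ring.
Qed.

Hypothesis J32_0 : forall x y, pi (J32_form (lf x) (lf y)) = 0.
Hypothesis J42_0 : forall x y, pi (J42_form (lf x) (lf y)) = 0.
Hypothesis J222_0 : forall x y z, pi (J222_form (lf x) (lf y) (lf z)) = 0.

Let e (j : 'I_m) : W := delta_mx 0 j.
Let p i j := pol2 (e i) (e j).
Let c i j k := pol3 (e i) (e j) (e k).

Let pC i j : p i j = p j i. Proof. exact: pol2C. Qed.
Let c12 i j k : c i j k = c j i k. Proof. exact: pol3_12. Qed.
Let c23 i j k : c i j k = c i k j. Proof. exact: pol3_23. Qed.
Let two_reg (x : A) : 2 * x = 0 -> x = 0. Proof. exact: (alg_nat_reg (n := 1)). Qed.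

Let minors (a b d f g h : W) : minor3 pol2 a b d f g h = 0.
Proof.
apply: (minor3_0 alg_nat_reg pol2D pol2C) => x y z.
by apply: (alg_nat_reg (n := 647)); rewrite -J222_centred J222_0.
Qed.

Let E222 a b d f g h : minor3 p a b d f g h = 0. Proof. exact: minors. Qed.

Let E32 j k l n r : R1 p (fun x y => c x y r) j k l n = 0.
Proof.
apply: (R1_polar alg_nat_reg pol2D pol2C pol3D pol3_12 pol3_23) => x y.
apply: (alg_nat_reg (n := 53)); apply: oppr_inj; rewrite -mulNr -J32_centred J32_0.
by rewrite oppr0.
Qed.

Let E42 i j k l n r :
  c i j k * c l n r - Xw p (Hw p c 0) [:: l; n; r] [:: i; j; k]
  = c l j k * c i n r - Xw p (Hw p c 0) [:: i; n; r] [:: l; j; k].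
Proof.
(* The chain of equalities adds 4 times the mean times [J32_form], which is zero, to 54 times the
   relation; by [J42_centred] the sum is the image of [J42_form]. *)
have rel x y := alg_nat_reg (n := 53) (etrans (esym (addr0 _))
  (etrans (congr1 _ (esym (mulr0 _))) (etrans (congr1 _ (congr1 _ (esym (J32_0 x y))))
  (etrans (esym (J42_centred x y)) (J42_0 x y))))).
have := exchange_polar alg_nat_reg pol2D pol2C pol3D pol3_12 pol3_23 rel minors
  (e i) (e j) (e k) (e l) (e n) (e r).
by [].
Qed.

Let XX := XX p c.

Let X_perm a a' b b' : perm_eq a a' -> perm_eq b b' -> XX a b = XX a' b'.
Proof. exact: XX_perm two_reg pC c12 c23 E32 E222 E42 _ _ _ _. Qed.
Let X_q i j a b : XX (i :: a) (j :: b) + XX (j :: a) (i :: b) = 2 * p i j * XX a b.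
Proof. exact: XX_q two_reg pC c12 c23 E32 E222 E42 _ _ _ _. Qed.
Let X_c i j k a b :
  XX (i :: j :: k :: a) b + XX a (i :: j :: k :: b) = c i j k * XX a b.
Proof. exact: XX_c two_reg pC c12 c23 E32 E222 E42 _ _ _ _ _. Qed.

Local Notation P := {mpoly C[3 * m]}.
Local Notation xv i j := (xvar C i j : P).

Let mean_mon (u : 'X_{1..3 * m}) : A := \prod_j mean (e j) ^+ u (mxvec_index row_s j).

(* The linear map C[s, u, v] -> A sending s^d u^a v^b to mean^d XX a b; it is
   a module map over the image of phi. *)
Definition section_map : P -> A :=
  monext (fun u a => iota a * (mean_mon u * XX (word row_u u) (word row_v u))).

Local Notation sg := section_map.

Let gD u a b : iota (a + b) * (mean_mon u * XX (word row_u u) (word row_v u)) =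
   iota a * (mean_mon u * XX (word row_u u) (word row_v u))
   + iota b * (mean_mon u * XX (word row_u u) (word row_v u)).
Proof. by rewrite iotaD mulrDl. Qed.

Lemma section_mapD x y : sg (x + y) = sg x + sg y.
Proof. exact: monextD. Qed.

Lemma section_map0 : sg 0 = 0. Proof. exact: monext0. Qed.

Lemma section_mapX a u : sg (a *: 'X_[u]) =
  iota a * (mean_mon u * XX (word row_u u) (word row_v u)).
Proof. exact: (monextZX gD). Qed.

Lemma section_map1 : sg 1 = 2.
Proof.
rewrite -mpolyX0 -[ 'X_[_]]scale1r section_mapX !word0 /iota mpolyC1 rmorph1 mul1r.
by rewrite /mean_mon big1 ?mul1r // => j _; rewrite mnm0E expr0.
Qed.

Lemma section_mapZ a h : sg (a *: h) = iota a * sg h.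
Proof.
rewrite [h]mpolyE scaler_sumr !(big_morph _ section_mapD section_map0) mulr_sumr.
by apply: eq_bigr => u _; rewrite scalerA !section_mapX iotaM -!mulrA.
Qed.

Lemma section_map_mul (d : A) (f : P) :
  (forall u, sg (f * 'X_[u]) = d * sg 'X_[u]) -> forall h, sg (f * h) = d * sg h.
Proof.
move=> fd h; rewrite [h]mpolyE mulr_sumr !(big_morph _ section_mapD section_map0) mulr_sumr.
by apply: eq_bigr => u _; rewrite -scalerAr !section_mapZ fd mulrCA.
Qed.

(** The prefixes a and b record the variables u_j and v_j by which the monomial has been
    multiplied. *)
Let val_w a b (u : 'X_{1..3 * m}) : A :=
  mean_mon u * XX (a ++ word row_u u) (b ++ word row_v u).

Let sgX u : sg 'X_[u] = val_w [::] [::] u.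
Proof.
by rewrite -['X_[_]]scale1r section_mapX /iota mpolyC1 rmorph1 mul1r.
Qed.

Let mean_mon_addU i j u :
  mean_mon (u + U_(mxvec_index i j)) = (if i == row_s then mean (e j) else 1) * mean_mon u.
Proof.
rewrite /mean_mon; under eq_bigr => k _.
  rewrite mnmDE mnm1E mxvec_index_eq exprD; over.
rewrite big_split /= mulrC; congr (_ * _).
case: eqP => _ /=; last by rewrite big1.
rewrite (bigD1 j) //= eqxx expr1 big1 ?mulr1 // => k kj.
by rewrite eq_sym (negbTE kj).
Qed.

Let val_u a b j u : val_w a b (u + U_(mxvec_index row_u j)) = val_w (j :: a) b u.
Proof.
rewrite /val_w mean_mon_addU mul1r; congr (_ * _); apply: X_perm.
  apply: perm_trans (_ : perm_eq _ (a ++ j :: word row_u u)) _.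
    by rewrite perm_cat2l; exact: word_addU row_u row_u j u.
  by rewrite -cat1s perm_catCA.
by rewrite perm_cat2l; exact: word_addU row_v row_u j u.
Qed.

Let val_v a b j u : val_w a b (u + U_(mxvec_index row_v j)) = val_w a (j :: b) u.
Proof.
rewrite /val_w mean_mon_addU mul1r; congr (_ * _); apply: X_perm.
  by rewrite perm_cat2l; exact: word_addU row_u row_v j u.
apply: perm_trans (_ : perm_eq _ (b ++ j :: word row_v u)) _.
  by rewrite perm_cat2l; exact: word_addU row_v row_v j u.
by rewrite -cat1s perm_catCA.
Qed.

Let val_s a b j u :
  val_w a b (u + U_(mxvec_index row_s j)) = mean (e j) * val_w a b u.
Proof.
rewrite /val_w mean_mon_addU eqxx -mulrA; congr (_ * (_ * _)); apply: X_perm.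
  by rewrite perm_cat2l; exact: word_addU row_u row_s j u.
by rewrite perm_cat2l; exact: word_addU row_v row_s j u.
Qed.

Let xvM i j u : xv i j * 'X_[u] = 'X_[u + U_(mxvec_index i j)].
Proof. by rewrite mpolyXD mulrC. Qed.

Lemma section_map_s j h : sg (xv row_s j * h) = mean (e j) * sg h.
Proof. by apply: section_map_mul => u; rewrite xvM !sgX val_s. Qed.

Let val_q i j u : val_w [:: i] [:: j] u + val_w [:: j] [:: i] u
  = 2 * p i j * val_w [::] [::] u.
Proof. by rewrite /val_w -mulrDr X_q mulrCA. Qed.

Let val_c i j k u : val_w [:: k; j; i] [::] u + val_w [::] [:: k; j; i] u
  = c i j k * val_w [::] [::] u.
Proof. by rewrite /val_w -mulrDr X_c (c12 k) c23 c12 mulrCA. Qed.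

Lemma section_map_p i j h :
  sg ((xv row_u i * xv row_v j + xv row_u j * xv row_v i) * h) = 2 * p i j * sg h.
Proof.
apply: section_map_mul => u; rewrite (sgX u) -val_q mulrDl section_mapD.
by congr (_ + _); rewrite -mulrA 2!xvM sgX val_u val_v.
Qed.

Lemma section_map_c i j k h :
  sg ((xv row_u i * xv row_u j * xv row_u k + xv row_v i * xv row_v j * xv row_v k) * h)
  = c i j k * sg h.
Proof.
apply: section_map_mul => u; rewrite (sgX u) -val_c mulrDl section_mapD.
congr (_ + _); rewrite -2!mulrA 3!xvM sgX.
  by rewrite !val_u.
by rewrite !val_v.
Qed.

End Centering.

(** * Coordinates that diagonalize the cyclic permutation of the rows *)

Section Fourier.
Variables (C : fieldType) (m : nat).
Local Notation P := {mpoly C[3 * m]}.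
Local Notation xv i j := (xvar C i j : P).
Local Notation t := (@t C 3 m).
Variable w : C.
Hypothesis w_root : w ^+ 2 + w + 1 = 0.

Definition fourier (f : P) : P := f \mPo [tuple mxvec (\matrix_(i < 3, j < m)
  (xv row_s j + w ^+ i *: xv row_u j + w ^+ (i + i) *: xv row_v j)) 0 k | k < 3 * m].

Lemma fourier_xvar i j : fourier (xv i j) =
  xv row_s j + w ^+ i *: xv row_u j + w ^+ (i + i) *: xv row_v j.
Proof. by rewrite /fourier comp_mpolyXU -tnth_nth tnth_mktuple mxvecE mxE. Qed.

Definition fourier_phi (f : Falg C 3 m) : P := fourier (phi 3 f).

Lemma fourier_phiD f g : fourier_phi (f + g) = fourier_phi f + fourier_phi g.
Proof. by rewrite /fourier_phi /fourier /phi !rmorphD. Qed.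

Lemma fourier_phiM f g : fourier_phi (f * g) = fourier_phi f * fourier_phi g.
Proof. by rewrite /fourier_phi /fourier /phi !rmorphM. Qed.

Lemma fourier_phiC a : fourier_phi a%:MP = a%:MP.
Proof. by rewrite /fourier_phi /fourier /phi !comp_mpolyC. Qed.

Let fourier_row (i : 'I_3) (q : {mpoly C[m]}) : P :=
  fourier (q \mPo [tuple xv i j | j < m]).

Let fourier_row_var i j : fourier_row i 'X_j = fourier (xv i j).
Proof. by rewrite /fourier_row comp_mpolyXU -tnth_nth tnth_mktuple. Qed.

Let fourier_rowM i q r : fourier_row i (q * r) = fourier_row i q * fourier_row i r.
Proof. by rewrite /fourier_row /fourier !rmorphM. Qed.

Lemma big_ord3 (V : zmodType) (F : 'I_3 -> V) : \sum_i F i = F 0 + F 1 + F 2%:R.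
Proof.
rewrite !big_ord_recl big_ord0 addr0 addrA; congr (_ + _ + _); congr F; exact: val_inj.
Qed.

Let fourier_phi_t (e0 : nat) q : (0 < e0 <= 3)%N -> q \is e0.-homog ->
  fourier_phi (t q) = fourier_row 0 q + fourier_row 1 q + fourier_row 2%:R q.
Proof.
move=> he hq; rewrite /fourier_phi (phi_t 3 he hq) /psum_lin /fourier raddf_sum /=.
exact: big_ord3.
Qed.

Let fourier0 j : fourier_row 0 'X_j = xv row_s j + xv row_u j + xv row_v j.
Proof. by rewrite fourier_row_var fourier_xvar !scale1r. Qed.

Let fourier1 j : fourier_row 1 'X_j =
  xv row_s j + w%:MP * xv row_u j + (w ^+ 2)%:MP * xv row_v j.
Proof. by rewrite fourier_row_var fourier_xvar -!mul_mpolyC. Qed.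

Let w4 : w ^+ 4 = w.
Proof.
apply: subr0_eq; transitivity ((w ^+ 2 + w + 1) * (w ^+ 2 - w)); first by ring.
by rewrite w_root mul0r.
Qed.

Let fourier2 j : fourier_row 2%:R 'X_j =
  xv row_s j + (w ^+ 2)%:MP * xv row_u j + w%:MP * xv row_v j.
Proof. by rewrite fourier_row_var fourier_xvar -!mul_mpolyC [w ^+ (_ + _)]w4. Qed.

Let W_root : w%:MP ^+ 2 + w%:MP + 1 = 0 :> P.
Proof.
by rewrite -mpolyC1 -mpolyC0 -w_root !mpolyCD expr2 -mpolyCM -expr2.
Qed.

Lemma fourier_t1 j : fourier_phi (t 'X_j) = 3 * xv row_s j.
Proof.
rewrite (fourier_phi_t (e0 := 1)) //; last by rewrite dhomogX /= mdeg1.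
rewrite fourier0 fourier1 fourier2.
apply: subr0_eq; rewrite [(w ^+ 2)%:MP]mpolyCM -expr2.
rewrite -(mul0r (xv row_u j + xv row_v j)) -W_root; ring.
Qed.

Lemma fourier_t2 j k : fourier_phi (t ('X_j * 'X_k)) = 3 * (xv row_s j * xv row_s k)
  + 3 * (xv row_u j * xv row_v k + xv row_u k * xv row_v j).
Proof.
rewrite (fourier_phi_t (e0 := 2)) //; last first.
  by rewrite -mpolyXD dhomogX /= mdegD !mdeg1.
rewrite !fourier_rowM !fourier0 !fourier1 !fourier2.
apply: subr0_eq; rewrite [(w ^+ 2)%:MP]mpolyCM -expr2.
move: (w%:MP) W_root (xv _ j) (xv _ j) (xv _ j) (xv _ k) (xv _ k) (xv _ k).
move=> W WE d b a d' b' a'.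
(* The two sides differ by this explicit multiple of [W ^+ 2 + W + 1]. *)
rewrite -(mul0r (a * (b' + d') + a' * (b + d) + (W ^+ 2 - W + 1) * (b * b' + d * d')
  + 2 * (W - 1) * (b * d' + d * b'))) -WE; ring.
Qed.

Lemma fourier_t3 j k l : fourier_phi (t ('X_j * 'X_k * 'X_l)) =
  3 * (xv row_s j * xv row_s k * xv row_s l)
  + 3 * (xv row_s j * (xv row_u k * xv row_v l + xv row_u l * xv row_v k)
       + xv row_s k * (xv row_u j * xv row_v l + xv row_u l * xv row_v j)
       + xv row_s l * (xv row_u j * xv row_v k + xv row_u k * xv row_v j))
  + 3 * (xv row_u j * xv row_u k * xv row_u l + xv row_v j * xv row_v k * xv row_v l).
Proof.
rewrite (fourier_phi_t (e0 := 3)) //; last first.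
  by rewrite -!mpolyXD dhomogX /= !mdegD !mdeg1.
rewrite !fourier_rowM !fourier0 !fourier1 !fourier2.
apply: subr0_eq; rewrite [(w ^+ 2)%:MP]mpolyCM -expr2.
move: (w%:MP) W_root (xv _ j) (xv _ j) (xv _ j) (xv _ k) (xv _ k) (xv _ k)
  (xv _ l) (xv _ l) (xv _ l).
move=> W WE d b a d' b' a' d2 b2 a2.
rewrite -(mul0r (a * a' * (b2 + d2) + a * a2 * (b' + d') + a' * a2 * (b + d)
  + (W ^+ 2 - W + 1) * (a * (b' * b2 + d' * d2) + a' * (b * b2 + d * d2)
                        + a2 * (b * b' + d * d'))
  + 2 * (W - 1) * (a * (b' * d2 + d' * b2) + a' * (b * d2 + d * b2)
                   + a2 * (b * d' + d * b'))
  + (W - 1) * (W ^+ 3 + 2) * (b * b' * b2 + d * d' * d2)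
  + (W ^+ 3 - W + 1) * (b * b' * d2 + b * d' * b2 + d * b' * b2
                        + b * d' * d2 + d * b' * d2 + d * d' * b2))) -WE; ring.
Qed.

End Fourier.

Lemma low_degree_monomial m (u : 'X_{1..m}) : (0 < mdeg u <= 3)%N ->
  [\/ exists j, u = U_(j)%MM, exists j k, u = (U_(j) + U_(k))%MM
    | exists j k l, u = (U_(j) + U_(k) + U_(l))%MM].
Proof.
have dec (v : 'X_{1..m}) : (0 < mdeg v)%N ->
    exists j v', v = (U_(j) + v')%MM /\ mdeg v = (mdeg v').+1.
  rewrite lt0n mdeg_eq0 => v0; have [j vj] : exists j, (0 < v j)%N.
    apply/existsP; apply: contraR v0 => /existsPn v0.
    by apply/eqP/mnmP => j; rewrite mnm0E; move: (v0 j); rewrite lt0n negbK => /eqP.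
  have vE : (v - U_(j) + U_(j))%MM = v by rewrite submK // lep1mP -lt0n.
  exists j, (v - U_(j))%MM; split; first by rewrite addmC vE.
  by rewrite -{1}vE mdegD mdeg1 addn1.
have deg0 (v : 'X_{1..m}) : mdeg v = 0%N -> v = 0%MM by move/eqP; rewrite mdeg_eq0 => /eqP.
case/andP=> u0 u3; have [j [u1 [uE du]]] := dec u u0; rewrite uE.
have [d1|d1] := posnP (mdeg u1).
  by constructor 1; exists j; rewrite (deg0 _ d1) addm0.
have [k [u2 [u1E du1]]] := dec u1 d1; rewrite u1E addmA.
have [d2|d2] := posnP (mdeg u2).
  by constructor 2; exists j, k; rewrite (deg0 _ d2) addm0.
have [l [u4 [u2E du2]]] := dec u2 d2; constructor 3; exists j, k, l.
by rewrite u2E (deg0 u4) ?addm0 ?addmA //; lia.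
Qed.

(** * Linearity of sigma over the image of F *)

Section Absorption.
Variables (C : fieldType) (m : nat) (A : comNzRingType).
Variable pi : {rmorphism Falg C 3 m -> A}.
Local Notation P := {mpoly C[3 * m]}.
Local Notation xv i j := (xvar C i j : P).
Local Notation t := (@t C 3 m).
Variables (s : 'I_m -> A) (p : 'I_m -> 'I_m -> A) (c : 'I_m -> 'I_m -> 'I_m -> A).
Hypothesis t1 : forall j, pi (t 'X_j) = 3 * s j.
Hypothesis t2 : forall j k, pi (t ('X_j * 'X_k)) = 3 * s j * s k + 6 * p j k.
Hypothesis t3 : forall j k l, pi (t ('X_j * 'X_k * 'X_l)) = 3 * s j * s k * s l
  + 6 * (s j * p k l + s k * p j l + s l * p j k) + 3 * c j k l.
Variable sg : P -> A.
Hypothesis sgD : forall x y, sg (x + y) = sg x + sg y.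
Hypothesis sgZ : forall a h, sg (a *: h) = pi a%:MP * sg h.
Hypothesis sg_s : forall j h, sg (xv row_s j * h) = s j * sg h.
Hypothesis sg_p : forall i j h,
  sg ((xv row_u i * xv row_v j + xv row_u j * xv row_v i) * h) = 2 * p i j * sg h.
Hypothesis sg_c : forall i j k h,
  sg ((xv row_u i * xv row_u j * xv row_u k + xv row_v i * xv row_v j * xv row_v k) * h)
  = c i j k * sg h.
Variable w : C.
Hypothesis w_root : w ^+ 2 + w + 1 = 0.

Local Notation Phi := (fourier_phi w).

Definition absorbs (f : Falg C 3 m) : Prop := forall h, sg (Phi f * h) = pi f * sg h.

Let absorbsD f g : absorbs f -> absorbs g -> absorbs (f + g).
Proof. by move=> af ag h; rewrite fourier_phiD mulrDl sgD af ag (rmorphD pi) mulrDl. Qed.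

Let absorbsM f g : absorbs f -> absorbs g -> absorbs (f * g).
Proof. by move=> af ag h; rewrite fourier_phiM -mulrA af ag (rmorphM pi) mulrA. Qed.

Let absorbsC a : absorbs a%:MP.
Proof. by move=> h; rewrite fourier_phiC mul_mpolyC sgZ. Qed.

Let sg3 f d h : (forall h, sg (f * h) = d * sg h) -> sg (3 * f * h) = 3 * d * sg h.
Proof.
move=> fd; rewrite -!mulrA -[X in sg X = _](_ : f * h + f * h + f * h = _); last by ring.
by rewrite !sgD fd; ring.
Qed.

Let absorbs_t1 j : absorbs (t 'X_j).
Proof. by move=> h; rewrite fourier_t1 // t1; apply: sg3 => k; rewrite sg_s. Qed.

Let absorbs_t2 j k : absorbs (t ('X_j * 'X_k)).
Proof.
move=> h; rewrite fourier_t2 // t2 mulrDl sgD.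
rewrite (sg3 (d := s j * s k)) => [|k']; last first.
  by rewrite -mulrA !sg_s mulrA.
by rewrite (sg3 (d := 2 * p j k)) => [|k']; [ring | exact: sg_p].
Qed.

Let absorbs_t3 j k l : absorbs (t ('X_j * 'X_k * 'X_l)).
Proof.
move=> h; rewrite fourier_t3 // t3 2!mulrDl 2!sgD.
rewrite (sg3 (d := s j * (s k * s l))) => [|k']; last first.
  by rewrite -!mulrA !sg_s !mulrA.
rewrite (sg3 (d := 2 * (s j * p k l + s k * p j l + s l * p j k))) => [|k']; last first.
  by rewrite 2!mulrDl 2!sgD -3!(mulrA (xvar C row_s _)) 3!sg_s 3!sg_p; ring.
by rewrite (sg3 (d := c j k l)) => [|k']; [ring | exact: sg_c].
Qed.

Lemma absorbs_all f : absorbs f.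
Proof.
have absX j : absorbs ('X_j : Falg C 3 m).
  rewrite -t_mon_of; case: (low_degree_monomial (mon_of_deg j)) => [[i1]|[i [k]]|[i [k [l]]]] ->.
  - exact: absorbs_t1.
  - by rewrite mpolyXD; exact: absorbs_t2.
  - by rewrite !mpolyXD; exact: absorbs_t3.
rewrite [f]mpolyE; elim/big_ind: _ => [||u _]; first exact: (absorbsC 0).
  exact: absorbsD.
rewrite -mul_mpolyC; apply: absorbsM; first exact: absorbsC.
rewrite mpolyXE_id; elim/big_ind: _ => [||j _]; first exact: (absorbsC 1).
  exact: absorbsM.
by elim: (u j) => [|n IH]; [exact: (absorbsC 1) | rewrite exprS; apply: absorbsM].
Qed.

Lemma absorbs_kernel f : (forall x, 2 * x = 0 :> A -> x = 0) -> sg 1 = 2 -> K C 3 m f -> pi f = 0.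
Proof.
move=> two_reg sg1 Kf; apply: two_reg; rewrite mulrC -sg1 -absorbs_all.
rewrite /fourier_phi Kf /fourier raddf0 mul0r.
have := sgD 0 0; rewrite addr0 => /esym/eqP; rewrite -subr_eq0 addrK => /eqP.
by [].
Qed.

End Absorption.

Lemma kernel_vanishes (C : fieldType) (m : nat) (A : comNzRingType)
    (pi : {rmorphism Falg C 3 m -> A}) (w : C) :
  (forall n, n.+1%:R != 0 :> C) -> w ^+ 2 + w + 1 = 0 ->
  (forall x y, pi (J32_form (linform x) (linform y)) = 0) ->
  (forall x y, pi (J42_form (linform x) (linform y)) = 0) ->
  (forall x y z, pi (J222_form (linform x) (linform y) (linform z)) = 0) ->
  forall f, K C 3 m f -> pi f = 0.
Proof.
move=> natC w0 h32 h42 h222 f.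
pose e j : 'rV[C]_m := delta_mx 0 j.
apply: (@absorbs_kernel C m A pi (fun j => mean pi (e j))
  (fun i j => pol2 pi (e i) (e j)) (fun i j k => pol3 pi (e i) (e j) (e k))
  _ _ _ (section_map pi) _ _ _ _ _ w w0).
- by move=> j; rewrite -t1E // linform_delta.
- by move=> j k; rewrite -t2E // !linform_delta.
- by move=> j k l; rewrite -t3E // !linform_delta.
- exact: section_mapD.
- exact: section_mapZ.
- exact: section_map_s.
- exact: section_map_p.
- exact: section_map_c.
- by move=> x; apply: (@alg_nat_reg C m A natC pi 1).
- exact: section_map1.
Qed.

(** Properness makes the quotient a nonzero ring; an ideal containing 1 is treated separately in
    [kernel_sub_ideal]. *)
Record ideal_set (A : comNzRingType) := IdealSet {
  ideal_car : set A;
  ideal0 : ideal_car 0;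
  idealMD : forall a u v, ideal_car u -> ideal_car v -> ideal_car (a * u + v);
  ideal_proper : ~ ideal_car 1 }.

Section IdealQuotient.
Local Open Scope quotient_scope.
Variables (A : comNzRingType) (I : ideal_set A).

Definition ideal_mem : {pred A} := fun f => `[< ideal_car I f >].

Lemma ideal_mem_closed : idealr_closed ideal_mem.
Proof.
split=> [||a u v /asboolP Iu /asboolP Iv]; first exact/asboolP/ideal0.
  by apply/asboolP; exact: ideal_proper.
by apply/asboolP/idealMD.
Qed.

HB.instance Definition _ := isIdealr.Build A ideal_mem ideal_mem_closed.

Definition ideal_quot : comNzRingType := {ideal_quot (ideal_mem : idealr A)}.

Definition ideal_pi (f : A) : ideal_quot := \pi_{ideal_quot (ideal_mem : idealr A)} f.

Lemma ideal_pi_additive : {morph ideal_pi : x y / x + y}.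
Proof. by move=> x y; rewrite /ideal_pi Quotient.pi_add. Qed.

Lemma ideal_pi_mul : {morph ideal_pi : x y / x * y}.
Proof. by move=> x y; rewrite /ideal_pi Quotient.pi_mul. Qed.

Lemma ideal_pi1 : ideal_pi 1 = 1.
Proof. by rewrite /ideal_pi piE. Qed.

Lemma ideal_pi0 : ideal_pi 0 = 0.
Proof. by rewrite /ideal_pi piE. Qed.

HB.instance Definition _ :=
  GRing.isNmodMorphism.Build A ideal_quot ideal_pi (conj ideal_pi0 ideal_pi_additive).
HB.instance Definition _ :=
  GRing.isMonoidMorphism.Build A ideal_quot ideal_pi (conj ideal_pi1 ideal_pi_mul).

Lemma ideal_pi0P f : ideal_pi f = 0 <-> ideal_car I f.
Proof.
rewrite -ideal_pi0 /ideal_pi; split=> [/eqP|If].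
  by rewrite -Quotient.idealrBE subr0 => /asboolP.
by apply/eqP; rewrite -Quotient.idealrBE subr0; exact/asboolP.
Qed.

End IdealQuotient.


Lemma kernel_sub_ideal (C : fieldType) (m : nat) (w : C) (I : set (Falg C 3 m)) :
  (forall n, n.+1%:R != 0 :> C) -> w ^+ 2 + w + 1 = 0 ->
  I 0 -> (forall a u v, I u -> I v -> I (a * u + v)) ->
  (forall x y, I (J32_form (linform x) (linform y))) ->
  (forall x y, I (J42_form (linform x) (linform y))) ->
  (forall x y z, I (J222_form (linform x) (linform y) (linform z))) ->
  K C 3 m `<=` I.
Proof.
move=> natC w0 I0 IMD h32 h42 h222 f Kf.
have [I1|I1] := pselect (I 1).
  by rewrite -[f]mulr1 -[_ * _]addr0; exact: IMD.
pose J := IdealSet I0 IMD I1.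
apply/(ideal_pi0P J); apply: (kernel_vanishes natC w0 _ _ _ Kf) => *; exact/ideal_pi0P.
Qed.

(** * Polynomial dependence on the group element *)

Section Curves.
Variables (C : fieldType) (V : lmodType C) (N : set V).
Hypothesis natC : forall n, n.+1%:R != 0 :> C.
Hypothesis N0 : N 0.
Hypothesis NL : forall a u v, N u -> N v -> N (a *: u + v).

Lemma subspace_sum I (r : seq I) (c : I -> C) (F : I -> V) :
  (forall i, N (F i)) -> N (\sum_(i <- r) c i *: F i).
Proof.
by move=> NF; elim: r => [|i r IH]; rewrite ?big_nil // big_cons; exact: NL.
Qed.

Lemma nat_inj_field : injective (fun n => n%:R : C).
Proof.
have pos n k : (n + k.+1)%:R != n%:R :> C.
  by rewrite natrD -subr_eq0 addrAC subrr add0r.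
move=> i j /= ij; case: (ltngtP i j) => // lt.
  by have := pos i (j - i.+1)%N; rewrite addnS -addSn subnKC // ij eqxx.
by have := pos j (i - j.+1)%N; rewrite addnS -addSn subnKC // ij eqxx.
Qed.

Lemma nonroots (D : {poly C}) n : D != 0 ->
  exists2 s : seq C, uniq s & (n <= size s)%N && all (fun x => D.[x] != 0) s.
Proof.
(* The integers below n + size D are distinct in C, and fewer than size D of them can be roots. *)
move=> D0; pose s0 : seq C := [seq i%:R | i <- iota 0 (n + size D)].
have us0 : uniq s0 by rewrite map_inj_uniq ?iota_uniq //; exact: nat_inj_field.
exists [seq x <- s0 | ~~ root D x]; first exact: filter_uniq.
rewrite all_filter (eq_all (a2 := xpredT)) ?all_predT ?andbT; last first.
  by move=> x /=; rewrite rootE implybb.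
have := count_predC (root D) s0; rewrite size_map size_iota -!size_filter.
have := max_poly_roots D0 (filter_all (root D) s0) (filter_uniq _ us0).
rewrite -[filter (fun x => ~~ root D x) s0]/(filter (predC (root D)) s0).
move: (size D) (size (filter (root D) s0)) (size (filter (predC (root D)) s0)) => a b d.
by move=> ba bd; lia.
Qed.

(* A Vandermonde matrix recovers the coefficients from sufficiently many values. *)
Lemma curve_coef (l : seq ({poly C} * V)) (D : {poly C}) : D != 0 ->
  (forall s, D.[s] != 0 -> N (\sum_(x <- l) x.1.[s] *: x.2)) ->
  forall d, N (\sum_(x <- l) x.1`_d *: x.2).
Proof.
move=> D0 Ncurve d; pose n := maxn d.+1 (\max_(x <- l) size x.1).
pose f i := \sum_(x <- l) x.1`_i *: x.2.
have curveE s : \sum_(x <- l) x.1.[s] *: x.2 = \sum_(i < n) s ^+ i *: f i.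
  under [RHS]eq_bigr => i _ do rewrite scaler_sumr.
  rewrite exchange_big /=; rewrite !big_seq; apply: eq_bigr => x xl.
  rewrite (@horner_coef_wide _ n) ?scaler_suml; last first.
    by rewrite leq_max (leq_bigmax_seq (F := fun x : {poly C} * V => size x.1)) ?orbT.
  by apply: eq_bigr => i _; rewrite scalerA mulrC.
have [s us /andP[ns /allP sD]] := nonroots n D0.
have nz i : (i < n)%N -> (i < size s)%N by move=> /leq_trans; apply.
pose a : 'rV[C]_n := \row_i s`_i.
have dn : (d < n)%N by rewrite leq_max leqnn.
have Vu : Vandermonde n a \in unitmx.
  rewrite unitmxE det_Vandermonde unitfE prodf_seq_neq0; apply/allP => i _ /=.
  rewrite prodf_seq_neq0; apply/allP => j _; apply/implyP => ij.
  rewrite !mxE subr_eq0 nth_uniq ?nz //.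
  by rewrite neq_ltn ij orbT.
pose W := invmx (Vandermonde n a).
rewrite -/(f d); have -> : f d = \sum_(j < n) W j (Ordinal dn) *: \sum_(x <- l) x.1.[a 0 j] *: x.2.
  under [RHS]eq_bigr => j _ do rewrite curveE scaler_sumr.
  rewrite exchange_big /=.
  transitivity (\sum_(i < n) (Vandermonde n a *m W) i (Ordinal dn) *: f i).
    rewrite mulmxV // (bigD1 (Ordinal dn)) //= mxE eqxx scale1r big1 ?addr0 // => i id.
    by rewrite mxE (negbTE id) scale0r.
  apply: eq_bigr => i _; rewrite mxE scaler_suml; apply: eq_bigr => j _.
  by rewrite scalerA !mxE mulrC.
apply: subspace_sum => j; apply: Ncurve; rewrite mxE.
by apply: sD; rewrite mem_nth // nz.
Qed.

(** A subspace that contains all but finitely many points of a polynomial curve contains the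
    coefficients of the curve, hence all of its points. *)
Lemma curve_closed (l : seq ({poly C} * V)) (D : {poly C}) : D != 0 ->
  (forall s, D.[s] != 0 -> N (\sum_(x <- l) x.1.[s] *: x.2)) ->
  forall s, N (\sum_(x <- l) x.1.[s] *: x.2).
Proof.
move=> D0 Ncurve s; have Nf := curve_coef D0 Ncurve.
pose n := (\max_(x <- l) size x.1)%N.
suff -> : \sum_(x <- l) x.1.[s] *: x.2 = \sum_(i < n) s ^+ i *: \sum_(x <- l) x.1`_i *: x.2.
  exact: subspace_sum.
under [RHS]eq_bigr => i _ do rewrite scaler_sumr.
rewrite exchange_big /=; rewrite !big_seq; apply: eq_bigr => x xl.
rewrite (@horner_coef_wide _ n) ?scaler_suml; last first.
  by rewrite (leq_bigmax_seq (F := fun x : {poly C} * V => size x.1)).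
by apply: eq_bigr => i _; rewrite scalerA mulrC.
Qed.

End Curves.

Section PolynomialMaps.
Variables (C : fieldType) (m : nat).
Local Notation M := 'M[C]_m.
Local Notation ev P g := (P.@[fun k => mxvec g 0 k]).

Definition polymap (V : lmodType C) (f : M -> V) : Prop :=
  exists l : seq ({mpoly C[m * m]} * V), forall g, f g = \sum_(x <- l) ev x.1 g *: x.2.

Lemma polymap_const (V : lmodType C) (v : V) : polymap (fun=> v).
Proof. by exists [:: (1, v)] => g; rewrite big_seq1 meval1 scale1r. Qed.

Lemma polymapD (V : lmodType C) (f h : M -> V) :
  polymap f -> polymap h -> polymap (fun g => f g + h g).
Proof.
by move=> [l fl] [k hk]; exists (l ++ k) => g; rewrite big_cat fl hk.
Qed.

Lemma polymap_sum (V : lmodType C) I (r : seq I) (P : pred I) (f : I -> M -> V) :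
  (forall i, polymap (f i)) -> polymap (fun g => \sum_(i <- r | P i) f i g).
Proof.
move=> pf; elim: r => [|i r IH].
  by exists [::] => g; rewrite !big_nil.
case Pi : (P i).
  have [l E] := polymapD (pf i) IH.
  by exists l => g; rewrite big_cons Pi E.
by have [l E] := IH; exists l => g; rewrite big_cons Pi E.
Qed.

Lemma polymap_linear (V W : lmodType C) (L : {linear V -> W}) (f : M -> V) :
  polymap f -> polymap (fun g => L (f g)).
Proof.
move=> [l fl]; exists [seq (x.1, L x.2) | x <- l] => g.
by rewrite fl linear_sum big_map; apply: eq_bigr => x _; rewrite linearZ.
Qed.

Lemma polymapZ (V : lmodType C) (a : C) (f : M -> V) :
  polymap f -> polymap (fun g => a *: f g).
Proof.
move=> [l fl]; exists [seq (x.1, a *: x.2) | x <- l] => g.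
rewrite fl scaler_sumr big_map; apply: eq_bigr => x _ /=.
by rewrite !scalerA mulrC.
Qed.

Lemma polymap_entry (V : lmodType C) (v : V) i j : polymap (fun g => g i j *: v).
Proof.
by exists [:: ('X_(mxvec_index i j), v)] => g; rewrite big_seq1 mevalXU mxvecE.
Qed.

Lemma polymapM (n : nat) (f h : M -> {mpoly C[n]}) :
  polymap f -> polymap h -> polymap (fun g => f g * h g).
Proof.
move=> [l fl] [k hk].
exists [seq (x.1 * y.1, x.2 * y.2) | x <- l, y <- k] => g.
rewrite fl hk big_distrlr /= big_allpairs_dep.
apply: eq_bigr => x _; apply: eq_bigr => y _.
by rewrite mevalM -scalerAl -scalerAr scalerA.
Qed.

Lemma polymap_prod (n : nat) I (r : seq I) (f : I -> M -> {mpoly C[n]}) :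
  (forall i, polymap (f i)) -> polymap (fun g => \prod_(i <- r) f i g).
Proof.
move=> pf; elim: r => [|i r IH].
  by have [l E] := polymap_const (1 : {mpoly C[n]}); exists l => g; rewrite big_nil; exact: E.
by have [l E] := polymapM (pf i) IH; exists l => g; rewrite big_cons E.
Qed.

Lemma polymapX (n : nat) (f : M -> {mpoly C[n]}) k : polymap f -> polymap (fun g => f g ^+ k).
Proof.
move=> pf; elim: k => [|k IH].
  by have [l E] := polymap_const (1 : {mpoly C[n]}); exists l.
by have [l E] := polymapM pf IH; exists l => g; rewrite exprS E.
Qed.

Lemma polymap_ext (V : lmodType C) (f h : M -> V) : f =1 h -> polymap f -> polymap h.
Proof. by move=> fh [l E]; exists l => g; rewrite -fh E. Qed.

Lemma polymap_act d (v : Falg C d m) : polymap (fun g => F_act g v).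
Proof.
apply: (polymap_ext (fun g => esym (comp_mpolyEX _ _))).
apply: polymap_sum => u.
apply: polymapZ.
apply: (polymap_ext (fun g => esym (comp_mpolyX _ _))).
apply: polymap_prod => j; apply: polymapX.
apply: polymap_ext (_ : polymap (fun g => t d (mon_act g 'X_[mon_of j]))).
  by move=> g; rewrite tnth_mktuple.
apply: polymap_linear; apply: (polymap_ext (fun g => esym (comp_mpolyX _ _))).
apply: polymap_prod => i; apply: polymapX.
apply: polymap_ext (_ : polymap (fun g => \sum_(k < m) g k i *: 'X_k)).
  by move=> g; rewrite tnth_mktuple.
by apply: polymap_sum => k; exact: polymap_entry.
Qed.

Lemma polymap_curve (V : lmodType C) (f : M -> V) (G : 'M[{poly C}]_m) : polymap f ->
  exists l : seq ({poly C} * V),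
    forall s, f (map_mx (fun q : {poly C} => q.[s]) G) = \sum_(x <- l) x.1.[s] *: x.2.
Proof.
move=> [l fl]; exists [seq (mmap polyC (fun k => mxvec G 0 k) x.1, x.2) | x <- l] => s.
rewrite fl big_map; apply: eq_bigr => x _ /=; congr (_ *: _).
rewrite /meval /mmap horner_sum; apply: eq_bigr => u _.
rewrite hornerM hornerC /mmap1 horner_prod; congr (_ * _); apply: eq_bigr => k _.
by rewrite horner_exp; case/mxvec_indexP: k => i j; rewrite !mxvecE mxE.
Qed.

(** The polynomial map is restricted to the line of matrices g + s, and g is reached at s = 0. *)
Lemma polymap_closed (V : lmodType C) (N : set V) (f : M -> V) (g : M) :
  (forall n, n.+1%:R != 0 :> C) ->
  N 0 -> (forall a u v, N u -> N v -> N (a *: u + v)) ->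
  polymap f -> (forall D : {poly C}, D != 0 -> 
     (forall s, D.[s] != 0 -> N (f (g + s%:M))) -> N (f g)).
Proof.
move=> natC N0 NL pf D D0 ND.
have [l E] := polymap_curve (map_mx polyC g + 'X%:M) pf.
have gE s : map_mx (fun q : {poly C} => q.[s]) (map_mx polyC g + 'X%:M) = g + s%:M.
  apply/matrixP => i j; rewrite !mxE hornerD hornerC hornerMn hornerX.
  by [].
have -> : f g = \sum_(x <- l) x.1.[0] *: x.2.
  by rewrite -E gE; congr f; rewrite raddf0 addr0.
apply: (curve_closed natC N0 NL D0) => s Ds.
by rewrite -E gE; exact: ND.
Qed.

Lemma shift_unit (g : M) : exists2 D : {poly C}, D != 0 &
  forall s, D.[s] != 0 -> g + s%:M \in unitmx.
Proof.
exists (char_poly (- g)); first exact/monic_neq0/char_poly_monic.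
move=> s; rewrite unitmxE unitfE /char_poly -horner_evalE -det_map_mx.
suff -> : map_mx (horner_eval s) (char_poly_mx (- g)) = g + s%:M by [].
apply/matrixP => i j; rewrite !mxE /horner_eval hornerD hornerN hornerMn hornerX hornerC.
by rewrite opprK addrC.
Qed.

(** Submodules are thus stable under singular matrices as well, which allows arbitrary linear forms,
    possibly dependent, to be substituted for the variables in the J. *)
Lemma submod_act_all d (N : set (F_glmod C d m)) (g : M) v :
  (forall n, n.+1%:R != 0 :> C) ->
  is_submod N -> N v -> N (F_act g (v : Falg C d m)).
Proof.
move=> natC [N0 NL NG] Nv; have [D D0 Du] := shift_unit g.
apply: (polymap_closed natC N0 NL (polymap_act v) D0) => s /Du gs.
exact: NG.
Qed.

End PolynomialMaps.

(** * The Fischer form *)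

Lemma mpoly_alg_ind (C : comNzRingType) (n : nat) (P : {mpoly C[n]} -> Prop) :
  (forall a, P a%:MP) -> (forall j, P 'X_j) ->
  (forall f g, P f -> P g -> P (f + g)) -> (forall f g, P f -> P g -> P (f * g)) ->
  forall f, P f.
Proof.
move=> PC PX PD PM f; rewrite [f]mpolyE.
apply: (big_ind P) => [||u _]; [exact: (PC 0) | exact: PD |].
rewrite -mul_mpolyC; apply: (PM) => //; rewrite mpolyXE_id.
apply: (big_ind P) => [||j _]; [exact: (PC 1) | exact: PM |].
by elim: (u j) => [|k IH]; [exact: (PC 1) | rewrite exprS; apply: PM].
Qed.

(** Induction by one variable factor at a time, which suits the adjointness of multiplication by a
    variable and differentiation. *)
Lemma mpoly_var_ind (C : comNzRingType) (n : nat) (P : {mpoly C[n]} -> Prop) :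
  P 1 -> (forall a f, P f -> P (a *: f)) -> (forall j f, P f -> P ('X_j * f)) ->
  (forall f g, P f -> P g -> P (f + g)) -> forall f, P f.
Proof.
move=> P1 PZ PX PD f; rewrite -[f]mulr1; move: (1) P1.
elim/mpoly_alg_ind: f => [a|j|f h Pf Ph|f h Pf Ph] g Pg.
- by rewrite mul_mpolyC; exact: PZ.
- exact: PX.
- by rewrite mulrDl; apply: PD; [apply: Pf|apply: Ph].
- by rewrite -mulrA; apply: Pf; exact: Ph.
Qed.

Lemma mcoeff0_meval (C : comNzRingType) (n : nat) (f : {mpoly C[n]}) :
  f@_0%MM = f.@[fun=> 0].
Proof.
rewrite {1}[f]mpolyE [in RHS](mpolyE f) !raddf_sum /=; apply: eq_bigr => u _.
rewrite mcoeffZ mevalZ mcoeffX mevalX; congr (_ * _).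
have [->|u0] := eqVneq u 0%MM.
  by rewrite big1 // => i _; rewrite mnm0E.
have [i ui] : exists i, u i != 0%N.
  apply/existsP; apply: contraR u0 => /existsPn h; apply/eqP/mnmP => i.
  by rewrite mnm0E; move: (h i); rewrite negbK => /eqP.
by rewrite (bigD1 i) //= expr0n (negbTE ui) mul0r.
Qed.

Section Fischer.
Variables (C : fieldType) (conj : {rmorphism C -> C}).
Hypothesis conjK : involutive conj.
Hypothesis natC : forall n, n.+1%:R != 0 :> C.
(** Positive definiteness expressed without an order, so that the argument stays over an abstract
    field with an involution. *)
Hypothesis anisotropic : forall (I : eqType) (r : seq I) (k : I -> nat) (a : I -> C),
  \sum_(i <- r) (k i).+1%:R * (a i * conj (a i)) = 0 -> forall i, i \in r -> a i = 0.

Section Form.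
Variables (n : nat) (nu : 'I_n -> nat).
Hypothesis nu_gt0 : forall j, (0 < nu j)%N.

(** Monomials are orthogonal with squared norm u! nu^u. With this norm, multiplication by X_j is
    adjoint to nu_j times the derivative in X_j. *)
Definition fweight (u : 'X_{1..n}) : nat := (\prod_j ((u j)`! * nu j ^ u j))%N.

Lemma fweight_gt0 u : (0 < fweight u)%N.
Proof. by rewrite prodn_gt0 // => j; rewrite muln_gt0 fact_gt0 expn_gt0 nu_gt0. Qed.

Lemma fweight_addU u j : fweight (u + U_(j)) = (nu j * (u j).+1 * fweight u)%N.
Proof.
rewrite /fweight (bigD1 j) //= [in RHS](bigD1 j) //= mnmDE mnm1E eqxx addn1.
rewrite factS expnS [X in (_ * X)%N](_ : _ =
  \prod_(i < n | i != j) ((u i)`! * nu i ^ u i))%N; first by ring.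
by apply: eq_bigr => i ij; rewrite mnmDE mnm1E eq_sym (negbTE ij) addn0.
Qed.

Definition fform (f h : {mpoly C[n]}) : C :=
  monext (fun u a => (fweight u)%:R * (a * conj h@_u)) f.

Let gD h u (a b : C) : (fweight u)%:R * ((a + b) * conj h@_u) =
  (fweight u)%:R * (a * conj h@_u) + (fweight u)%:R * (b * conj h@_u).
Proof. by rewrite mulrDl mulrDr. Qed.

Lemma fformDl f g h : fform (f + g) h = fform f h + fform g h.
Proof. exact: monextD. Qed.

Lemma fformE r f h : uniq r -> {subset msupp f <= r} ->
  fform f h = \sum_(u <- r) (fweight u)%:R * (f@_u * conj h@_u).
Proof. by move=> ur fr; rewrite /fform (monextE (gD h) ur fr). Qed.

Lemma fform_conj f h : fform f h = conj (fform h f).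
Proof.
pose r := undup (msupp f ++ msupp h); have ur : uniq r by exact: undup_uniq.
have fr : {subset msupp f <= r} by move=> u uf; rewrite mem_undup mem_cat uf.
have hr : {subset msupp h <= r} by move=> u uh; rewrite mem_undup mem_cat uh orbT.
rewrite (fformE _ ur fr) (fformE _ ur hr) rmorph_sum; apply: eq_bigr => u _.
by rewrite !rmorphM conjK rmorph_nat [conj _ * _]mulrC.
Qed.

Lemma fformZl a f h : fform (a *: f) h = a * fform f h.
Proof.
rewrite (fformE h (msupp_uniq f) (@msuppZ_le _ _ a f)) mulr_sumr.
by apply: eq_bigr => u _; rewrite mcoeffZ; ring.
Qed.

Lemma fformDr f g h : fform f (g + h) = fform f g + fform f h.
Proof. by rewrite fform_conj fformDl rmorphD -!fform_conj. Qed.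

Lemma fformZr a f h : fform f (a *: h) = conj a * fform f h.
Proof. by rewrite fform_conj fformZl rmorphM -fform_conj. Qed.

Lemma fform0l h : fform 0 h = 0.
Proof. by rewrite -(scale0r 0) fformZl mul0r. Qed.

Lemma fform0r h : fform h 0 = 0.
Proof. by rewrite fform_conj fform0l rmorph0. Qed.

Lemma fform_suml I (r : seq I) P (F : I -> {mpoly C[n]}) h :
  fform (\sum_(i <- r | P i) F i) h = \sum_(i <- r | P i) fform (F i) h.
Proof. exact: (big_morph (fform^~ h) (fun f g => fformDl f g h) (fform0l h)). Qed.

Lemma fform_sumr I (r : seq I) P (F : I -> {mpoly C[n]}) h :
  fform h (\sum_(i <- r | P i) F i) = \sum_(i <- r | P i) fform h (F i).
Proof. exact: (big_morph (fform h) (fformDr h) (fform0r h)). Qed.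

Lemma fformX u h : fform 'X_[u] h = (fweight u)%:R * conj h@_u.
Proof. by rewrite -['X_[u]]scale1r /fform (monextZX (gD h)) mul1r. Qed.

Lemma fform_definite f : fform f f = 0 -> f = 0.
Proof.
rewrite /fform /monext => f0; apply/mpolyP => u; rewrite mcoeff0.
have [uf|/memN_msupp_eq0 //] := boolP (u \in msupp f).
apply: (anisotropic (r := msupp f) (k := fun u => (fweight u).-1) (a := fun u => f@_u)) => //.
by rewrite -[RHS]f0; apply: eq_bigr => v _; rewrite prednK // fweight_gt0.
Qed.

Lemma fform_mulX j f h : fform ('X_j * f) h = (nu j)%:R * fform f h^`M(j).
Proof.
rewrite [f]mpolyE mulr_sumr !fform_suml mulr_sumr; apply: eq_bigr => u _.
rewrite -scalerAr !fformZl mulrCA; congr (_ * _); rewrite mulrC -mpolyXD !fformX.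
by rewrite fweight_addU mcoeff_mderiv rmorphMn -mulr_natl !natrM; ring.
Qed.

Variables (S S' : 'I_n -> 'I_n -> C).
Hypothesis SS' : forall k j, (nu k)%:R * S k j = (nu j)%:R * conj (S' j k).

Definition linsubst (S : 'I_n -> 'I_n -> C) (f : {mpoly C[n]}) : {mpoly C[n]} :=
  f \mPo [tuple \sum_k S k j *: 'X_k | j < n].

Lemma linsubstD S0 f g : linsubst S0 (f + g) = linsubst S0 f + linsubst S0 g.
Proof. exact: rmorphD. Qed.

Lemma linsubstM S0 f g : linsubst S0 (f * g) = linsubst S0 f * linsubst S0 g.
Proof. exact: rmorphM. Qed.

Lemma linsubstX j : linsubst S 'X_j = \sum_k S k j *: 'X_k.
Proof. by rewrite /linsubst comp_mpolyXU -tnth_nth tnth_mktuple. Qed.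

Lemma linsubst_mderiv h j :
  (linsubst S' h)^`M(j) = \sum_k S' j k *: linsubst S' h^`M(k).
Proof.
elim/mpoly_alg_ind: h => [a|i|f g Ef Eg|f g Ef Eg].
- rewrite /linsubst comp_mpolyC mderivC big1 // => k _.
  by rewrite mderivC raddf0 scaler0.
- rewrite /linsubst comp_mpolyXU -tnth_nth tnth_mktuple raddf_sum /=.
  have dX k l : ('X_l : {mpoly C[n]})^`M(k) = (l == k)%:R%:MP.
    rewrite mderivX mnm1E; case: eqP => [->|_]; last by rewrite scale0r.
    by rewrite scale1r -[X in (X - _)%MM]add0m addmK mpolyX0.
  rewrite (bigD1 j) //= [RHS](bigD1 i) //= !mderivZ !dX !eqxx comp_mpolyC.
  rewrite big1 ?addr0 => [|k kj]; last by rewrite mderivZ dX (negbTE kj) scaler0.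
  rewrite big1 ?addr0 // => k ki; rewrite dX eq_sym (negbTE ki).
  by rewrite comp_mpolyC scaler0.
- rewrite linsubstD mderivD Ef Eg -big_split /=.
  by apply: eq_bigr => k _; rewrite mderivD linsubstD scalerDr.
- rewrite linsubstM mderivM Ef Eg.
  rewrite mulr_suml mulr_sumr -big_split /=; apply: eq_bigr => k _.
  rewrite mderivM linsubstD !linsubstM scalerDr.
  by rewrite scalerAl scalerAr.
Qed.

(** Adjoint substitutions of the variables stay adjoint on all polynomials: a variable factor of f
    becomes a derivative of h, to which the chain rule [linsubst_mderiv] applies. *)
Lemma fform_adjoint f h : fform (linsubst S f) h = fform f (linsubst S' h).
Proof.
elim/mpoly_var_ind: f h => [|a f IH|j f IH|f g IHf IHg] h.
- rewrite /linsubst rmorph1 -mpolyX0 !fformX !mcoeff0_meval comp_mpoly_meval.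
  congr (_ * conj (meval _ _)); apply: funext => j.
  rewrite tnth_mktuple raddf_sum big1 // => k _ /=.
  by rewrite mevalZ mevalXU mulr0.
- by rewrite /linsubst linearZ -/(linsubst _ _) !fformZl IH.
- rewrite linsubstM linsubstX mulr_suml fform_suml.
  rewrite fform_mulX linsubst_mderiv fform_sumr mulr_sumr; apply: eq_bigr => k _.
  by rewrite -scalerAl fformZl fform_mulX IH fformZr mulrA mulrA -SS' [_ * S _ _]mulrC.
- by rewrite linsubstD !fformDl IHf IHg.
Qed.

End Form.
Section AdjointAction.
Variables (d m : nat).

Definition adj_mx (g : 'M[C]_m) : 'M[C]_m := map_mx conj g^T.

(** The case of C[x_1, ..., x_m] with all nu equal to 1. It is also the hypothesis [SS'] for F,
    provided that t(w) is given squared norm w!; this is the origin of [tweight]. *)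
Lemma mon_act_adjoint (g : 'M[C]_m) (u v : 'X_{1..m}) :
  (fweight (fun=> 1%N) v)%:R * (mon_act g 'X_[u])@_v
  = (fweight (fun=> 1%N) u)%:R * conj (mon_act (adj_mx g) 'X_[v])@_u.
Proof.
have SS (k j : 'I_m) : 1%:R * g k j = 1%:R * conj (adj_mx g j k) by rewrite !mxE conjK.
have := fform_adjoint (nu := fun=> 1%N) SS 'X_[u] 'X_[v].
rewrite fformX fform_conj fformX rmorphM conjK rmorph_nat => <-.
by [].
Qed.

Definition tweight (j : 'I_(ntmon d m)) : nat := fweight (fun=> 1%N) (mon_of j).

Lemma tweight_gt0 j : (0 < tweight j)%N.
Proof. exact: fweight_gt0. Qed.

Definition tform : Falg C d m -> Falg C d m -> C := fform tweight.

Lemma t_var_sum (q : {mpoly C[m]}) :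
  t d q = \sum_(k < ntmon d m) q@_(mon_of k) *: 'X_k.
Proof.
rewrite /t (reindex (@enum_val _ xpredT)) /=; last first.
  by apply: onW_bij; exact: enum_val_bij.
by apply: eq_bigr => k _; rewrite enum_valK.
Qed.

Lemma tform_adjoint g f h : tform (F_act g f) h = tform f (F_act (adj_mx g) h).
Proof.
have actE (a : 'M[C]_m) (q : Falg C d m) : F_act a q =
    linsubst (fun k j => (mon_act a 'X_[mon_of j])@_(mon_of k)) q.
  rewrite /F_act /linsubst; congr (_ \mPo _); apply: eq_from_tnth => j.
  by rewrite !tnth_mktuple t_var_sum.
rewrite !actE; apply: fform_adjoint => k j.
exact: mon_act_adjoint.
Qed.

End AdjointAction.

End Fischer.

(** * Highest weight vectors *)

Section LU.
Variable C : fieldType.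

(** D is a product of characteristic polynomials of the proper leading blocks: where it is nonzero,
    these blocks of g + s are invertible and the last diagonal entry of T is a Schur complement. *)
Lemma lu_shift m (g : 'M[C]_m) : exists2 D : {poly C}, D != 0 &
  forall s, D.[s] != 0 -> exists L T : 'M[C]_m,
    [/\ is_trig_mx L, is_trig_mx T^T & g + s%:M = L *m T].
Proof.
elim: m g => [|m IHm].
  move=> g; exists 1; first exact: oner_neq0.
  move=> s _; exists 1%:M, 1%:M; split; try by apply/is_trig_mxP => -[].
  by apply/matrixP => -[].
rewrite -addn1 => g; rewrite -[g]submxK.
move: (ulsubmx g) (ursubmx g) (dlsubmx g) (drsubmx g) => A b c e.
have [D1 D10 D1P] := IHm A; have [D2 D20 D2P] := shift_unit A.
exists (D1 * D2); first by rewrite mulf_neq0.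
move=> s; rewrite hornerM mulf_eq0 negb_or => /andP[/D1P [L [T [trL trT AE]]] /D2P].
rewrite AE unitmx_mul => /andP[uL uT].
exists (block_mx L 0 (c *m invmx T) 1%:M).
exists (block_mx T (invmx L *m b) 0 (e + s%:M - c *m invmx T *m (invmx L *m b))); split.
- by rewrite is_trig_block_mx // eqxx trL scalar_mx_is_trig.
- rewrite tr_block_mx is_trig_block_mx // trmx0 eqxx trT /=.
  by apply/is_trig_mxP => i j; rewrite !ord1.
rewrite mulmx_block !mul0mx !mulmx0 !mul1mx !addr0 -AE mulmxKV // mulKVmx //.
by rewrite [_ *m (_ *m b) + _]addrC subrK [in LHS]scalar_mx_block add_block_mx !addr0.
Qed.

Lemma lower_upper_shift m (g : 'M[C]_m) : exists2 D : {poly C}, D != 0 &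
  forall s, D.[s] != 0 -> exists (L U : 'M[C]_m) (z : 'rV[C]_m),
    [/\ upper_unitriangular L^T, upper_unitriangular U, forall i, z 0 i != 0
      & g + s%:M = L *m (diag_mx z *m U)].
Proof.
have [D1 D10 D1P] := lu_shift g; have [D2 D20 D2P] := shift_unit g.
exists (D1 * D2); first by rewrite mulf_neq0.
move=> s; rewrite hornerM mulf_eq0 negb_or => /andP[/D1P [L [T [trL trT gE]]] /D2P].
have diag_nz (M : 'M[C]_m) : is_trig_mx M -> M \in unitmx -> forall i, M i i != 0.
  move=> trM; rewrite unitmxE unitfE det_trig // prodf_seq_neq0 => /allP h i.
  by apply: h; rewrite mem_index_enum.
rewrite gE unitmx_mul => /andP[uL uT].
have Lnz := diag_nz L trL uL.
have Tnz i : T i i != 0.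
  by have := diag_nz T^T trT _ i; rewrite unitmx_tr mxE; apply.
exists (L *m diag_mx (\row_i (L i i)^-1)), (diag_mx (\row_i (T i i)^-1) *m T).
exists (\row_i (L i i * T i i)); split.
- move=> i j ji; rewrite mxE mul_mx_diag !mxE.
  have [->|ij] := eqVneq i j; first by rewrite divff.
  move/is_trig_mxP: trL => -> //; first by rewrite mul0r.
  by rewrite ltn_neqAle ji andbT eq_sym.
- move=> i j ji; rewrite mul_diag_mx !mxE.
  have [->|ij] := eqVneq i j; first by rewrite mulVf.
  move/is_trig_mxP: trT => /(_ j i); rewrite mxE => -> //; first by rewrite mulr0.
  by rewrite ltn_neqAle ji andbT eq_sym.
- by move=> i; rewrite mxE mulf_neq0.
set D3 := diag_mx (\row_i (T i i)^-1); set D4 := diag_mx _; set D5 := diag_mx _.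
suff E : D4 *m (D5 *m D3) = 1%:M by rewrite -!mulmxA (mulmxA D5) (mulmxA D4) E mul1mx.
rewrite !mulmx_diag -diag_const_mx; congr diag_mx.
by apply/rowP => i; rewrite !mxE; field; rewrite Lnz Tnz.
Qed.

End LU.

(** * Weight components *)

Section Restriction.
Variables (C : fieldType) (n : nat).
Implicit Types (P Q : pred 'X_{1..n}) (f : {mpoly C[n]}).

Definition restrict P f : {mpoly C[n]} := \sum_(u <- msupp f | P u) f@_u *: 'X_[u].

Lemma restrictE P f u : (restrict P f)@_u = if P u then f@_u else 0.
Proof.
rewrite /restrict raddf_sum /=.
have [uf|uf] := boolP (u \in msupp f); last first.
  rewrite (memN_msupp_eq0 uf) if_same big_seq_cond big1 // => v /andP[vf _].
  rewrite mcoeffZ mcoeffX; case: eqP => [vu|]; last by rewrite mulr0.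
  by rewrite vu (negbTE uf) in vf.
rewrite big_mkcond (bigD1_seq u) //= big1 ?addr0 => [|v vu].
  by case: ifP => // _; rewrite mcoeffZ mcoeffX eqxx mulr1.
by case: ifP => // _; rewrite mcoeffZ mcoeffX (negbTE vu) mulr0.
Qed.

Lemma restrict_restrict P Q f : restrict P (restrict Q f) = restrict (predI P Q) f.
Proof.
by apply/mpolyP => u; rewrite !restrictE /=; case: (P u); case: (Q u).
Qed.

Lemma restrictT f : restrict xpredT f = f.
Proof. by apply/mpolyP => u; rewrite restrictE. Qed.

Lemma eq_restrict P Q f : P =1 Q -> restrict P f = restrict Q f.
Proof. by move=> PQ; apply/mpolyP => u; rewrite !restrictE PQ. Qed.

End Restriction.

Section Weights.
Variables (C : fieldType) (d m : nat).
Hypothesis natC : forall n, n.+1%:R != 0 :> C.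
Local Notation F := (Falg C d m).
Local Notation M := 'M[C]_m.

Definition xweight (u : 'X_{1..ntmon d m}) (i : 'I_m) : nat :=
  (\sum_j mon_of j i * u j)%N.

Definition torus_char (lam : seq nat) (z : 'rV[C]_m) : C :=
  \prod_i z 0 i ^+ nth 0%N lam i.

Definition has_weight (lam : seq nat) (f : F) : Prop :=
  forall z : 'rV[C]_m, (forall i, z 0 i != 0) ->
    F_act (diag_mx z) f = torus_char lam z *: f.

Lemma mon_act_diag (z : 'rV[C]_m) (u : 'X_{1..m}) :
  mon_act (diag_mx z) 'X_[u] = (\prod_i z 0 i ^+ u i) *: 'X_[u].
Proof.
rewrite /mon_act comp_mpolyX [in RHS]mpolyXE_id -scaler_prod; apply: eq_bigr => i _.
rewrite tnth_mktuple (bigD1 i) //= mxE eqxx mulr1n big1 ?addr0 ?exprZn //.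
by move=> k ki; rewrite mxE eq_sym eq_sym (negbTE ki) mulr0n scale0r.
Qed.

Lemma F_act_diag (z : 'rV[C]_m) (u : 'X_{1..ntmon d m}) :
  F_act (diag_mx z) ('X_[u] : F) = (\prod_i z 0 i ^+ xweight u i) *: 'X_[u].
Proof.
rewrite /F_act comp_mpolyX.
transitivity (\prod_(j < ntmon d m) ((\prod_i z 0 i ^+ mon_of j i) ^+ u j *: ('X_j : F) ^+ u j)).
  apply: eq_bigr => j _; rewrite tnth_mktuple mon_act_diag linearZ /= t_mon_of.
  by rewrite exprZn.
rewrite scaler_prod -mpolyXE_id; congr (_ *: _).
under eq_bigr => j _ do rewrite -prodrXl.
rewrite exchange_big /=; apply: eq_bigr => i _.
rewrite -prodrXr; apply: eq_bigr => j _.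
by rewrite -exprM.
Qed.

Lemma F_act_diag_sum (z : 'rV[C]_m) (f : F) : F_act (diag_mx z) f =
  \sum_(u <- msupp f) (\prod_i z 0 i ^+ xweight u i) *: (f@_u *: 'X_[u]).
Proof.
rewrite /F_act comp_mpolyEX; apply: eq_bigr => u _.
by rewrite -/(F_act (diag_mx z) ('X_[u] : F)) F_act_diag !scalerA mulrC.
Qed.

Lemma F_act_diagE (z : 'rV[C]_m) (f : F) u :
  (F_act (diag_mx z) f)@_u = (\prod_i z 0 i ^+ xweight u i) * f@_u.
Proof.
rewrite F_act_diag_sum raddf_sum /=.
have [uf|uf] := boolP (u \in msupp f); last first.
  rewrite (memN_msupp_eq0 uf) mulr0 big_seq big1 // => v vf.
  rewrite !mcoeffZ mcoeffX; case: eqP => [vu|]; last by rewrite !mulr0.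
  by rewrite -vu vf in uf.
rewrite (bigD1_seq u) //= !mcoeffZ mcoeffX eqxx mulr1 [Y in _ + Y]big1 ?addr0 // => v vu.
by rewrite !mcoeffZ mcoeffX (negbTE vu) !mulr0.
Qed.

Lemma has_weightP lam f :
  has_weight lam f <-> (forall u, f@_u != 0 -> forall i, xweight u i = nth 0%N lam i).
Proof.
split=> [hf u fu i|hf z z0].
  (* Scaling x_i alone by 2 reads off its degree, since the powers of 2 are distinct in
     characteristic zero. *)
  pose z : 'rV[C]_m := \row_k (if k == i then 2%:R else 1).
  have z0 k : z 0 k != 0 by rewrite mxE; case: ifP => _; [exact: natC 1 | exact: oner_neq0].
  have zE (e : 'I_m -> nat) : \prod_k z 0 k ^+ e k = (2 ^ e i)%:R.
    rewrite (bigD1 i) //= mxE eqxx -natrX big1 ?mulr1 // => k ki.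
    by rewrite mxE (negbTE ki) expr1n.
  have := congr1 (mcoeff u) (hf z z0); rewrite F_act_diagE mcoeffZ /torus_char.
  rewrite (zE (xweight u)) (zE (fun k => nth 0%N lam k)) => /(mulIf fu).
  by move/(nat_inj_field natC)/eqP; rewrite eqn_exp2l // => /eqP.
apply/mpolyP => u; rewrite F_act_diagE mcoeffZ.
have [->|fu] := eqVneq f@_u 0; first by rewrite !mulr0.
by congr (_ * _); apply: eq_bigr => i _; rewrite (hf u fu).
Qed.

(** Scaling x_i by s multiplies the part of degree k in x_i by s^k, so this part is a coefficient of
    a curve that lies in N for s nonzero. *)
Lemma restrict_weight_submod (N : set (F_glmod C d m)) f i k : is_submod N -> N f ->
  N (restrict (fun u => xweight u i == k) (f : F)).
Proof.
move=> [N0 NL NG] Nf.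
pose l := [seq ('X^(xweight u i) : {poly C}, (f : F)@_u *: ('X_[u] : F)) | u <- msupp (f : F)].
pose z s : 'rV[C]_m := \row_k (if k == i then s else 1).
have E s : \sum_(x <- l) x.1.[s] *: x.2 = F_act (diag_mx (z s)) f.
  rewrite [RHS]F_act_diag_sum big_map; apply: eq_bigr => u _ /=.
  rewrite hornerXn; congr (_ *: _); rewrite (bigD1 i) //= mxE eqxx big1 ?mulr1 // => j ji.
  by rewrite mxE (negbTE ji) expr1n.
have E' : \sum_(x <- l) x.1`_k *: x.2 = restrict (fun u => xweight u i == k) f.
  rewrite big_map /restrict [RHS]big_mkcond; apply: eq_bigr => u _ /=.
  by rewrite coefXn eq_sym; case: eqP => _; rewrite ?scale1r ?scale0r.
rewrite -E'; apply: (curve_coef natC N0 NL (negbT (polyX_eq0 C)) _ k) => s.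
rewrite hornerX => s0; rewrite [X in N X]E; apply: NG => //.
rewrite unitmxE det_diag unitfE prodf_seq_neq0; apply/allP => j _ /=.
by rewrite mxE; case: ifP => // _; exact: oner_neq0.
Qed.

End Weights.

Lemma gen_submod_submod (C : fieldType) (m : nat) (M : glmod C m) (v : M) :
  is_submod (gen_submod v).
Proof.
split=> [N [] //|a u w Gu Gw N sN Nv|g u gu Gu N sN Nv].
  by have [_ NL _] := sN; apply: NL; [exact: Gu|exact: Gw].
by have [_ _ NG] := sN; apply: NG => //; exact: Gu.
Qed.

Lemma gen_submod_self (C : fieldType) (m : nat) (M : glmod C m) (v : M) : gen_submod v v.
Proof. by []. Qed.

Lemma F_actZ (C : fieldType) (d m : nat) (g : 'M[C]_m) a (f : Falg C d m) :
  F_act g (a *: f) = a *: F_act g f.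
Proof. by rewrite /F_act linearZ. Qed.

Lemma F_actB (C : fieldType) (d m : nat) (g : 'M[C]_m) (f h : Falg C d m) :
  F_act g (f - h) = F_act g f - F_act g h.
Proof. by rewrite /F_act linearB. Qed.

Section HighestWeight.
Variables (C : fieldType) (conj : {rmorphism C -> C}).
Hypothesis conjK : involutive conj.
Hypothesis natC : forall n, n.+1%:R != 0 :> C.
Hypothesis anisotropic : forall (I : eqType) (r : seq I) (k : I -> nat) (a : I -> C),
  \sum_(i <- r) (k i).+1%:R * (a i * conj (a i)) = 0 -> forall i, i \in r -> a i = 0.
Variables (d m : nat).
Local Notation F := (Falg C d m).
Local Notation M := 'M[C]_m.
Local Notation tf := (@tform C conj d m).

Let tfDl f g h : tf (f + g) h = tf f h + tf g h. Proof. exact: fformDl. Qed.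
Let tfZl a f h : tf (a *: f) h = a * tf f h. Proof. exact: fformZl. Qed.
Let tfDr f g h : tf h (f + g) = tf h f + tf h g. Proof. exact: fformDr. Qed.
Let tfZr a f h : tf h (a *: f) = conj a * tf h f. Proof. exact: fformZr. Qed.
Let tf_conj f h : tf f h = conj (tf h f). Proof. exact: fform_conj. Qed.

Definition tform_right (h f : F) : C^o := tf f h.

Let tform_right_linear h : linear (tform_right h).
Proof. by move=> a x y; rewrite /tform_right tfDl tfZl. Qed.

HB.instance Definition _ h :=
  GRing.isLinear.Build C F C^o _ (tform_right h) (@tform_right_linear h).

Let adj_unitri (L : M) : upper_unitriangular L^T -> upper_unitriangular (adj_mx conj L).
Proof. by move=> uL i j ji; rewrite mxE uL // rmorph_nat. Qed.

(* Off finitely many s, g + s = L z U with L, U unitriangular and z diagonal, so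
   <(g + s) v, w> is a multiple of <v, L^* w>. *)
Lemma hwv_orth_act (lam : seq nat) (v w : F) (g : M) :
  highest_weight_vector lam (v : F_glmod C d m) ->
  (forall U : M, upper_unitriangular U -> tf v (F_act U w) = 0) ->
  tf (F_act g v) w = 0.
Proof.
move=> [_ vU vz] wU; have [D D0 DP] := lower_upper_shift g.
apply: (@polymap_closed C m C^o [set 0] (fun g => tform_right w (F_act g v)) g natC _ _ _ D D0).
- by [].
- by move=> a x y -> ->; rewrite /= scaler0 addr0.
- by apply: polymap_linear; exact: polymap_act.
move=> s /DP [L [U [z [uL uU z0 gE]]]]; rewrite /= /tform_right gE !F_actM.
rewrite [F_act U v]vU // [F_act _ v]vz // F_actZ tfZl.
rewrite (tform_adjoint conjK) wU ?mulr0 //; exact: adj_unitri.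
Qed.

(** By [hwv_orth_act] the vector w is orthogonal to every g v, hence to the whole module generated
    by v, and w lies in that module. *)
Lemma hwv_orth_gen (lam : seq nat) (v w : F) :
  highest_weight_vector lam (v : F_glmod C d m) ->
  gen_submod (v : F_glmod C d m) w ->
  (forall U : M, upper_unitriangular U -> tf v (F_act U w) = 0) -> w = 0.
Proof.
move=> hv Gw wU; pose N : set (F_glmod C d m) := [set u : F | forall g, tf (F_act g u) w = 0].
apply: (fform_definite anisotropic (@tweight_gt0 d m)).
suff : N w by move=> /(_ 1%:M); rewrite F_act1.
apply: (Gw N); last by move=> g; exact: hwv_orth_act hv wU.
split=> [g|a x y Nx Ny g|h x hu Nx g].
- by rewrite /F_act linear0; exact: fform0l.
- by rewrite F_act_linear tfDl tfZl Nx Ny mulr0 addr0.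
by rewrite -F_actM Nx.
Qed.

Lemma tform_has_weight lam (v w : F) : has_weight lam v ->
  tf w v = tf (restrict (fun u => [forall i, xweight u i == nth 0%N lam i]) w) v.
Proof.
move=> /(has_weightP natC) hv; rewrite ![tf _ v]tf_conj; congr (conj _).
rewrite /tform /fform /monext; apply: eq_bigr => u _.
rewrite restrictE; case: ifP => // /negbT; rewrite negb_forall => /existsP [i /eqP ui].
have [->|vu] := eqVneq v@_u 0; first by rewrite !mul0r.
by case: ui; exact: hv.
Qed.

Lemma hwv_has_weight lam (v : F) :
  highest_weight_vector lam (v : F_glmod C d m) -> has_weight lam v.
Proof. by case. Qed.

(** Vectors of different weights are orthogonal, so by [hwv_orth_gen] a highest weight vector of
    another weight would be zero. *)
Lemma hwv_unique (lam mu : seq nat) (v w : F) :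
  highest_weight_vector lam (v : F_glmod C d m) ->
  highest_weight_vector mu (w : F_glmod C d m) ->
  gen_submod (v : F_glmod C d m) w -> forall i : 'I_m, nth 0%N lam i = nth 0%N mu i.
Proof.
move=> hv hw Gw i; have [w0 wU _] := hw; apply: contra_neq_eq w0 => lam_mu.
apply: (hwv_orth_gen hv Gw) => U /wU /= ->.
rewrite (tform_has_weight _ (hwv_has_weight hw)).
suff -> : restrict (fun u => [forall i, xweight u i == nth 0%N mu i]) v = 0.
  exact: fform0l.
apply/mpolyP => u; rewrite restrictE mcoeff0; case: ifP => // /forallP /(_ i) /eqP ui.
apply/eqP; apply: contraNT lam_mu => vu.
by rewrite -ui (proj1 (has_weightP natC _ _) (hwv_has_weight hv) u vu).
Qed.

Lemma tform_torus lam (v y : F) (z : 'rV[C]_m) : has_weight lam v ->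
  (forall i, z 0 i != 0) -> tf (F_act (diag_mx z) y) v = torus_char lam z * tf y v.
Proof.
move=> hv z0; have := tform_adjoint conjK (diag_mx z) y v; rewrite /tform => ->.
have -> : adj_mx conj (diag_mx z) = diag_mx (\row_i conj (z 0 i)).
  by apply/matrixP => i j; rewrite !mxE eq_sym rmorphMn; case: eqP => // ->.
rewrite hv => [|i]; last by rewrite mxE fmorph_eq0.
rewrite -/(tf _ _) -/(tf y v) tfZr; congr (_ * _).
rewrite /torus_char rmorph_prod; apply: eq_bigr => i _.
by rewrite mxE rmorphXn conjK.
Qed.

Lemma tform_unitri lam (v w : F) (U : M) : has_weight lam v -> has_weight lam w ->
  upper_unitriangular U -> tf (F_act U w) v = tf w v.
Proof.
move=> hv hw uU.
(* Conjugating U by this one-parameter torus gives the entries U i j s^(j-i). The form is constant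
   along this curve for s nonzero, and at s = 0 the curve reaches the identity. *)
pose z s : 'rV[C]_m := \row_i s ^- i.
pose G : 'M[{poly C}]_m := \matrix_(i, j) (U i j *: 'X^(j - i)).
pose f g := tform_right v (F_act g w) - tform_right v (F_act U w).
have pf : polymap f.
  have [k E] := polymapD (polymap_linear (tform_right v) (polymap_act w))
    (polymap_const m (- tform_right v (F_act U w))).
  by exists k.
have [l lE] := polymap_curve G pf.
have G0 : map_mx (fun q : {poly C} => q.[0]) G = 1%:M.
  apply/matrixP => i j; rewrite !mxE hornerZ hornerXn.
  have [ij|ji] := ltnP i j; last by rewrite uU //; have [->|] := eqVneq i j; rewrite ?subnn ?mulr1 ?mul0r.
  rewrite expr0n subn_eq0 leqNgt ij mulr0.
  by case: eqP => // e; rewrite e ltnn in ij.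
suff : f (map_mx (fun q : {poly C} => q.[0]) G) = 0.
  by rewrite G0 /f F_act1 => /eqP; rewrite subr_eq0 => /eqP.
rewrite lE; apply: (@curve_closed C C^o [set 0] natC _ _ l 'X) => [//|a x y -> ->| |s].
- by rewrite /= scaler0 addr0.
- by rewrite polyX_eq0.
rewrite hornerX -lE => s0.
have zs : forall i, z s 0 i != 0 by move=> i; rewrite mxE invr_neq0 // expf_neq0.
have GE : map_mx (fun q : {poly C} => q.[s]) G
    = diag_mx (z s) *m (U *m diag_mx (\row_i (z s 0 i)^-1)).
    apply/matrixP => i j; rewrite mul_mx_diag mul_diag_mx !mxE hornerZ hornerXn invrK.
  have [ij|ji] := leqP i j.
    by rewrite mulrCA; congr (_ * _); rewrite -{2}(subnK ij) exprD mulrC mulfK // expf_neq0.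
  have -> : U i j = 0 by rewrite uU ?(ltnW ji) // -val_eqE gtn_eqF.
  by rewrite !(mul0r, mulr0).
have zV i : (\row_i (z s 0 i)^-1) 0 i != 0 :> C by rewrite mxE invr_neq0.
rewrite /= /f /tform_right GE !F_actM.
rewrite [F_act (diag_mx _) w]hw // !F_actZ tfZl.
have charV : torus_char lam (\row_i (z s 0 i)^-1) * torus_char lam (z s) = 1.
  rewrite /torus_char -big_split big1 //= => i _.
  by have := zs i; rewrite !mxE => si; rewrite exprVn mulVf // expf_neq0.
have E := tform_torus (F_act U w) hv zs.
transitivity (torus_char lam (\row_i (z s 0 i)^-1) * (torus_char lam (z s) * tf (F_act U w) v)
  - tf (F_act U w) v).
  by congr (_ * _ - _).
by rewrite mulrA charV mul1r subrr.
Qed.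

(* If f is a submodule vector with <v, f> <> 0, its component of weight lam is
   again in the submodule, and it differs from a multiple of v by a vector
   orthogonal to v, which vanishes by hwv_orth_gen. *)
Lemma hwv_irreducible (lam : seq nat) (v : F) :
  highest_weight_vector lam (v : F_glmod C d m) ->
  is_irreducible (gen_submod (v : F_glmod C d m)).
Proof.
move=> hv; split; first exact: gen_submod_submod.
  by exists v => //; case: hv.
move=> N sN NG; have [N0 NL NA] := sN.
have [orth|] := pselect (forall f, N f -> tf v f = 0).
  left; apply/seteqP; split=> [f Nf|f ->] //=.
  by apply: (hwv_orth_gen hv) => [|U uU]; [exact: NG | apply: orth; apply: submod_act_all].
move=> /existsNP[f /not_implyP[Nf vf]]; right.
have hvw := hwv_has_weight hv.
pose Q r (u : 'X_{1..ntmon d m}) := all (fun i => xweight u i == nth 0%N lam i) r.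
have NQ r : N (restrict (Q r) f).
  elim: r => [|i r IH]; first by rewrite (eq_restrict _ (Q := xpredT)) ?restrictT.
  have := restrict_weight_submod natC i (nth 0%N lam i) sN IH.
  by rewrite restrict_restrict.
pose h : F := restrict (Q (enum 'I_m)) f.
have hw : has_weight lam h.
  apply/(has_weightP natC) => u; rewrite restrictE; case: ifP => [/allP uQ _ i|]; last by rewrite eqxx.
  by apply/eqP/uQ; rewrite mem_enum.
have vh : tf v h = tf v f.
  rewrite !(tf_conj v) (tform_has_weight f hvw); congr (conj (tf _ _)).
  apply: eq_restrict => u; apply/allP/forallP => H i; last by move=> _; exact: H.
  by apply: H; rewrite mem_enum.
have vv : tf v v != 0.
  by apply/eqP => /(fform_definite anisotropic (@tweight_gt0 d m)); have [/eqP] := hv.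
pose a := conj (tf v f / tf v v).
have a0 : a != 0 by rewrite fmorph_eq0 mulf_neq0 ?invr_neq0 //; exact/eqP.
have hE : h = a *: v.
  apply: subr0_eq; apply: (hwv_orth_gen hv).
    have [_ GL _] := gen_submod_submod (v : F_glmod C d m).
    by rewrite -scaleNr addrC; apply: GL => //; apply: NG; exact: NQ.
  move=> U uU; rewrite tf_conj (tform_unitri hvw) //; last first.
    move=> z z0; by rewrite F_actB F_actZ hw // hvw // scalerBr !scalerA mulrC.
  rewrite -tf_conj tfDr vh -scaleNr tfZr rmorphN /a conjK.
  by rewrite mulNr divfK // subrr.
apply/seteqP; split=> // u; apply => //.
have -> : v = a^-1 *: (h : F) + 0 by rewrite hE scalerA mulVf // scale1r addr0.
by apply: (NL a^-1 h 0) => //; exact: NQ.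
Qed.

End HighestWeight.

(** * Homogeneous submodules as polynomial modules *)

Lemma subspace_row_basis (C : fieldType) (n : nat) (N : set 'rV[C]_n) :
  N 0 -> (forall a u v, N u -> N v -> N (a *: u + v)) ->
  exists r (B : 'M[C]_(r, n)), row_free B /\ forall x, N x <-> (x <= B)%MS.
Proof.
move=> N0 NL.
pose P r := `[< exists2 B : 'M[C]_(r, n), row_free B & forall i, N (row i B) >].
have P0 : exists r, P r.
  by exists 0%N; apply/asboolP; exists 0; [rewrite /row_free mxrank0 | case].
have Pn r : P r -> (r <= n)%N.
  by move=> /asboolP[B fB _]; rewrite -(eqP fB) rank_leq_col.
case: (ex_maxnP P0 Pn) => r /asboolP[B fB NB] rmax.
exists r, B; split=> // x; split=> [Nx|/submxP[D ->]]; last first.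
  by rewrite mulmx_sum_row; apply: (subspace_sum N0 NL).
apply: contraT => xB.
have : P (r + 1)%N.
  apply/asboolP; exists (col_mx B x) => [|i].
    rewrite /row_free eqn_leq rank_leq_row -addsmxE addn1 -[X in (X < _)%N](eqP fB).
    by apply: rank_ltmx; rewrite ltmxE addsmxSl addsmx_sub submx_refl.
  rewrite -[X in row X _]splitK; case: (split i) => j /=.
    by rewrite rowKu.
  by rewrite rowKd ord1 row_id.
by move/rmax; rewrite addn1 ltnn.
Qed.

Section PolynomialModules.
Variables (C : fieldType) (d m : nat).
Local Notation F := (Falg C d m).

Lemma homogeneous_mdeg e (f : F) u : homogeneous e f -> f@_u != 0 -> (mdeg u < e.+1)%N.
Proof.
move=> hf fu; have <- : tdeg u = e.
  by apply/eqP; apply: contraNT fu => ue; rewrite (dhomog_nemf_coeff hf ue).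
rewrite ltnS mdegE /tdeg; apply: leq_sum => j _.
by have /andP[w0 _] := mon_of_deg j; rewrite -{1}[u j]muln1 leq_mul2l w0 orbT.
Qed.

(** Every variable has positive weight, so a fixed weighted degree bounds the ordinary degree and N
    embeds in a space of coefficient vectors. The matrix entries come from [polymap_act]. *)
Lemma polynomial_submod e (N : set (F_glmod C d m)) :
  is_submod N -> (forall f, N f -> homogeneous e (f : F)) -> is_polynomial_module N.
Proof.
move=> [N0 NL NG] Nh.
pose n := #|{: 'X_{1..(ntmon d m) < e.+1}}|.
pose vec (f : F) : 'rV[C]_n := \row_k f@_(bmnm (enum_val (k : 'I_#|{: 'X_{1..(ntmon d m) < e.+1}}|))).
pose unvec (x : 'rV[C]_n) : F := \sum_k x 0 k *: 'X_[bmnm (enum_val (k : 'I_#|{: 'X_{1..(ntmon d m) < e.+1}}|))].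
have vec_lin a f g : vec (a *: f + g) = a *: vec f + vec g.
  by apply/rowP => k; rewrite !mxE mcoeffD mcoeffZ.
have unvec_lin a x y : unvec (a *: x + y) = a *: unvec x + unvec y.
  rewrite /unvec scaler_sumr -big_split; apply: eq_bigr => k _.
  by rewrite !mxE scalerDl scalerA.
have vecK f : N f -> unvec (vec f) = f.
  move=> Nf; apply/mpolyP => u; rewrite /unvec raddf_sum /=.
  have uE k : (vec f 0 k *: ('X_[bmnm (enum_val k)] : F))@_u =
      f@_(bmnm (enum_val k)) * (bmnm (enum_val k) == u)%:R.
    by rewrite mcoeffZ mcoeffX mxE.
  under eq_bigr => k _ do rewrite uE.
  have [fu|/(homogeneous_mdeg (Nh f Nf)) ue] := eqVneq (f : F)@_u 0.
    rewrite fu big1 // => k _; case: eqP => [->|]; last by rewrite mulr0.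
    by rewrite fu mul0r.
  pose b : 'X_{1..(ntmon d m) < e.+1} := BMultinom ue; rewrite (bigD1 (enum_rank b)) //= enum_rankK eqxx mulr1.
  rewrite big1 ?addr0 // => k kb; case: eqP => [ku|]; last by rewrite mulr0.
  case/eqP: kb; rewrite -[k]enum_valK; congr enum_rank.
  by apply/val_inj/esym/eqP; rewrite eq_sym; apply/eqP.
have unvecK x : vec (unvec x) = x.
  apply/rowP => k; rewrite mxE /unvec raddf_sum /= (bigD1 k) //=.
  rewrite mcoeffZ mcoeffX eqxx mulr1 big1 ?addr0 // => l lk.
  rewrite mcoeffZ mcoeffX; case: eqP => [kl|]; last by rewrite mulr0.
  by case/eqP: lk; apply/enum_val_inj/val_inj.
have vec0 : vec 0 = 0 by apply/rowP => k; rewrite !mxE mcoeff0.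
have unvec0 : unvec 0 = 0 by rewrite /unvec big1 // => k _; rewrite mxE scale0r.
have unvec_sum r (c : 'I_r -> C) (x : 'I_r -> 'rV[C]_n) :
    unvec (\sum_j c j *: x j) = \sum_j c j *: unvec (x j).
  apply: (big_ind2 (fun a b => unvec a = b)) => // [a a' b b' <- <-|j _].
    by rewrite -[a in LHS]scale1r unvec_lin scale1r.
  by rewrite -[X in unvec X]addr0 unvec_lin unvec0 addr0.
pose N' : set 'rV[C]_n := [set x | N (unvec x)].
have [r [A [fA NA]]] : exists r (A : 'M[C]_(r, n)),
    row_free A /\ forall x, N' x <-> (x <= A)%MS.
  apply: subspace_row_basis; rewrite /N' /= ?unvec0 //.
  by move=> a x y Nx Ny; rewrite unvec_lin; exact: NL.
pose ev (j : 'I_r) : F := unvec (row j A).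
have Ne j : N (ev j) by apply/NA; exact: row_sub.
have expand f : N f -> f = \sum_j (vec f *m pinvmx A) 0 j *: ev j.
  move=> Nf; have fA' : (vec f <= A)%MS by apply/NA; rewrite /N' /= vecK.
  by rewrite -unvec_sum -mulmx_sum_row mulmxKpV // vecK.
have free_ev (c : 'I_r -> C) : \sum_j c j *: ev j = 0 -> forall j, c j = 0.
  rewrite -unvec_sum => /(congr1 vec); rewrite unvecK vec0 => cA j.
  have : (\row_j c j) *m A = 0.
    by rewrite mulmx_sum_row -[RHS]cA; apply: eq_bigr => k _; rewrite mxE.
  by move/eqP; rewrite mulmx_free_eq0 // => /eqP /rowP /(_ j); rewrite !mxE.
have ev_inj : injective ev.
  move=> i j /(congr1 vec); rewrite !unvecK !rowE => /(row_free_inj fA) /rowP /(_ i).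
  rewrite !mxE !eqxx /= => E; apply/eqP; case: (i == j) E => // /eqP.
  by rewrite oner_eq0.
have [l lE] := choice (fun j => polymap_act (ev j)).
pose P (i j : 'I_r) : {mpoly C[m * m]} :=
  \sum_(x <- l j) (vec x.2 *m pinvmx A) 0 i *: x.1.
have PE g i j : (vec (F_act g (ev j)) *m pinvmx A) 0 i = (P i j).@[fun k => mxvec g 0 k].
  have -> : vec (F_act g (ev j)) = \sum_(x <- l j) x.1.@[fun k => mxvec g 0 k] *: vec x.2.
    rewrite lE; apply: (big_ind2 (fun a b => vec a = b)) => // [a a' b b' <- <-|x _].
      by rewrite -[a in LHS]scale1r vec_lin scale1r.
    by rewrite -[X in vec X]addr0 vec_lin vec0 addr0.
  rewrite mulmx_suml summxE /P raddf_sum; apply: eq_bigr => x _.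
  by rewrite /= mevalZ -scalemxAl mxE mulrC.
exists r, ev, P; split=> //; last first.
  move=> g gu j; rewrite [LHS](expand _ (NG _ _ gu (Ne j))).
  by apply: eq_bigr => i _; rewrite PE.
split=> [v [j _ <-] //|s c us sev s0 v vs|u Nu].
  have ps : perm_eq s [seq ev j | j <- enum 'I_r & ev j \in s].
    apply: uniq_perm => // [|w]; first by rewrite map_inj_uniq // filter_uniq // enum_uniq.
    apply/idP/mapP => [ws|[j]]; last by rewrite mem_filter => /andP[js _] ->.
    have [j _ jw] := sev w ws; exists j; last by [].
    by rewrite mem_filter jw ws mem_enum.
  have [j _ jv] := sev v vs.
  have := free_ev (fun j => if ev j \in s then c (ev j) else 0).
  rewrite -[X in X = 0](_ : \sum_(v <- s) c v *: v = _); last first.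
    rewrite (perm_big _ ps) big_map big_filter big_enum_cond big_mkcond.
    by apply: eq_bigr => k _; rewrite ?inE /=; case: (ev k \in s); rewrite ?scale0r.
  by move=> /(_ s0 j); rewrite jv vs.
exists [seq ev j | j <- enum 'I_r].
(* Coefficients are indexed by vectors rather than indices; as [ev] is injective, the sum has a
   single term on each basis vector. *)
exists (fun v => \sum_(j | ev j == v) (vec u *m pinvmx A) 0 j); split.
  by move=> v /mapP[j _ ->]; exists j.
rewrite big_map big_enum [LHS](expand u Nu); apply: eq_bigr => j _ /=.
congr (_ *: _); rewrite (bigD1 j) //= big1 ?addr0 // => k /andP[/eqP/ev_inj->].
by rewrite eqxx.
Qed.

End PolynomialModules.

Section HighestWeightModules.
Variables (C : fieldType) (conj : {rmorphism C -> C}).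
Hypothesis conjK : involutive conj.
Hypothesis natC : forall n, n.+1%:R != 0 :> C.
Hypothesis anisotropic : forall (I : eqType) (r : seq I) (k : I -> nat) (a : I -> C),
  \sum_(i <- r) (k i).+1%:R * (a i * conj (a i)) = 0 -> forall i, i \in r -> a i = 0.
Variables (d m : nat).
Local Notation F := (Falg C d m).

Lemma homogeneous_submod e : is_submod ([set f : F | homogeneous e f] : set (F_glmod C d m)).
Proof.
split=> [|a u v hu hv|g v _ hv]; rewrite /homogeneous /=.
- exact: rpred0.
- by apply: rpredD => //; apply: rpredZ.
exact: homogeneous_act.
Qed.

Lemma gen_homogeneous e (v f : F) : homogeneous e v ->
  gen_submod (v : F_glmod C d m) f -> homogeneous e f.
Proof. by move=> hv; apply; first exact: homogeneous_submod. Qed.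

Lemma gen_isom_V e (lam : seq nat) (v : F) : (size lam <= m)%N -> homogeneous e v ->
  highest_weight_vector lam (v : F_glmod C d m) ->
  isom_V lam (gen_submod (v : F_glmod C d m)).
Proof.
move=> sz hv hw; split=> //; last by exists v.
  exact: (hwv_irreducible conjK natC anisotropic hw).
apply: (polynomial_submod (e := e)); first exact: gen_submod_submod.
by move=> f; exact: gen_homogeneous.
Qed.

End HighestWeightModules.

(** * The modules generated by the J *)

Section JFormAction.
Variables (C : fieldType) (m : nat).
Local Notation t := (@t C 3 m).
Local Notation F := (Falg C 3 m).
Local Notation lf := (@linform C m).
Implicit Types x y z : {mpoly C[m]}.

Lemma mon_actM_mul (g : 'M[C]_m) x y : mon_act g (x * y) = mon_act g x * mon_act g y.
Proof. exact: rmorphM. Qed.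

Lemma mon_actX (g : 'M[C]_m) x n : mon_act g (x ^+ n) = mon_act g x ^+ n.
Proof. exact: rmorphXn. Qed.

Lemma F_act_J32_form (g : 'M[C]_m) x y :
  F_act g (J32_form x y) = J32_form (mon_act g x) (mon_act g y).
Proof.
rewrite {1}/F_act rel32_morph /= -!/(F_act g (t _)) !F_act_t.
by rewrite !(mon_actM_mul, mon_actX).
Qed.

Lemma F_act_J42_form (g : 'M[C]_m) x y :
  F_act g (J42_form x y) = J42_form (mon_act g x) (mon_act g y).
Proof.
rewrite {1}/F_act rel42_morph /= -!/(F_act g (t _)) !F_act_t.
by rewrite !(mon_actM_mul, mon_actX).
Qed.

Lemma F_act_J222_form (g : 'M[C]_m) x y z :
  F_act g (J222_form x y z) = J222_form (mon_act g x) (mon_act g y) (mon_act g z).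
Proof.
rewrite {1}/F_act rel222_morph /= -!/(F_act g (t _)) !F_act_t.
by rewrite !(mon_actM_mul, mon_actX).
Qed.

Local Notation row i x := (x \mPo [tuple xvar C (i : 'I_3) j | j < m]).

Let rowM (i : 'I_3) x y : row i (x * y) = row i x * row i y.
Proof. exact: rmorphM. Qed.

Lemma phi_t_rows x e : (0 < e <= 3)%N -> x \is e.-homog ->
  phi 3 (t x) = row 0 x + row 1 x + row 2%:R x.
Proof. by move=> e3 hx; rewrite (phi_t 3 e3 hx) /psum_lin big_ord3. Qed.

Let phi_t1 x : x \is 1.-homog -> phi 3 (t x) = row 0 x + row 1 x + row 2%:R x.
Proof. by move=> hx; exact: phi_t_rows hx. Qed.

Let phi_t2 x y : x \is 1.-homog -> y \is 1.-homog ->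
  phi 3 (t (x * y)) = row 0 (x * y) + row 1 (x * y) + row 2%:R (x * y).
Proof. by move=> hx hy; exact: phi_t_rows (dhomogM hx hy). Qed.

Let phi_t3 x y z : x \is 1.-homog -> y \is 1.-homog -> z \is 1.-homog ->
  phi 3 (t (x * y * z)) = row 0 (x * y * z) + row 1 (x * y * z) + row 2%:R (x * y * z).
Proof. by move=> hx hy hz; exact: phi_t_rows (dhomogM (dhomogM hx hy) hz). Qed.

Let phi_rel32 (a b c d e f g h : F) : phi 3 (rel32 a b c d e f g h)
  = rel32 (phi 3 a) (phi 3 b) (phi 3 c) (phi 3 d) (phi 3 e) (phi 3 f) (phi 3 g) (phi 3 h).
Proof. exact: (rel32_morph (comp_mpoly _)). Qed.

Let phi_rel42 (a b c d e f g h : F) : phi 3 (rel42 a b c d e f g h)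
  = rel42 (phi 3 a) (phi 3 b) (phi 3 c) (phi 3 d) (phi 3 e) (phi 3 f) (phi 3 g) (phi 3 h).
Proof. exact: (rel42_morph (comp_mpoly _)). Qed.

Let phi_rel222 (a b c d e f g h i : F) : phi 3 (rel222 a b c d e f g h i)
  = rel222 (phi 3 a) (phi 3 b) (phi 3 c) (phi 3 d) (phi 3 e) (phi 3 f) (phi 3 g)
           (phi 3 h) (phi 3 i).
Proof. exact: (rel222_morph (comp_mpoly _)). Qed.

Let cube x : x ^+ 3 = x * x * x. Proof. by rewrite exprSr expr2. Qed.
Let sqr x : x ^+ 2 = x * x. Proof. by rewrite expr2. Qed.

(** As [phi] turns t(q) into the sum of the values of q on three rows, this is a polynomial identity
    in the six values of x and y. *)
Lemma J32_form_K x y : x \is 1.-homog -> y \is 1.-homog -> K C 3 m (J32_form x y).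
Proof.
move=> hx hy; rewrite /K /= /J32_form phi_rel32 !cube !sqr mulrA.
rewrite (phi_t3 hx hx hx) (phi_t3 hx hx hy) (phi_t3 hx hy hy).
rewrite (phi_t2 hx hx) (phi_t2 hx hy) (phi_t2 hy hy) (phi_t1 hx) (phi_t1 hy).
rewrite !(rowM _ x x, rowM _ x y, rowM _ y y, rowM _ (x * x), rowM _ (x * y)).
move: (row 0 x) (row 1 x) (row 2%:R x) (row 0 y) (row 1 y) (row 2%:R y).
by move=> *; rewrite /rel32; ring.
Qed.

Lemma J42_form_K x y : x \is 1.-homog -> y \is 1.-homog -> K C 3 m (J42_form x y).
Proof.
move=> hx hy; rewrite /K /= /J42_form phi_rel42 !cube !sqr mulrA.
rewrite (phi_t3 hx hx hx) (phi_t3 hx hx hy) (phi_t3 hx hy hy).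
rewrite (phi_t2 hx hx) (phi_t2 hx hy) (phi_t2 hy hy) (phi_t1 hx) (phi_t1 hy).
rewrite !(rowM _ x x, rowM _ x y, rowM _ y y, rowM _ (x * x), rowM _ (x * y)).
move: (row 0 x) (row 1 x) (row 2%:R x) (row 0 y) (row 1 y) (row 2%:R y).
by move=> *; rewrite /rel42; ring.
Qed.

Lemma J222_form_K x y z : x \is 1.-homog -> y \is 1.-homog -> z \is 1.-homog ->
  K C 3 m (J222_form x y z).
Proof.
move=> hx hy hz; rewrite /K /= /J222_form phi_rel222 !sqr.
rewrite (phi_t2 hx hx) (phi_t2 hx hy) (phi_t2 hx hz) (phi_t2 hy hy) (phi_t2 hy hz).
rewrite (phi_t2 hz hz) (phi_t1 hx) (phi_t1 hy) (phi_t1 hz).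
rewrite !(rowM _ x x, rowM _ x y, rowM _ x z, rowM _ y y, rowM _ y z, rowM _ z z).
move: (row 0 x) (row 1 x) (row 2%:R x) (row 0 y) (row 1 y) (row 2%:R y)
  (row 0 z) (row 1 z) (row 2%:R z).
by move=> *; rewrite /rel222; ring.
Qed.

Let tC a x : t (a%:MP * x) = a%:MP * t x.
Proof. by rewrite !mul_mpolyC linearZ. Qed.

Let tD x y : t (x + y) = t x + t y.
Proof. exact: linearD. Qed.

Section Substitution.
Variables (a b d : C) (x y : {mpoly C[m]}).
Local Notation P := {mpoly C[m]}.
Local Notation A := (a%:MP : P).
Local Notation B := (b%:MP : P).
Local Notation D := (d%:MP : P).
Local Notation A' := (a%:MP : F).
Local Notation B' := (b%:MP : F).
Local Notation D' := (d%:MP : F).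

Let s1 : t (B * y + D * x) =
  B' * t y + D' * t x.
Proof. by rewrite tD !tC. Qed.

Let s2 : t ((A * x) ^+ 2) =
  A' * (A' * t (x ^+ 2)).
Proof.
rewrite (_ : (A * x) ^+ 2 =
  A * (A * (x ^+ 2))); last by ring.
by rewrite ?tD !tC.
Qed.

Let s3 : t (A * x * (B * y + D * x)) =
  A' * (B' * t (x * y)) + A' * (D' * t (x ^+ 2)).
Proof.
rewrite (_ : A * x * (B * y + D * x) =
  A * (B * (x * y)) + A * (D * (x ^+ 2))); last by ring.
by rewrite ?tD !tC.
Qed.

Let s4 : t ((B * y + D * x) ^+ 2) =
    B' * (B' * t (y ^+ 2)) + B' * (D' * t (x * y)) + B' * (D' * t (x * y))
  + D' * (D' * t (x ^+ 2)).
Proof.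
rewrite (_ : (B * y + D * x) ^+ 2 =
    B * (B * (y ^+ 2)) + B * (D * (x * y)) + B * (D * (x * y))
  + D * (D * (x ^+ 2))); last by ring.
by rewrite ?tD !tC.
Qed.

Let s5 : t ((A * x) ^+ 3) =
  A' * (A' * (A' * t (x ^+ 3))).
Proof.
rewrite (_ : (A * x) ^+ 3 =
  A * (A * (A * (x ^+ 3)))); last by ring.
by rewrite ?tD !tC.
Qed.

Let s6 : t ((A * x) ^+ 2 * (B * y + D * x)) =
    A' * (A' * (B' * t (x ^+ 2 * y))) + A' * (A' * (D' * t (x ^+ 3))).
Proof.
rewrite (_ : (A * x) ^+ 2 * (B * y + D * x) =
    A * (A * (B * (x ^+ 2 * y))) + A * (A * (D * (x ^+ 3)))); last by ring.
by rewrite ?tD !tC.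
Qed.

Let s7 : t (A * x * (B * y + D * x) ^+ 2) =
    A' * (B' * (B' * t (x * y ^+ 2))) + A' * (B' * (D' * t (x ^+ 2 * y)))
  + A' * (B' * (D' * t (x ^+ 2 * y))) + A' * (D' * (D' * t (x ^+ 3))).
Proof.
rewrite (_ : A * x * (B * y + D * x) ^+ 2 =
    A * (B * (B * (x * y ^+ 2))) + A * (B * (D * (x ^+ 2 * y)))
  + A * (B * (D * (x ^+ 2 * y))) + A * (D * (D * (x ^+ 3)))); last by ring.
by rewrite ?tD !tC.
Qed.

Let consts (p q : nat) : (a ^+ p * b ^+ q)%:MP = A' ^+ p * B' ^+ q :> F.
Proof. by rewrite mpolyCM !(rmorphXn (@mpolyC _ C)). Qed.

(** Several facts at once: a = b = 1 gives the invariance under unitriangular matrices, d = 0 the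
    weight (3, 2), and b = 0 the vanishing on proportional linear forms. *)
Lemma J32_form_subst : J32_form (A * x) (B * y + D * x) =
  (a ^+ 3 * b ^+ 2)%:MP * J32_form x y.
Proof.
rewrite consts /J32_form s1 s2 s3 s4 s5 s6 s7 tC.
move: A' B' D' (t x) (t y) (t (x ^+ 2)) (t (x * y)) (t (y ^+ 2)) (t (x ^+ 3))
  (t (x ^+ 2 * y)) (t (x * y ^+ 2)) => *; rewrite /rel32; ring.
Qed.

Lemma J42_form_subst : J42_form (A * x) (B * y + D * x) =
  (a ^+ 4 * b ^+ 2)%:MP * J42_form x y.
Proof.
rewrite consts /J42_form s1 s2 s3 s4 s5 s6 s7 tC.
move: A' B' D' (t x) (t y) (t (x ^+ 2)) (t (x * y)) (t (y ^+ 2)) (t (x ^+ 3))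
  (t (x ^+ 2 * y)) (t (x * y ^+ 2)) => *; rewrite /rel42; ring.
Qed.

Variables (e f g : C) (z : P).
Local Notation E := (e%:MP : P).
Local Notation G := (f%:MP : P).
Local Notation H := (g%:MP : P).
Local Notation E' := (e%:MP : F).
Local Notation G' := (f%:MP : F).
Local Notation H' := (g%:MP : F).

Let r1 : t (E * z + G * y + H * x) =
  E' * t z + G' * t y + H' * t x.
Proof.
by rewrite ?tD !tC.
Qed.

Let r2 : t (A * x * (E * z + G * y + H * x)) =
    A' * (E' * t (x * z)) + A' * (G' * t (x * y)) + A' * (H' * t (x ^+ 2)).
Proof.
rewrite (_ : A * x * (E * z + G * y + H * x) =
    A * (E * (x * z)) + A * (G * (x * y)) + A * (H * (x ^+ 2))); last by ring.
by rewrite ?tD !tC.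
Qed.

Let r3 : t ((B * y + D * x) * (E * z + G * y + H * x)) =
    B' * (E' * t (y * z)) + B' * (G' * t (y ^+ 2)) + B' * (H' * t (x * y))
  + D' * (E' * t (x * z)) + D' * (G' * t (x * y)) + D' * (H' * t (x ^+ 2)).
Proof.
rewrite (_ : (B * y + D * x) * (E * z + G * y + H * x) =
    B * (E * (y * z)) + B * (G * (y ^+ 2)) + B * (H * (x * y))
  + D * (E * (x * z)) + D * (G * (x * y)) + D * (H * (x ^+ 2))); last by ring.
by rewrite ?tD !tC.
Qed.

Let r4 : t ((E * z + G * y + H * x) ^+ 2) =
    E' * (E' * t (z ^+ 2)) + G' * (G' * t (y ^+ 2)) + H' * (H' * t (x ^+ 2))
  + (E' * (G' * t (y * z)) + E' * (G' * t (y * z)))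
  + (E' * (H' * t (x * z)) + E' * (H' * t (x * z)))
  + (G' * (H' * t (x * y)) + G' * (H' * t (x * y))).
Proof.
rewrite (_ : (E * z + G * y + H * x) ^+ 2 =
    E * (E * (z ^+ 2)) + G * (G * (y ^+ 2)) + H * (H * (x ^+ 2))
  + (E * (G * (y * z)) + E * (G * (y * z)))
  + (E * (H * (x * z)) + E * (H * (x * z)))
  + (G * (H * (x * y)) + G * (H * (x * y)))); last by ring.
by rewrite ?tD !tC.
Qed.

Let constE : (e ^+ 2)%:MP = E' ^+ 2 :> F.
Proof. by rewrite (rmorphXn (@mpolyC _ C)). Qed.

Lemma J222_form_subst : J222_form (A * x) (B * y + D * x) (E * z + G * y + H * x) =
  (a ^+ 2 * b ^+ 2 * e ^+ 2)%:MP * J222_form x y z.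
Proof.
rewrite mpolyCM consts constE /J222_form r1 r2 r3 r4 s1 s2 s3 s4 tC.
move: A' B' D' E' G' H' (t x) (t y) (t z) (t (x ^+ 2)) (t (x * y)) (t (x * z))
  (t (y ^+ 2)) (t (y * z)) (t (z ^+ 2)) => *; rewrite /rel222; ring.
Qed.

End Substitution.

End JFormAction.

Section Variables.
Variables (C : fieldType) (m : nat).

Lemma XE k (km : (k < m)%N) : X C m k = 'X_(Ordinal km).
Proof. by rewrite /X insubT. Qed.

Lemma X0 k : (m <= k)%N -> X C m k = 0.
Proof. by move=> mk; rewrite /X insubF // ltnNge mk. Qed.

Lemma X_homog k : X C m k \is 1.-homog.
Proof.
have [km|mk] := ltnP k m; last by rewrite X0 // rpred0.
by rewrite XE dhomogX /= mdeg1.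
Qed.

Lemma mon_act_var (g : 'M[C]_m) i : mon_act g 'X_i = \sum_k g k i *: 'X_k.
Proof. by rewrite /mon_act comp_mpolyXU -tnth_nth tnth_mktuple. Qed.

Lemma mon_act_diag_X (z : 'rV[C]_m) k (km : (k < m)%N) :
  mon_act (diag_mx z) (X C m k) = (z 0 (Ordinal km))%:MP * X C m k.
Proof.
rewrite XE mon_act_diag mul_mpolyC; congr (_ *: _).
rewrite (bigD1 (Ordinal km)) //= mnm1E eqxx expr1 big1 ?mulr1 // => i ik.
by rewrite mnm1E eq_sym (negbTE ik).
Qed.

Lemma mon_act_unitri_X (U : 'M[C]_m) k (km : (k < m)%N) : upper_unitriangular U ->
  mon_act U (X C m k) =
  X C m k + \sum_(l < m | (l < k)%N) (U l (Ordinal km))%:MP * X C m l.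
Proof.
move=> uU; rewrite XE mon_act_var (bigID (fun l : 'I_m => (l < k)%N)) /= addrC.
congr (_ + _); last first.
  apply: eq_bigr => l _; rewrite mul_mpolyC; congr (_ *: _).
  by rewrite (XE (ltn_ord l)); congr 'X_(_); apply: val_inj.
rewrite (bigD1 (Ordinal km)) /= -?leqNgt //= uU // eqxx scale1r big1 ?addr0 // => l.
by rewrite -leqNgt => /andP[kl lk]; rewrite uU // (negbTE lk) scale0r.
Qed.

End Variables.

Section JInKernel.
Variables (C : fieldType) (m : nat).

Lemma J32_K : K C 3 m (J32 C m).
Proof. by rewrite J32E; apply: J32_form_K; exact: X_homog. Qed.

Lemma J42_K : K C 3 m (J42 C m).
Proof. by rewrite J42E; apply: J42_form_K; exact: X_homog. Qed.

Lemma J222_K : K C 3 m (J222 C m).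
Proof. by rewrite J222E; apply: J222_form_K; exact: X_homog. Qed.

Lemma N32_K : N32 C m `<=` K C 3 m.
Proof. by move=> f; apply; [exact: K_submod | exact: J32_K]. Qed.

Lemma N42_K : N42 C m `<=` K C 3 m.
Proof. by move=> f; apply; [exact: K_submod | exact: J42_K]. Qed.

Lemma N222_K : N222 C m `<=` K C 3 m.
Proof. by move=> f; apply; [exact: K_submod | exact: J222_K]. Qed.

End JInKernel.

Section Evaluation.
Variables (C : fieldType) (m : nat) (theta : 'X_{1..m} -> C).

(** The variables t(w) are independent, so [theta] may be any function; it need not come from points
    of V^m. *)
Definition mon_eval (f : Falg C 3 m) : C := f.@[fun j => theta (mon_of j)].

Lemma mon_eval_t w : (0 < mdeg w <= 3)%N -> mon_eval (t 3 'X_[w]) = theta w.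
Proof. by move=> /mon_ofP[j <-]; rewrite /mon_eval t_mon_of mevalXU. Qed.

Let mon_eval_rel32 (a b c d e f g h : Falg C 3 m) : mon_eval (rel32 a b c d e f g h) =
  rel32 (mon_eval a) (mon_eval b) (mon_eval c) (mon_eval d) (mon_eval e) (mon_eval f)
    (mon_eval g) (mon_eval h).
Proof. exact: (rel32_morph (meval _)). Qed.

Let mon_eval_rel42 (a b c d e f g h : Falg C 3 m) : mon_eval (rel42 a b c d e f g h) =
  rel42 (mon_eval a) (mon_eval b) (mon_eval c) (mon_eval d) (mon_eval e) (mon_eval f)
    (mon_eval g) (mon_eval h).
Proof. exact: (rel42_morph (meval _)). Qed.

Let mon_eval_rel222 (a b c d e f g h i : Falg C 3 m) : mon_eval (rel222 a b c d e f g h i) =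
  rel222 (mon_eval a) (mon_eval b) (mon_eval c) (mon_eval d) (mon_eval e) (mon_eval f)
    (mon_eval g) (mon_eval h) (mon_eval i).
Proof. exact: (rel222_morph (meval _)). Qed.

Let mon_eval1 (i : 'I_m) : mon_eval (t 3 'X_i) = theta U_(i).
Proof. by apply: mon_eval_t; rewrite mdeg1. Qed.

Let mon_eval2 (i j : 'I_m) : mon_eval (t 3 ('X_i * 'X_j)) = theta (U_(i) + U_(j)).
Proof. by rewrite -mpolyXD mon_eval_t // mdegD !mdeg1. Qed.

Let mon_eval3 (i j k : 'I_m) :
  mon_eval (t 3 ('X_i * 'X_j * 'X_k)) = theta (U_(i) + U_(j) + U_(k)).
Proof. by rewrite -!mpolyXD mon_eval_t // !mdegD !mdeg1. Qed.

Lemma mon_eval_J32 (i j : 'I_m) : mon_eval (J32_form 'X_i 'X_j) =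
  rel32 (theta U_(i)) (theta U_(j)) (theta (U_(i) + U_(i))) (theta (U_(i) + U_(j)))
    (theta (U_(j) + U_(j))) (theta (U_(i) + U_(i) + U_(i)))
    (theta (U_(i) + U_(i) + U_(j))) (theta (U_(i) + U_(j) + U_(j))).
Proof.
rewrite mon_eval_rel32 !mon_eval1 [_ ^+ 3]exprSr !expr2 mulrA.
by rewrite !mon_eval2 !mon_eval3.
Qed.

Lemma mon_eval_J42 (i j : 'I_m) : mon_eval (J42_form 'X_i 'X_j) =
  rel42 (theta U_(i)) (theta U_(j)) (theta (U_(i) + U_(i))) (theta (U_(i) + U_(j)))
    (theta (U_(j) + U_(j))) (theta (U_(i) + U_(i) + U_(i)))
    (theta (U_(i) + U_(i) + U_(j))) (theta (U_(i) + U_(j) + U_(j))).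
Proof.
rewrite mon_eval_rel42 !mon_eval1 [_ ^+ 3]exprSr !expr2 mulrA.
by rewrite !mon_eval2 !mon_eval3.
Qed.

Lemma mon_eval_J222 (i j k : 'I_m) : mon_eval (J222_form 'X_i 'X_j 'X_k) =
  rel222 (theta U_(i)) (theta U_(j)) (theta U_(k)) (theta (U_(i) + U_(i)))
    (theta (U_(i) + U_(j))) (theta (U_(i) + U_(k))) (theta (U_(j) + U_(j)))
    (theta (U_(j) + U_(k))) (theta (U_(k) + U_(k))).
Proof. by rewrite mon_eval_rel222 !mon_eval1 !expr2 !mon_eval2. Qed.

End Evaluation.

(** * Nonvanishing, invariance and weights of the J *)

Section HighestWeightVectors.
Variables (C : fieldType) (m : nat).
Hypothesis natC : forall n, n.+1%:R != 0 :> C.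

Lemma torus_char2 a b (z : 'rV[C]_m) (m0 : (0 < m)%N) (m1 : (1 < m)%N) :
  torus_char [:: a; b] z = z 0 (Ordinal m0) ^+ a * z 0 (Ordinal m1) ^+ b.
Proof.
rewrite /torus_char (bigD1 (Ordinal m0)) //= (bigD1 (Ordinal m1)) //= big1 ?mulr1 //.
by move=> [[|[|i]] im] //=; rewrite nth_default.
Qed.

Lemma torus_char3 a b c (z : 'rV[C]_m) (m0 : (0 < m)%N) (m1 : (1 < m)%N) (m2 : (2 < m)%N) :
  torus_char [:: a; b; c] z =
  z 0 (Ordinal m0) ^+ a * z 0 (Ordinal m1) ^+ b * z 0 (Ordinal m2) ^+ c.
Proof.
rewrite /torus_char (bigD1 (Ordinal m0)) //= (bigD1 (Ordinal m1)) //=.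
rewrite (bigD1 (Ordinal m2)) //= big1 ?mulr1 ?mulrA //.
by move=> [[|[|[|i]]] im] //=; rewrite nth_default.
Qed.

Lemma unitri_X0 (U : 'M[C]_m) (m0 : (0 < m)%N) : upper_unitriangular U ->
  mon_act U (X C m 0) = X C m 0.
Proof. by move=> uU; rewrite (mon_act_unitri_X m0 uU) big_pred0 ?addr0. Qed.

Lemma unitri_X1 (U : 'M[C]_m) (m0 : (0 < m)%N) (m1 : (1 < m)%N) : upper_unitriangular U ->
  mon_act U (X C m 1) = X C m 1 + (U (Ordinal m0) (Ordinal m1))%:MP * X C m 0.
Proof.
move=> uU; rewrite (mon_act_unitri_X m1 uU) (bigD1 (Ordinal m0)) //= big1 ?addr0 //.
by move=> [[|i] im].
Qed.

Lemma unitri_X2 (U : 'M[C]_m) (m0 : (0 < m)%N) (m1 : (1 < m)%N) (m2 : (2 < m)%N) :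
  upper_unitriangular U ->
  mon_act U (X C m 2) = X C m 2 + (U (Ordinal m1) (Ordinal m2))%:MP * X C m 1
                        + (U (Ordinal m0) (Ordinal m2))%:MP * X C m 0.
Proof.
move=> uU; rewrite (mon_act_unitri_X m2 uU) -addrA; congr (_ + _).
rewrite (bigD1 (Ordinal m1)) //= (bigD1 (Ordinal m0)) //= big1 ?addr0 //.
by move=> [[|[|i]] im].
Qed.

Lemma J32_hwv : (1 < m)%N -> highest_weight_vector [:: 3; 2]%N (J32 C m : F_glmod C 3 m).
Proof.
move=> m1; have m0 := ltnW m1; rewrite J32E; split.
(* Among the monomials that occur, [theta] is 1 only on xy and x^2 y; the term 6 t(x^2 y) t(xy) is
   the only one that survives. *)
- pose theta (w : 'X_{1..m}) : C :=
    if (w (Ordinal m1) == 1%N) && (0 < w (Ordinal m0) <= 2)%N then 1 else 0.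
  apply/eqP => /(congr1 (mon_eval theta)); rewrite (XE _ m0) (XE _ m1) mon_eval_J32.
  rewrite /theta !mnmDE !mnm1E /= /mon_eval meval0 /rel32.
  rewrite !(mulr0, mul0r, mulr1, expr0n, subr0, addr0, expr1n) /=.
  by apply/eqP; exact: natC 5.
- move=> U uU /=; rewrite F_act_J32_form (unitri_X0 m0 uU) (unitri_X1 m0 m1 uU).
  have := J32_form_subst 1 1 (U (Ordinal m0) (Ordinal m1)) (X C m 0) (X C m 1).
  by rewrite !mpolyC1 !mul1r !expr1n mulr1 mpolyC1 mul1r.
move=> z _ /=; rewrite F_act_J32_form (mon_act_diag_X z m0) (mon_act_diag_X z m1).
have := J32_form_subst (z 0 (Ordinal m0)) (z 0 (Ordinal m1)) 0 (X C m 0) (X C m 1).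
rewrite mpolyC0 mul0r addr0 => ->; rewrite mul_mpolyC; congr (_ *: _).
by rewrite -[RHS]/(torus_char [:: 3; 2]%N z) (torus_char2 _ _ _ m0 m1).
Qed.

(** As [theta] vanishes on the variables x_i, this shows J42 to be nonzero even modulo the t(x_i),
    as [Jgen_notin_FplusK] requires. *)
Lemma J42_core_eval : (1 < m)%N ->
  exists2 theta : 'X_{1..m} -> C, forall i, theta U_(i)%MM = 0 & mon_eval theta (J42 C m) != 0.
Proof.
move=> m1; have m0 := ltnW m1; rewrite J42E.
(* Only t(x^2 y) is nonzero among the variables of J42, which leaves 6 t(x^2 y)^2. *)
pose theta (w : 'X_{1..m}) : C :=
  if (w (Ordinal m1) == 1%N) && (w (Ordinal m0) == 2%N) then 1 else 0.
exists theta; first by move=> i; rewrite /theta !mnm1E; case: eqP => // _; case: (_ == Ordinal m0).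
rewrite (XE _ m0) (XE _ m1) mon_eval_J42 /theta !mnmDE !mnm1E /= /rel42.
rewrite !(mulr0, mul0r, mulr1, expr0n, subr0, addr0, expr1n) /=.
exact: natC 5.
Qed.

Lemma J222_core_eval : (2 < m)%N ->
  exists2 theta : 'X_{1..m} -> C, forall i, theta U_(i)%MM = 0 & mon_eval theta (J222 C m) != 0.
Proof.
move=> m2; have m1 := ltnW m2; have m0 := ltnW m1; rewrite J222E.
(* The matrix of J222 becomes diagonal with entries 1, 1, 1, 3. *)
pose theta (w : 'X_{1..m}) : C :=
  if [|| w (Ordinal m0) == 2%N, w (Ordinal m1) == 2%N | w (Ordinal m2) == 2%N] then 1 else 0.
exists theta.
  by move=> i; rewrite /theta !mnm1E; do 3 case: (_ == Ordinal _).
rewrite (XE _ m0) (XE _ m1) (XE _ m2) mon_eval_J222 /theta !mnmDE !mnm1E /= /rel222.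
rewrite !(mulr0, mul0r, mulr1, expr0n, subr0, addr0, expr1n) /=.
exact: natC 2.
Qed.

Lemma J42_hwv : (1 < m)%N -> highest_weight_vector [:: 4; 2]%N (J42 C m : F_glmod C 3 m).
Proof.
move=> m1; have m0 := ltnW m1; rewrite J42E; split.
- rewrite -J42E; have [theta _ +] := J42_core_eval m1.
  by apply: contraNneq => ->; rewrite /mon_eval meval0.
- move=> U uU /=; rewrite F_act_J42_form (unitri_X0 m0 uU) (unitri_X1 m0 m1 uU).
  have := J42_form_subst 1 1 (U (Ordinal m0) (Ordinal m1)) (X C m 0) (X C m 1).
  by rewrite !mpolyC1 !mul1r !expr1n mulr1 mpolyC1 mul1r.
move=> z _ /=; rewrite F_act_J42_form (mon_act_diag_X z m0) (mon_act_diag_X z m1).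
have := J42_form_subst (z 0 (Ordinal m0)) (z 0 (Ordinal m1)) 0 (X C m 0) (X C m 1).
rewrite mpolyC0 mul0r addr0 => ->; rewrite mul_mpolyC; congr (_ *: _).
by rewrite -[RHS]/(torus_char [:: 4; 2]%N z) (torus_char2 _ _ _ m0 m1).
Qed.

Lemma J222_hwv : (2 < m)%N ->
  highest_weight_vector [:: 2; 2; 2]%N (J222 C m : F_glmod C 3 m).
Proof.
move=> m2; have m1 := ltnW m2; have m0 := ltnW m1; rewrite J222E; split.
- rewrite -J222E; have [theta _ +] := J222_core_eval m2.
  by apply: contraNneq => ->; rewrite /mon_eval meval0.
- move=> U uU /=; rewrite F_act_J222_form (unitri_X0 m0 uU) (unitri_X1 m0 m1 uU).
  rewrite (unitri_X2 m0 m1 m2 uU).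
  have := J222_form_subst 1 1 (U (Ordinal m0) (Ordinal m1)) (X C m 0) (X C m 1)
    1 (U (Ordinal m1) (Ordinal m2)) (U (Ordinal m0) (Ordinal m2)) (X C m 2).
  by rewrite !mpolyC1 !mul1r !expr1n !mulr1 mpolyC1 mul1r.
move=> z _ /=; rewrite F_act_J222_form (mon_act_diag_X z m0) (mon_act_diag_X z m1).
rewrite (mon_act_diag_X z m2).
have := J222_form_subst (z 0 (Ordinal m0)) (z 0 (Ordinal m1)) 0 (X C m 0) (X C m 1)
  (z 0 (Ordinal m2)) 0 0 (X C m 2).
rewrite mpolyC0 !mul0r !addr0 => ->; rewrite mul_mpolyC; congr (_ *: _).
by rewrite -[RHS]/(torus_char [:: 2; 2; 2]%N z) (torus_char3 _ _ _ _ m0 m1 m2).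
Qed.

End HighestWeightVectors.

Section WeightDegree.
Variables (C : fieldType) (d m : nat).
Hypothesis natC : forall n, n.+1%:R != 0 :> C.

Lemma tdeg_xweight (u : 'X_{1..ntmon d m}) : tdeg u = (\sum_i xweight u i)%N.
Proof.
rewrite /tdeg /xweight exchange_big /=; apply: eq_bigr => j _.
by rewrite mdegE big_distrr /=; apply: eq_bigr => i _; rewrite mulnC.
Qed.

Lemma has_weight_homogeneous lam (f : Falg C d m) : (size lam <= m)%N ->
  has_weight lam f -> homogeneous (sumn lam) f.
Proof.
move=> lm /(has_weightP natC) hf; apply/dhomogP => u; rewrite mcoeff_msupp => /hf uw.
rewrite [LHS]tdeg_xweight sumnE (big_nth 0%N) big_mkord (big_ord_widen _ (nth 0%N lam) lm) [RHS]big_mkcond /=.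
apply: eq_bigr => i _; rewrite uw; case: ltnP => // lami.
by rewrite nth_default.
Qed.

End WeightDegree.

Section GeneratedIdeals.
Variable A : comNzRingType.
Implicit Types S I : set A.

Lemma gen_ideal_closed S a u v : gen_ideal S u -> gen_ideal S v -> gen_ideal S (a * u + v).
Proof.
move=> [r [p [q [Sq ->]]]] [r' [p' [q' [Sq' ->]]]]; exists (r + r')%N.
exists (fun i => match split i with inl j => a * p j | inr j => p' j end).
exists (fun i => match split i with inl j => q j | inr j => q' j end).
split=> [i|]; first by case: split.
rewrite big_split_ord /= mulr_sumr; congr (_ + _); apply: eq_bigr => j _.
  by rewrite (unsplitK (inl j)) mulrA.
by rewrite (unsplitK (inr j)).
Qed.

Lemma gen_ideal0 S : gen_ideal S 0.
Proof. by exists 0%N, (fun=> 0), (fun=> 0); split=> [[]|] //; rewrite big_ord0. Qed.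

Lemma gen_ideal_sub S : S `<=` gen_ideal S.
Proof. by move=> f Sf; exists 1%N, (fun=> 1), (fun=> f); split=> //; rewrite big_ord1 mul1r. Qed.

Lemma gen_ideal_min S I : I 0 -> (forall a u v, I u -> I v -> I (a * u + v)) ->
  S `<=` I -> gen_ideal S `<=` I.
Proof.
move=> I0 IL SI _ [r [a [s [Ss ->]]]].
apply: (big_ind I) => // [u v Iu Iv|i _]; first by rewrite -[u]mul1r; exact: IL.
by rewrite -[_ * _]addr0; apply: IL => //; exact: SI.
Qed.

End GeneratedIdeals.

Section JMembership.
Variables (C : fieldType) (m : nat).
Hypothesis natC : forall n, n.+1%:R != 0 :> C.
Local Notation lf := (@linform C m).

(** Its action sends x_1, x_2, x_3 to prescribed linear forms. It may be singular, which
    [submod_act_all] permits. *)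
Definition cols_mx (x y z : 'rV[C]_m) : 'M[C]_m :=
  \matrix_(k, i) (if val i == 0%N then x 0 k else if val i == 1%N then y 0 k else z 0 k).

Lemma mon_act_cols x y z k (km : (k < m)%N) : mon_act (cols_mx x y z) (X C m k) =
  lf (if k == 0%N then x else if k == 1%N then y else z).
Proof.
rewrite XE mon_act_var /linform; apply: eq_bigr => l _.
by rewrite mxE /=; case: ifP => // _; case: ifP.
Qed.

Lemma J32_form_gen x y : (1 < m)%N -> N32 C m (J32_form (lf x) (lf y)).
Proof.
move=> m1; have m0 := ltnW m1.
have := submod_act_all (cols_mx x y y) natC (gen_submod_submod _) (@gen_submod_self _ _ (F_glmod C 3 m) (J32 C m)).
by rewrite /N32 J32E F_act_J32_form (mon_act_cols _ _ _ m0) (mon_act_cols _ _ _ m1).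
Qed.

Lemma J42_form_gen x y : (1 < m)%N -> N42 C m (J42_form (lf x) (lf y)).
Proof.
move=> m1; have m0 := ltnW m1.
have := submod_act_all (cols_mx x y y) natC (gen_submod_submod _) (@gen_submod_self _ _ (F_glmod C 3 m) (J42 C m)).
by rewrite /N42 J42E F_act_J42_form (mon_act_cols _ _ _ m0) (mon_act_cols _ _ _ m1).
Qed.

Lemma J222_form_gen x y z : (2 < m)%N -> N222 C m (J222_form (lf x) (lf y) (lf z)).
Proof.
move=> m2; have m1 := ltnW m2; have m0 := ltnW m1.
have := submod_act_all (cols_mx x y z) natC (gen_submod_submod _) (@gen_submod_self _ _ (F_glmod C 3 m) (J222 C m)).
rewrite /N222 J222E F_act_J222_form.
by rewrite (mon_act_cols _ _ _ m0) (mon_act_cols _ _ _ m1) (mon_act_cols _ _ _ m2).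
Qed.

Lemma linform1 x : (m <= 1)%N -> exists a, lf x = a%:MP * X C m 0.
Proof.
case: (posnP m) => [m0 _|m0 m1].
  exists 0; rewrite mul_mpolyC scale0r /linform big1 // => k _.
  by have := ltn_ord k; rewrite {2}m0.
exists (x 0 (Ordinal m0)); rewrite /linform (bigD1 (Ordinal m0)) //= big1 ?addr0 => [|k].
  by rewrite mul_mpolyC XE.
rewrite -val_eqE /= => k0; have := leq_trans (ltn_ord k) m1.
by case: (val k) k0.
Qed.

Lemma linform2 x : (m <= 2)%N -> exists a b, lf x = a%:MP * X C m 0 + b%:MP * X C m 1.
Proof.
have [m1 _|m1 m2] := leqP m 1.
  by have [a ->] := linform1 x m1; exists a, 0; rewrite [0%:MP * _]mul_mpolyC scale0r addr0.
have m0 := ltnW m1; exists (x 0 (Ordinal m0)), (x 0 (Ordinal m1)).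
rewrite /linform (bigD1 (Ordinal m0)) //= (bigD1 (Ordinal m1)) //= big1 ?addr0 => [|k].
  by rewrite !mul_mpolyC (XE _ m0) (XE _ m1).
rewrite -!val_eqE /= => /andP[k0 k1]; have := leq_trans (ltn_ord k) m2.
by case: (val k) k0 k1 => [|[]].
Qed.

(** The cases m < 2 matter because the multiplicity of a partition is taken at m = h(lambda). Both
    linear forms are then multiples of one variable, and the substitution formula with b = 0
    applies. *)
Lemma J32_form_dim1 x y : (m <= 1)%N -> J32_form (lf x) (lf y) = 0.
Proof.
move=> m1; have [a ->] := linform1 x m1; have [d ->] := linform1 y m1.
have := J32_form_subst a 0 d (X C m 0) 0.
by rewrite mulr0 add0r => ->; rewrite expr0n mulr0 mul_mpolyC scale0r.
Qed.

Lemma J42_form_dim1 x y : (m <= 1)%N -> J42_form (lf x) (lf y) = 0.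
Proof.
move=> m1; have [a ->] := linform1 x m1; have [d ->] := linform1 y m1.
have := J42_form_subst a 0 d (X C m 0) 0.
by rewrite mulr0 add0r => ->; rewrite expr0n mulr0 mul_mpolyC scale0r.
Qed.

Local Notation t := (@t C 3 m).

Let tprod (a b c d : C) (p q : {mpoly C[m]}) :
  t ((a%:MP * p + b%:MP * q) * (c%:MP * p + d%:MP * q)) =
  (a * c)%:MP * t (p ^+ 2) + (a * d + b * c)%:MP * t (p * q) + (b * d)%:MP * t (q ^+ 2).
Proof.
have tC e (x : {mpoly C[m]}) : t (e%:MP * x) = e%:MP * t x by rewrite !mul_mpolyC linearZ.
have tD (x y : {mpoly C[m]}) : t (x + y) = t x + t y by exact: linearD.
rewrite -!tC -!tD; congr t.
by rewrite mpolyCD !mpolyCM; ring.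
Qed.

Lemma J222_form_dim2 x y z : (m <= 2)%N -> J222_form (lf x) (lf y) (lf z) = 0.
Proof.
move=> m2; have [a [b ->]] := linform2 x m2; have [c [d ->]] := linform2 y m2.
have [e [f ->]] := linform2 z m2.
have tlin (p q : C) : t (p%:MP * X C m 0 + q%:MP * X C m 1) =
    p%:MP * t (X C m 0) + q%:MP * t (X C m 1).
  by rewrite !mul_mpolyC linearD !linearZ.
rewrite /J222_form !expr2 !tprod !tlin !mpolyCD !mpolyCM.
move: (t (X C m 0)) (t (X C m 1)) (t (X C m 0 ^+ 2)) (t (X C m 0 * X C m 1))
  (t (X C m 1 ^+ 2)) => p q pp pq qq.
move: (a%:MP) (b%:MP) (c%:MP) (d%:MP) (e%:MP) (f%:MP) => {}a {}b {}c {}d {}e {}f.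
by rewrite /rel222; ring.
Qed.

End JMembership.

Section Generators.
Variables (C : fieldType) (m : nat).
Hypothesis natC : forall n, n.+1%:R != 0 :> C.

(* For m < 3 the modules N222 (and for m < 2 all three) are zero; nshape m is the
   number of those that are not. *)
Definition nshape (n : nat) : nat := if (n < 2)%N then 0 else if n == 2%N then 2 else 3.

Definition shape (i : nat) : seq nat :=
  nth [::] [:: [:: 3; 2]; [:: 4; 2]; [:: 2; 2; 2]]%N i.

Definition Jgen (i : nat) : F_glmod C 3 m := nth 0 [:: J32 C m; J42 C m; J222 C m] i.

Definition Jmod (i : nat) : set (F_glmod C 3 m) := gen_submod (Jgen i).

Lemma nshapeP i : (i < nshape m)%N = (i < 3)%N && (size (shape i) <= m)%N.
Proof. by rewrite /nshape; case: m => [|[|[|n]]]; case: i => [|[|[|i]]]. Qed.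

Lemma Jgen_hwv i : (i < nshape m)%N -> highest_weight_vector (shape i) (Jgen i).
Proof.
rewrite nshapeP; case: i => [|[|[|//]]] /= sm.
- exact: J32_hwv.
- exact: J42_hwv.
- exact: J222_hwv.
Qed.

Lemma Jgen_homogeneous i : (i < nshape m)%N ->
  homogeneous (sumn (shape i)) (Jgen i : Falg C 3 m).
Proof.
move=> im; apply: (has_weight_homogeneous natC); first by move: im; rewrite nshapeP => /andP[].
exact: hwv_has_weight (Jgen_hwv im).
Qed.

Lemma Jmod_homogeneous i f : (i < nshape m)%N -> Jmod i f ->
  homogeneous (sumn (shape i)) (f : Falg C 3 m).
Proof. by move=> /Jgen_homogeneous hi; exact: gen_homogeneous. Qed.

Lemma Jmod_K i : (i < nshape m)%N -> Jmod i `<=` K C 3 m.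
Proof.
rewrite nshapeP; case: i => [|[|[|//]]] _; [exact: N32_K | exact: N42_K | exact: N222_K].
Qed.

Definition Junion : set (Falg C 3 m) := [set f | exists2 i, (i < nshape m)%N & Jmod i f].

Lemma K_closed a u v : K C 3 m u -> K C 3 m v -> K C 3 m (a * u + v).
Proof.
rewrite /K /= => Ku Kv; rewrite /phi rmorphD rmorphM /= -!/(phi 3 _) Ku Kv.
by rewrite mulr0 addr0.
Qed.

Lemma K_gen_ideal (w : C) : w ^+ 2 + w + 1 = 0 -> K C 3 m = gen_ideal Junion.
Proof.
move=> w0; apply/seteqP; split; last first.
  apply: gen_ideal_min; [by case: (K_submod C 3 m) | exact: K_closed |].
  by move=> f [i im]; exact: Jmod_K.
apply: (kernel_sub_ideal natC w0); [exact: gen_ideal0 | exact: gen_ideal_closed | | |].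
- move=> x y; have [m1|m1] := leqP m 1; first by rewrite J32_form_dim1 //; exact: gen_ideal0.
  apply: gen_ideal_sub; exists 0%N; last exact: J32_form_gen.
  by rewrite nshapeP.
- move=> x y; have [m1|m1] := leqP m 1; first by rewrite J42_form_dim1 //; exact: gen_ideal0.
  apply: gen_ideal_sub; exists 1%N; last exact: J42_form_gen.
  by rewrite nshapeP.
- move=> x y z; have [m2|m2] := leqP m 2; first by rewrite J222_form_dim2 //; exact: gen_ideal0.
  apply: gen_ideal_sub; exists 2%N; last exact: J222_form_gen.
  by rewrite nshapeP.
Qed.

End Generators.

Arguments Jmod C m i : clear implicits.

(** * Independence modulo decomposable relations *)

Section SubmoduleOperations.
Variables (C : fieldType) (m : nat) (M : glmod C m).
Implicit Types N B : set M.

Lemma submodB N u v : is_submod N -> N u -> N v -> N (u - v).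
Proof. by move=> [N0 NL _] Nu Nv; rewrite -scaleN1r addrC; exact: NL. Qed.

Lemma submodD N u v : is_submod N -> N u -> N v -> N (u + v).
Proof. by move=> [N0 NL _] Nu Nv; rewrite -[u]scale1r; exact: NL. Qed.

Lemma submodZ N a u : is_submod N -> N u -> N (a *: u).
Proof. by move=> [N0 NL _] Nu; rewrite -[_ *: _]addr0; exact: NL. Qed.

Lemma submodI N B : is_submod N -> is_submod B -> is_submod (N `&` B).
Proof.
move=> [N0 NL NG] [B0 BL BG]; split=> // [a u v [Nu Bu] [Nv Bv]|g v gu [Nv Bv]].
  by split; [exact: NL | exact: BL].
by split; [exact: NG | exact: BG].
Qed.

Definition submod_add N B : set M := [set f | exists u v, [/\ N u, B v & f = u + v]].

Lemma submod_addP N B : is_submod N -> is_submod B -> is_submod (submod_add N B).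
Proof.
move=> [N0 NL NG] [B0 BL BG]; split.
- by exists 0, 0; rewrite addr0.
- move=> a _ _ [u [v [Nu Bv ->]]] [u' [v' [Nu' Bv' ->]]].
  exists (a *: u + u'), (a *: v + v').
  by split; [exact: NL | exact: BL | rewrite scalerDr addrACA].
move=> g _ gu [u [v [Nu Bv ->]]]; exists (gl_act g u), (gl_act g v).
split; [exact: NG | exact: BG |].
by have := gl_act_linear gu 1 u v; rewrite !scale1r.
Qed.

(** The intersection with B is a submodule that misses v, so irreducibility forces it to be zero. *)
Lemma irreducible_gen_cap v B : is_irreducible (gen_submod v) -> is_submod B -> ~ B v ->
  forall f, gen_submod v f -> B f -> f = 0.
Proof.
move=> [sG _ irr] sB Bv f Gf Bf.
have [N0|NG] := irr (gen_submod v `&` B) (submodI sG sB) (@subIsetl _ _ _).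
  by have := conj Gf Bf : (gen_submod v `&` B) f; rewrite N0.
by case: Bv; have := @gen_submod_self _ _ _ v; rewrite -{1}NG => -[].
Qed.

End SubmoduleOperations.

Lemma unitriangular_unit (C : fieldType) m (U : 'M[C]_m) :
  upper_unitriangular U -> U \in unitmx.
Proof.
move=> uU; rewrite -unitmx_tr unitmxE det_trig; last first.
  by apply/is_trig_mxP => i j ij; rewrite mxE uU ?(ltnW ij) // -val_eqE gtn_eqF.
by rewrite big1 ?unitr1 // => i _; rewrite mxE uU // eqxx.
Qed.

Lemma diag_unit (C : fieldType) m (z : 'rV[C]_m) :
  (forall i, z 0 i != 0) -> diag_mx z \in unitmx.
Proof.
by move=> z0; rewrite unitmxE det_diag unitfE prodf_seq_neq0; apply/allP => i _; exact: z0.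
Qed.

Section Independence.
Variables (C : fieldType) (conj : {rmorphism C -> C}).
Hypothesis conjK : involutive conj.
Hypothesis natC : forall n, n.+1%:R != 0 :> C.
Hypothesis anisotropic : forall (I : eqType) (r : seq I) (k : I -> nat) (a : I -> C),
  \sum_(i <- r) (k i).+1%:R * (a i * conj (a i)) = 0 -> forall i, i \in r -> a i = 0.
Variables (d m : nat).
Local Notation M := (F_glmod C d m).

(* If v = b + n with b in B and n in the module of w, then n is fixed by the
   unitriangular matrices and has the weight of v, up to elements of B, hence
   exactly; so it is a highest weight vector of the wrong weight. *)
Lemma hwv_notin_add lam mu (v w : M) (B : set M) : is_submod B ->
  highest_weight_vector lam v -> highest_weight_vector mu w ->
  ~ (forall i : 'I_m, nth 0%N lam i = nth 0%N mu i) ->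
  ~ B v -> ~ B w -> ~ submod_add B (gen_submod w) v.
Proof.
move=> sB hv hw lam_mu Bv Bw [b [n [Bb Gn vE]]].
have sG := gen_submod_submod w; have [_ _ GG] := sG; have [_ _ BG] := sB.
have cap := irreducible_gen_cap (hwv_irreducible conjK natC anisotropic hw) sB Bw.
have [v0 vU vz] := hv.
have fixed g a : g \in unitmx -> gl_act g v = a *: v -> gl_act g n = a *: n.
  move=> gu gv; apply: subr0_eq; apply: cap.
    by apply: (submodB sG); [exact: GG | exact: (submodZ _ sG)].
  have -> : gl_act g n - a *: n = a *: b - gl_act g b.
    have := gl_act_linear gu 1 b n; rewrite !scale1r -vE gv vE scalerDr => E.
    by apply/eqP; rewrite subr_eq addrAC E addrC addKr.
  by apply: (submodB sB); [exact: (submodZ _ sB) | exact: BG].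
apply: lam_mu => i; apply/esym.
apply: (hwv_unique conjK natC anisotropic hw (w := n)) => //; split.
- by apply/eqP => n0; apply: Bv; rewrite vE n0 addr0.
- by move=> U uU; rewrite (fixed _ 1) ?scale1r ?unitriangular_unit ?vU.
by move=> z z0; apply: fixed; [exact: diag_unit | exact: vz].
Qed.

Lemma hwv_independent r (lam : nat -> seq nat) (v n : nat -> M) (B : set M) : is_submod B ->
  (forall i, (i < r)%N -> highest_weight_vector (lam i) (v i)) ->
  (forall i j, (i < r)%N -> (j < r)%N -> i != j ->
     ~ (forall k : 'I_m, nth 0%N (lam i) k = nth 0%N (lam j) k)) ->
  (forall i, (i < r)%N -> ~ B (v i)) ->
  (forall i, (i < r)%N -> gen_submod (v i) (n i)) ->
  B (\sum_(i < r) n i) -> forall i, (i < r)%N -> n i = 0.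
Proof.
move=> sB hv dist Bv Gn.
(* The filtration B + N_0 + ... + N_{k-1}. By [hwv_notin_add] the next generator never lies in it,
   so the summands vanish from the last one downwards. *)
pose fix S k := if k is l.+1 then submod_add (S l) (gen_submod (v l)) else B.
have sS k : is_submod (S k).
  by elim: k => // k IH; apply: submod_addP => //; exact: gen_submod_submod.
have Sv k i : (k <= i)%N -> (i < r)%N -> ~ S k (v i).
  elim: k i => [|k IH] i ki ir; first exact: Bv.
  apply: (hwv_notin_add (lam := lam i) (mu := lam k) (sS k)); try by [apply: hv => //; lia | apply: IH; lia].
  by apply: dist => //; lia.
have BS k f : B f -> S k f.
  move=> Bf; elim: k => // k IH; exists f, 0; rewrite addr0; split=> //.
  by have [] := gen_submod_submod (v k).
have Ssum k : (k <= r)%N -> S k (\sum_(i < k) n i).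
  elim: k => [_|k IH kr]; first by rewrite big_ord0; have [] := sB.
  rewrite big_ord_recr; exists (\sum_(i < k) n i), (n k).
  by split=> //; [exact: IH (ltnW kr) | exact: Gn].
suff main k : (k <= r)%N -> B (\sum_(i < k) n i) -> forall i, (i < k)%N -> n i = 0 by exact: main.
elim: k => // k IH kr; rewrite big_ord_recr /= => Bk.
have nk : n k = 0.
  apply: (irreducible_gen_cap (hwv_irreducible conjK natC anisotropic (hv k kr)) (sS k)).
  - exact: Sv.
  - exact: Gn.
  rewrite -[n k](addKr (\sum_(i < k) n i)) addrC.
  by apply: (submodB (sS k)); [exact: BS | exact: Ssum (ltnW kr)].
move: Bk; rewrite nk addr0 => Bk i; rewrite ltnS leq_eqVlt => /orP[/eqP -> //|].
exact: IH (ltnW kr) Bk i.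
Qed.

End Independence.

Lemma mcoeffM_eq0 (C : comNzRingType) n (p q : {mpoly C[n]}) (u : 'X_{1..n}) :
  (forall v w, u = (v + w)%MM -> p@_v * q@_w = 0) -> (p * q)@_u = 0.
Proof. by move=> pq0; rewrite mcoeffM big1 // => k /eqP /pq0. Qed.

Section LowDegree.
Variables (C : fieldType) (m : nat).
Hypothesis natC : forall n, n.+1%:R != 0 :> C.
Local Notation F := (Falg C 3 m).
Implicit Types u : 'X_{1..ntmon 3 m}.

Lemma tdeg_eq0 u : tdeg u = 0%N -> u = 0%MM.
Proof.
move=> u0; apply/mnmP => j; rewrite mnm0E; have /eqP := u0; rewrite sum_nat_eq0.
move=> /forallP /(_ j) /=; rewrite muln_eq0 => /orP[/eqP //|/eqP w0].
by have := mon_of_deg j; rewrite w0.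
Qed.

Lemma homogeneous_coef e (f : F) u : homogeneous e f -> tdeg u != e -> f@_u = 0.
Proof. by move=> hf ue; apply: dhomog_nemf_coeff hf ue. Qed.

Lemma Fplus_coef0 (f : F) : Fplus f -> f@_0%MM = 0.
Proof.
move=> [r [h [hh ->]]]; rewrite raddf_sum big1 // => i _ /=.
by have [e e0 he] := hh i; apply: (homogeneous_coef he); rewrite tdeg0 ltn_eqF.
Qed.

Lemma Fplus_sub_const (f : F) : Fplus (f - (f@_0%MM)%:MP).
Proof.
exists (size (msupp (f - (f@_0%MM)%:MP))).
set g := f - _; exists (fun i => g@_(nth 0%MM (msupp g) i) *: 'X_[nth 0%MM (msupp g) i]).
split; last by rewrite {1}[g]mpolyE (big_nth 0%MM) big_mkord.
move=> i; exists (tdeg (nth 0%MM (msupp g) i)); last first.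
  by apply: rpredZ; rewrite dhomogX.
rewrite lt0n; apply/negP => /eqP /tdeg_eq0 i0.
have := mem_nth 0%MM (ltn_ord i); rewrite i0 mcoeff_msupp /g mcoeffB mcoeffC eqxx mulr1.
by rewrite subrr eqxx.
Qed.

(** The generators have degrees 5, 6 and 6. *)
Lemma K_coef_low (w : C) f u : w ^+ 2 + w + 1 = 0 -> K C 3 m f -> (tdeg u < 5)%N -> f@_u = 0.
Proof.
move=> w0; rewrite (K_gen_ideal m natC w0) => Kf; move: u.
apply: (gen_ideal_min (I := [set f : F | forall u, (tdeg u < 5)%N -> f@_u = 0])) Kf.
- by move=> u _; rewrite mcoeff0.
- move=> a p q p0 q0 u u5 /=; rewrite mcoeffD q0 // addr0.
  apply: mcoeffM_eq0 => v v' uE; rewrite p0 ?mulr0 //; apply: leq_ltn_trans u5.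
  by rewrite uE tdegD leq_addl.
move=> s [i im si] u u5; apply: (homogeneous_coef (Jmod_homogeneous natC im si)).
by move: im u5; rewrite nshapeP; case: i {si} => [|[|[|//]]] _ /=; lia.
Qed.

Definition core u : bool := [forall j, (mdeg (mon_of j) == 1%N) ==> (u j == 0%N)].

(** As K starts in degree 5, F^+ K starts in degree 6, and there it consists of the degree 5 part of
    K times variables of degree one. It therefore has no monomial in degree 6 that avoids the
    t(x_i). *)
Lemma FplusK_coef (w : C) f u : w ^+ 2 + w + 1 = 0 -> ideal_mul (@Fplus C 3 m) (K C 3 m) f ->
  (tdeg u < 6)%N || ((tdeg u == 6) && core u) -> f@_u = 0.
Proof.
move=> w0 [r [a [b [Fa Kb ->]]]] hu; rewrite raddf_sum big1 // => i _ /=.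
apply: mcoeffM_eq0 => v v' uE.
have [v0|vpos] := posnP (tdeg v).
  by rewrite (tdeg_eq0 v0) (Fplus_coef0 (Fa i)) mul0r.
have [v5|v5] := ltnP (tdeg v') 5; first by rewrite (K_coef_low w0 (Kb i) v5) mulr0.
have uD : tdeg u = (tdeg v + tdeg v')%N by rewrite uE tdegD.
case/orP: hu => [u6|/andP[/eqP u6 /forallP uc]]; first by lia.
have : tdeg v = 1%N by lia.
have [[j vj]|v0] := pselect (exists j, v j != 0%N); last first.
  rewrite /tdeg big1 // => j _; apply/eqP; rewrite muln_eq0; apply/orP; left.
  by apply: contra_notT v0 => vj; exists j.
rewrite /tdeg (bigD1 j) //= => v1; have /andP[j0 _] := mon_of_deg j.
have j1 : mdeg (mon_of j) == 1%N by move: j0 vj v1; case: (v j) => // k; lia.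
by have /implyP /(_ j1) := uc j; rewrite uE mnmDE addn_eq0 (negbTE vj).
Qed.

Lemma mon_eval_core (theta : 'X_{1..m} -> C) (f : F) : (forall i, theta U_(i)%MM = 0) ->
  (forall u, core u -> f@_u = 0) -> mon_eval theta f = 0.
Proof.
move=> th0 fc; rewrite /mon_eval mevalE big1 // => u _.
have [/fc ->|] := boolP (core u); first by rewrite mul0r.
rewrite negb_forall => /existsP[j]; rewrite negb_imply => /andP[/mdeg1P[i /eqP ji] uj].
by rewrite (bigD1 j) //= ji th0 expr0n (negbTE uj) mul0r mulr0.
Qed.

Lemma Jgen_notin_FplusK (w : C) i : w ^+ 2 + w + 1 = 0 -> (i < nshape m)%N ->
  ~ ideal_mul (@Fplus C 3 m) (K C 3 m) (Jgen C m i).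
Proof.
move=> w0 im FK; have hi := Jgen_homogeneous natC im; have hw := Jgen_hwv natC im.
have coef u : (tdeg u < 6)%N || core u -> (Jgen C m i : F)@_u = 0.
  move=> hu; have [/eqP ui|ui] := boolP (tdeg u == sumn (shape i)); last exact: homogeneous_coef hi ui.
  apply: (FplusK_coef w0 FK).
  move: im ui hu; rewrite nshapeP; case: (i) => [|[|[|//]]] _ -> //=.
move: im coef hi; rewrite nshapeP; case: (i) hw => [|[|[|//]]] hw /= im coef hi.
- have [J0 _ _] := hw; case/eqP: J0; apply/mpolyP => u; rewrite mcoeff0.
  have [u6|u6] := ltnP (tdeg u) 6; first by apply: coef; rewrite u6.
  by apply: (homogeneous_coef hi); rewrite gtn_eqF.
- have [theta th0 /eqP[]] := J42_core_eval natC im.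
  by apply: (mon_eval_core th0) => u uc; apply: coef; rewrite uc orbT.
- have [theta th0 /eqP[]] := J222_core_eval natC im.
  by apply: (mon_eval_core th0) => u uc; apply: coef; rewrite uc orbT.
Qed.

End LowDegree.

Section Independence.
Variables (C : fieldType) (conj : {rmorphism C -> C}).
Hypothesis conjK : involutive conj.
Hypothesis natC : forall n, n.+1%:R != 0 :> C.
Hypothesis anisotropic : forall (I : eqType) (r : seq I) (k : I -> nat) (a : I -> C),
  \sum_(i <- r) (k i).+1%:R * (a i * conj (a i)) = 0 -> forall i, i \in r -> a i = 0.
Variable w : C.
Hypothesis w_root : w ^+ 2 + w + 1 = 0.
Variable m : nat.
Local Notation FK := (ideal_mul (@Fplus C 3 m) (K C 3 m) : set (F_glmod C 3 m)).

Lemma shape_inj i j : (i < nshape m)%N -> (j < nshape m)%N ->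
  (forall k : 'I_m, nth 0%N (shape i) k = nth 0%N (shape j) k) -> i = j.
Proof.
rewrite !nshapeP => /andP[i3 im] /andP[j3 jm] sij.
have m0 : (0 < m)%N by apply: leq_trans im; case: i {sij} i3 => [|[|[]]].
by have := sij (Ordinal m0); case: i j i3 j3 {im jm sij} => [|[|[|//]]] [|[|[|//]]].
Qed.

Lemma Jmod_independent (n : nat -> F_glmod C 3 m) :
  (forall i, (i < nshape m)%N -> Jmod C m i (n i)) ->
  FK (\sum_(i < nshape m) n i) -> forall i, (i < nshape m)%N -> n i = 0.
Proof.
move=> Jn; apply: (hwv_independent conjK natC anisotropic (lam := shape) (v := Jgen C m)) => //.
- exact: FplusK_submod.
- by move=> i; exact: Jgen_hwv.
- by move=> i j im jm /eqP ij /(shape_inj im jm).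
by move=> i; exact: Jgen_notin_FplusK w_root.
Qed.

Lemma Jmod_isom_V i : (i < nshape m)%N -> isom_V (shape i) (Jmod C m i).
Proof.
move=> im; apply: (gen_isom_V conjK natC anisotropic (e := sumn (shape i))).
- by move: im; rewrite nshapeP => /andP[].
- exact: Jgen_homogeneous.
exact: Jgen_hwv.
Qed.

(** Modulo F^+ K only the constant terms of the coefficients count, so a combination in the ideal
    becomes a linear one. *)
Lemma K_decomposition f : K C 3 m f -> exists n : nat -> F_glmod C 3 m,
  (forall i, Jmod C m i (n i)) /\ FK (f - \sum_(i < nshape m) n i).
Proof.
have [FK0 FKL _] := FplusK_submod C 3 m.
pose S : set (Falg C 3 m) := [set f : Falg C 3 m | exists n : nat -> F_glmod C 3 m,
  (forall i, Jmod C m i (n i)) /\ FK (f - \sum_(i < nshape m) n i)].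
have sJ i := gen_submod_submod (Jgen C m i).
have S0 : S 0.
  exists (fun=> 0); split=> [i|]; first by have [] := sJ i.
  by rewrite big1 // subrr.
have SD u v : S u -> S v -> S (u + v).
  move=> [n [Jn un]] [n' [Jn' vn']]; exists (fun i => n i + n' i); split=> [i|].
    exact: (submodD (sJ i) (Jn i) (Jn' i)).
  by rewrite big_split /= opprD addrACA; apply: (submodD (FplusK_submod _ _ _)).
suff KS : K C 3 m `<=` S by exact: KS.
rewrite (K_gen_ideal m natC w_root) => _ [r [a [s [Js ->]]]].
apply: (big_ind (fun x => S x) S0 SD) => k _; have [i im si] := Js k.
exists (fun j => if j == i then (a k)@_0%MM *: s k else 0); split=> [j|].
  case: eqP => [->|_]; last by have [] := sJ j.
  by apply: (submodZ _ (sJ i)); exact: si.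
rewrite (bigD1 (Ordinal im)) //= eqxx big1 ?addr0 => [|j]; last by rewrite -val_eqE => /negbTE /= ->.
exists 1%N, (fun=> a k - ((a k)@_0%MM)%:MP), (fun=> s k); split=> [_|_|].
- exact: Fplus_sub_const.
- exact: (Jmod_K im).
by rewrite big_ord1 mulrBl mul_mpolyC.
Qed.

End Independence.

(** * Passage to the quotient *)

Section QuotientTransport.
Variables (C : fieldType) (m : nat) (M : glmod C m) (B : submod M) (N : set M).
Hypothesis sN : is_submod N.
Hypothesis NB0 : forall v, N v -> sub_set B v -> v = 0.
Local Notation Q := (quot_glmod B).
Local Notation pi := (@quot_pi C m M B : M -> Q).
Implicit Types u v : M.

Lemma quot_pi0P v : pi v = 0 <-> sub_set B v.
Proof.
have p0 : pi 0 = 0.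
  by have := quot_piD B 0 0; rewrite addr0 => /esym/eqP; rewrite -subr_eq0 addrK => /eqP.
by rewrite -p0; have := quot_pi_eq B v 0; rewrite subr0.
Qed.

Lemma quot_piL a u v : pi (a *: u + v) = a *: pi u + pi v.
Proof. exact: (quot_pi_linear B a u v). Qed.

Lemma quot_pi_zero : pi 0 = 0.
Proof. by apply/quot_pi0P; have [] := sub_setP B. Qed.

Lemma quot_piZv a v : pi (a *: v) = a *: pi v.
Proof. by rewrite -[a *: v]addr0 quot_piL quot_pi_zero addr0. Qed.

Lemma quot_pi_sum I (r : seq I) (c : I -> C) (F : I -> M) :
  pi (\sum_(i <- r) c i *: F i) = \sum_(i <- r) c i *: pi (F i).
Proof.
elim: r => [|i r IH]; first by rewrite !big_nil quot_pi_zero.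
by rewrite !big_cons quot_piL IH.
Qed.

Lemma quot_pi_add I (r : seq I) (F : I -> M) :
  pi (\sum_(i <- r) F i) = \sum_(i <- r) pi (F i).
Proof.
have := quot_pi_sum r (fun=> 1) F.
under eq_bigr => i _ do rewrite scale1r.
by under [in RHS]eq_bigr => i _ do rewrite scale1r.
Qed.

Lemma quot_pi_inj u v : N u -> N v -> pi u = pi v -> u = v.
Proof.
move=> Nu Nv /quot_pi_eq Buv; apply: subr0_eq; apply: NB0 => //.
exact: submodB.
Qed.

Lemma quot_pi_gl g v : g \in unitmx -> gl_act g (pi v) = pi (gl_act g v).
Proof. exact: quot_pi_act. Qed.

Lemma image_submod : is_submod (pi @` N).
Proof.
have [N0 NL NG] := sN; split.
- by exists 0 => //; exact: quot_pi_zero.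
- by move=> a _ _ [u Nu <-] [v Nv <-]; exists (a *: u + v); [exact: NL | exact: quot_piL].
by move=> g _ gu [v Nv <-]; exists (gl_act g v); [exact: NG | rewrite quot_pi_gl].
Qed.

Lemma image_irreducible : is_irreducible N -> is_irreducible (pi @` N).
Proof.
move=> [_ [v Nv v0] irr]; split; first exact: image_submod.
  exists (pi v); first by exists v.
  by apply: contraNneq v0 => /quot_pi0P Bv; apply/eqP/NB0.
move=> N' sN' N'N; have [N'0 N'L N'G] := sN'; have [N0 NL NG] := sN.
pose N1 : set M := [set u | N u /\ N' (pi u)].
have sN1 : is_submod N1.
  split=> [|a x y [Nx Px] [Ny Py]|g x gu [Nx Px]].
  - by split; [exact: N0 | rewrite quot_pi_zero].
  - by split; [exact: NL | rewrite quot_piL; exact: N'L].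
  by split; [exact: NG | rewrite -quot_pi_gl //; exact: N'G].
have [N1E|N1E] := irr N1 sN1 (fun u => @proj1 _ _).
  left; apply/seteqP; split=> [q N'q|q ->] //; have [u Nu uq] := N'N _ N'q.
  have : N1 u by split=> //; rewrite uq.
  by rewrite N1E /= => u0; rewrite -uq u0; exact: quot_pi_zero.
right; apply/seteqP; split=> // _ [u Nu <-].
by move: Nu; rewrite -{1}N1E => -[].
Qed.

Lemma image_polynomial : is_polynomial_module N -> is_polynomial_module (pi @` N).
Proof.
move=> [r [e [P [einj [eN efree espan] eP]]]]; have [N0 NL NG] := sN.
have Ne j : N (e j) by apply: eN; exists j.
have pe_inj : injective (fun j => pi (e j)).
  by move=> i j /= /(quot_pi_inj (Ne i) (Ne j)); exact: einj.
exists r, (fun j => pi (e j)), P; split=> //; last first.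
  move=> g gu j; rewrite quot_pi_gl // eP //; exact: quot_pi_sum.
split=> [_ [j _ <-]|s c us se s0 q qs|_ [u Nu <-]].
- by exists (e j).
- have [j _ jq] := se q qs.
  pose I := [seq j <- enum 'I_r | pi (e j) \in s].
  have ps : perm_eq s [seq pi (e j) | j <- I].
    apply: uniq_perm => //; first by rewrite map_inj_uniq // filter_uniq // enum_uniq.
    move=> x; apply/idP/mapP => [xs|[k]]; last by rewrite mem_filter => /andP[ks _] ->.
    by have [k _ kx] := se x xs; exists k => //; rewrite mem_filter kx xs mem_enum.
  have sum0 : \sum_(k <- I) c (pi (e k)) *: e k = 0.
    apply: NB0; first exact: (subspace_sum N0 NL).
    by apply/quot_pi0P; rewrite quot_pi_sum -[RHS]s0 (perm_big _ ps) big_map.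
  rewrite -jq; apply: (efree [seq e k | k <- I] (fun v => c (pi v))).
  + by rewrite map_inj_uniq // filter_uniq // enum_uniq.
  + by move=> v /mapP[k _ ->]; exists k.
  + by rewrite big_map.
  by apply: map_f; rewrite mem_filter jq qs mem_enum.
have [s [c [se uE]]] := espan u Nu.
exists [seq pi (e k) | k <- enum 'I_r].
exists (fun q => \sum_(k | pi (e k) == q) \sum_(v <- s | v == e k) c v); split.
  by move=> v /mapP[k _ ->]; exists k.
rewrite big_map big_enum uE quot_pi_sum /=.
transitivity (\sum_(k < r) (\sum_(v <- s | v == e k) c v) *: pi (e k)); last first.
  apply: eq_bigr => k _; congr (_ *: _); rewrite [RHS](bigD1 k) //= [X in _ + X]big1 ?addr0 //.
  by move=> l /andP[/eqP /pe_inj ->]; rewrite eqxx.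
under [RHS]eq_bigr => k _ do rewrite scaler_suml.
rewrite (exchange_big_dep xpredT) //= big_seq [RHS]big_seq; apply: eq_bigr => v vs.
have [k _ kv] := se v vs.
rewrite (bigD1 k) /= ?kv // [X in _ + X]big1 ?addr0 // => l /andP[/eqP vl].
by case/eqP; apply: einj; rewrite -vl kv.
Qed.

Lemma image_hwv lam v : N v -> highest_weight_vector lam (pi v) <-> highest_weight_vector lam v.
Proof.
move=> Nv; have [N0 NL NG] := sN; split=> -[v0 vU vz]; split.
- by apply: contraNneq v0 => ->; rewrite quot_pi_zero.
- move=> U uU; have gu := unitriangular_unit uU; apply: quot_pi_inj => //; first exact: NG.
  by rewrite -quot_pi_gl // vU.
- move=> z z0; have gu := diag_unit z0; apply: quot_pi_inj; [exact: NG | exact: (submodZ _ sN) |].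
  by rewrite -quot_pi_gl // vz // quot_piZv.
- by apply: contraNneq v0 => /quot_pi0P Bv; apply/eqP/NB0.
- by move=> U uU; rewrite quot_pi_gl ?unitriangular_unit // vU.
by move=> z z0; rewrite quot_pi_gl ?diag_unit // vz // quot_piZv.
Qed.

Lemma image_isom_V lam : isom_V lam N -> isom_V lam (pi @` N).
Proof.
move=> [lm irr pol [v Nv hv]]; split=> //; [exact: image_irreducible | exact: image_polynomial |].
by exists (pi v); [exists v | apply/image_hwv].
Qed.

Lemma image_isom_V_hwv lam : isom_V lam (pi @` N) -> exists2 v, N v & highest_weight_vector lam v.
Proof. by move=> [_ _ _ [_ [v Nv <-] /(image_hwv _ Nv) hv]]; exists v. Qed.

End QuotientTransport.

(** * Multiplicities and minimal generating systems *)

Section MainResults.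
Variables (C : fieldType) (conj : {rmorphism C -> C}).
Hypothesis conjK : involutive conj.
Hypothesis natC : forall n, n.+1%:R != 0 :> C.
Hypothesis anisotropic : forall (I : eqType) (r : seq I) (k : I -> nat) (a : I -> C),
  \sum_(i <- r) (k i).+1%:R * (a i * conj (a i)) = 0 -> forall i, i \in r -> a i = 0.
Variable w : C.
Hypothesis w_root : w ^+ 2 + w + 1 = 0.

Local Notation FKs m := (Submod (FplusK_submod C 3 m)).
Local Notation FK m := (ideal_mul (@Fplus C 3 m) (K C 3 m) : set (F_glmod C 3 m)).
Local Notation pi m := (@quot_pi C m (F_glmod C 3 m) (FKs m) : F_glmod C 3 m -> FmodFplusK C 3 m).

Let indep m := @Jmod_independent C conj conjK natC anisotropic w w_root m.
Let Jmod_submod m i : is_submod (Jmod C m i) := gen_submod_submod _.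

Lemma Jmod_cap_FplusK m i f : (i < nshape m)%N -> Jmod C m i f -> FK m f -> f = 0.
Proof.
move=> im Jf FKf; pose n j : F_glmod C 3 m := if j == i then f else 0.
suff : n i = 0 by rewrite /n eqxx.
apply: (indep (n := n) _ _ im) => [j _|]; rewrite /n.
  by case: eqP => [->|_] //; have [] := Jmod_submod m j.
rewrite (bigD1 (Ordinal im)) //= eqxx big1 ?addr0 // => j.
by rewrite -val_eqE => /negbTE /= ->.
Qed.

Lemma image_Jmod_isom_V m i : (i < nshape m)%N -> isom_V (shape i) (pi m @` Jmod C m i).
Proof.
move=> im; apply: image_isom_V; first exact: Jmod_submod.
  by move=> v; exact: Jmod_cap_FplusK.
exact: (Jmod_isom_V conjK natC anisotropic im).
Qed.

Lemma minimal_relations_direct_sum m :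
  is_direct_sum (@minimal_relations C 3 m) (fun i : 'I_(nshape m) => pi m @` Jmod C m i).
Proof.
split.
- by move=> i _ [f Jf <-]; exists f => //; exact: (Jmod_K (ltn_ord i)).
- move=> _ [f Kf <-]; have [n [Jn fn]] := K_decomposition natC w_root Kf.
  exists (enum 'I_(nshape m)), (fun i : 'I_(nshape m) => pi m (n i)); split.
  + exact: enum_uniq.
  + by move=> i; exists (n i).
  by rewrite big_enum -quot_pi_add; apply/quot_pi_eq.
move=> s u us Ju u0.
have /choice[v vP] (i : 'I_(nshape m)) : exists v, Jmod C m i v /\ pi m v = u i.
  by have [x Jx xu] := Ju i; exists x.
(* Preimages of the summands, extended by zero to all natural indices, as [indep] expects. *)
pose n (i : nat) : F_glmod C 3 m :=
  if insub i is Some j then if j \in s then v j else 0 else 0.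
have nE (j : 'I_(nshape m)) : n j = if j \in s then v j else 0 by rewrite /n valK.
have n0 : forall i, (i < nshape m)%N -> n i = 0.
  apply: indep => [i im|].
    rewrite -[n _]/(n (Ordinal im)) nE; case: ifP => _; first by case: (vP (Ordinal im)).
    by have [] := Jmod_submod m i.
  apply/(quot_pi0P (FKs m)).
  have -> : \sum_(i < nshape m) n i = \sum_(i <- s) v i.
    rewrite (eq_bigr (fun j => if j \in s then v j else 0)) => [|j _]; last exact: nE.
    by rewrite -big_mkcond -big_uniq.
  by rewrite quot_pi_add -[RHS]u0; apply: eq_bigr => i _; case: (vP i).
move=> i si; have [_ <-] := vP i; have := n0 i (ltn_ord i).
by rewrite nE si => ->; exact: quot_pi_zero.
Qed.

Lemma isom_V_image_Jmod lam i : is_partition lam -> (i < nshape (size lam))%N ->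
  isom_V lam (pi (size lam) @` Jmod C (size lam) i) <-> shape i = lam.
Proof.
move=> /andP[_ lam0] im; split=> [h|sE]; last first.
  by have := image_Jmod_isom_V im; rewrite {1}sE.
have [v Jv hv] := image_isom_V_hwv (B := FKs _) (Jmod_submod _ _) (fun v => @Jmod_cap_FplusK _ _ v im) h.
have E := hwv_unique conjK natC anisotropic (Jgen_hwv natC im) hv Jv.
have sm : (size (shape i) <= size lam)%N by move: im; rewrite nshapeP => /andP[].
have sz : size (shape i) = size lam.
  (* If [shape i] were shorter than lam, comparing weights just past its end would give lam a zero
     part. *)
  apply/eqP; rewrite eqn_leq sm leqNgt; apply: contra lam0 => lt.
  have := E (Ordinal lt); rewrite nth_default //= => ->.
  exact: mem_nth.
apply: (eq_from_nth (x0 := 0%N)) => // j jm.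
by rewrite sz in jm; exact: (E (Ordinal jm)).
Qed.

Lemma mult_shapes lam : is_partition lam ->
  mult_is C 3 lam (if lam \in [:: [:: 3; 2]; [:: 4; 2]; [:: 2; 2; 2]]%N then 1%N else 0%N).
Proof.
move=> plam; set m := size lam.
exists 'I_(nshape m), (fun i : 'I_(nshape m) => pi m @` Jmod C m i); split.
- by move=> i; case: (image_Jmod_isom_V (ltn_ord i)).
- exact: minimal_relations_direct_sum.
exists [seq i : 'I_(nshape m) <- enum 'I_(nshape m) | shape i == lam]; split.
- by rewrite filter_uniq // enum_uniq.
- rewrite -sum1_size big_filter big_enum_cond /=.
  (* For the three listed partitions m is 2, 2 and 3, and the count of matching shapes is a
     computation. *)
  rewrite /m !inE; case: eqP => [->|n1]; first by rewrite big_mkcond !big_ord_recl big_ord0.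
  case: eqP => [->|n2]; first by rewrite big_mkcond !big_ord_recl big_ord0.
  case: eqP => [->|n3]; first by rewrite big_mkcond !big_ord_recl big_ord0.
  rewrite big_pred0 // => i; apply/eqP; have := ltn_ord i; rewrite nshapeP.
  by case: (val i) => [|[|[|//]]] _ /esym.
move=> i; rewrite mem_filter mem_enum andbT; split=> [/eqP|/isom_V_image_Jmod].
  by move=> sE; apply/isom_V_image_Jmod.
by move=> -> //; apply/eqP.
Qed.

Lemma min_gen_bases m (G : nat -> set (F_glmod C 3 m)) :
  (forall i, (i < nshape m)%N -> is_basis (Jmod C m i) (G i)) ->
  is_min_gen_system (K C 3 m) [set f : Falg C 3 m | exists2 i, (i < nshape m)%N & G i f].
Proof.
move=> bG; split.
- move=> f [i im Gf]; exists (sumn (shape i)); apply: (Jmod_homogeneous natC im).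
  by have [GJ _ _] := bG i im; exact: GJ.
- rewrite (K_gen_ideal m natC w_root); apply/seteqP; split.
    apply: gen_ideal_min; [exact: gen_ideal0 | exact: gen_ideal_closed |].
    move=> f [i im Gf]; apply: gen_ideal_sub; exists i => //.
    by have [GJ _ _] := bG i im; exact: GJ.
  apply: gen_ideal_min; [exact: gen_ideal0 | exact: gen_ideal_closed |].
  move=> f [i im Jf]; have [_ _ /(_ f Jf) [s [c [sG ->]]]] := bG i im.
  rewrite big_seq; apply: (big_ind (fun g => gen_ideal _ g)); first exact: gen_ideal0.
    by move=> u v hu hv; rewrite -[u]mul1r; exact: gen_ideal_closed.
  move=> v vs; rewrite -mul_mpolyC -[_ * _]addr0; apply: gen_ideal_closed; last exact: gen_ideal0.
  by apply: gen_ideal_sub; exists i => //; exact: sG.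
move=> G' G'G G'K; apply/seteqP; split=> // g [i0 im0 Gg].
have [GJ0 free0 _] := bG i0 im0.
have : gen_ideal G' g by rewrite G'K; apply: (Jmod_K im0); exact: GJ0.
move=> [r [a [s [sG' gE]]]].
have /choice[idx idxP] k : exists i, (i < nshape m)%N /\ G i (s k).
  by have [i im Gs] := G'G _ (sG' k); exists i.
(* Reducing the coefficients to their constant terms turns the expression of g into a linear
   relation modulo F^+ K. Independence splits it into the components [n i], each of which is
   zero. *)
pose c k := (a k)@_0%MM.
pose n i : F_glmod C 3 m := (if i == i0 then g else 0) - \sum_(k | idx k == i) c k *: s k.
have sJ k : Jmod C m (idx k) (s k).
  by have [kr Gk] := idxP k; have [GJ _ _] := bG _ kr; exact: GJ.
have n0 : n i0 = 0.
  apply: (indep (n := n) _ _ im0) => [i im|].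
    apply: (submodB (Jmod_submod m i)).
      case: eqP => [->|_]; first exact: GJ0.
      by have [] := Jmod_submod m i.
    apply: (big_ind (fun f => Jmod C m i f)).
    - by have [] := Jmod_submod m i.
    - by move=> u v; exact: (submodD (Jmod_submod m i)).
    by move=> k /eqP <-; exact: (submodZ _ (Jmod_submod m _)).
  rewrite /n sumrB (bigD1 (Ordinal im0)) //= eqxx [X in g + X - _]big1 ?addr0; last first.
    by move=> j; rewrite -val_eqE => /negbTE /= ->.
  rewrite (exchange_big_dep xpredT) //= {1}gE.
  rewrite -sumrB; exists r, (fun k => a k - (c k)%:MP), s; split=> [k|k|].
  - exact: Fplus_sub_const.
  - by have [kr _] := idxP k; exact: (Jmod_K kr).
  apply: eq_bigr => k _; rewrite mulrBl mul_mpolyC; congr (_ - _).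
  have [kr _] := idxP k; rewrite (big_pred1 (Ordinal kr)) // => j /=.
apply: contrapT => g'.
(* The component at i0 is a linear relation among g and the elements s k of the basis [G i0]. If g
   is none of the s k, its coefficient is 1, against linear independence. *)
pose l := undup (g :: [seq s k | k <- enum 'I_r & idx k == i0]).
have lG v : v \in l -> G i0 v.
  rewrite mem_undup inE => /orP[/eqP -> //|/mapP[k]].
  by rewrite mem_filter => /andP[/eqP <- _ ->]; case: (idxP k).
pose b (v : F_glmod C 3 m) : C := (v == g)%:R - \sum_(k | (idx k == i0) && (s k == v)) c k.
have bl : \sum_(v <- l) b v *: v = 0.
  have gl : g \in l by rewrite mem_undup mem_head.
  rewrite -[RHS]n0 /n eqxx; under eq_bigr => v _ do rewrite scalerBl.
  rewrite sumrB; congr (_ - _).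
    rewrite (bigD1_seq g) ?undup_uniq //= eqxx scale1r big1 ?addr0 // => v /negbTE ->.
    by rewrite scale0r.
  under eq_bigr => v _ do rewrite scaler_suml.
  rewrite (exchange_big_dep (fun k => idx k == i0)) /= => [|v k _ /andP[] //].
  apply: eq_bigr => k ki0.
  have kl : s k \in l.
    by rewrite mem_undup inE; apply/orP; right; apply: map_f; rewrite mem_filter ki0 mem_enum.
  rewrite big_mkcond (bigD1_seq (s k)) ?undup_uniq //= ki0 eqxx big1 ?addr0 // => v.
  by rewrite eq_sym => /negbTE ->.
have := free0 l b (undup_uniq _) lG bl g.
rewrite mem_undup mem_head => /(_ isT) /eqP; rewrite /b eqxx big1 ?subr0 ?oner_eq0 //.
by move=> k /andP[_ /eqP kg]; case: g'; rewrite -kg.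
Qed.

End MainResults.

Lemma cube_root_exists (C : numClosedFieldType) : exists w : C, w ^+ 2 + w + 1 = 0.
Proof.
exists ((sqrtC (- 3) - 1) / 2); have s3 := sqrtCK (- 3 : C).
have -> : ((sqrtC (- 3) - 1) / 2) ^+ 2 + (sqrtC (- 3) - 1) / 2 + 1
    = (sqrtC (- 3) ^+ 2 + 3) / 4 :> C by field.
by rewrite s3 addNr mul0r.
Qed.

Lemma conjC_anisotropic (C : numClosedFieldType) (I : eqType) (r : seq I) (k : I -> nat)
    (a : I -> C) :
  \sum_(i <- r) (k i).+1%:R * (a i * (a i)^*) = 0 -> forall i, i \in r -> a i = 0.
Proof.
move=> /eqP; rewrite psumr_eq0 => [/allP h i /h /=|i _]; last first.
  by rewrite mulr_ge0 ?ler0n ?mul_conjC_ge0.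
by rewrite mulf_eq0 pnatr_eq0 /= mul_conjC_eq0 => /eqP.
Qed.

Lemma bases_union2 (C : fieldType) m (G32 G42 : set (Falg C 3 m)) : nshape m = 2%N ->
  [set f | exists2 i, (i < nshape m)%N & nth set0 [:: G32; G42] i f] = G32 `|` G42.
Proof.
move=> n2; apply/seteqP; split=> [f [k]|f [Gf|Gf]].
- by rewrite n2; case: k => [|[|]] //= _ Gf; [left | right].
- by exists 0%N; rewrite ?n2.
by exists 1%N; rewrite ?n2.
Qed.

Lemma bases_union3 (C : fieldType) m (G32 G42 G222 : set (Falg C 3 m)) : nshape m = 3%N ->
  [set f | exists2 i, (i < nshape m)%N & nth set0 [:: G32; G42; G222] i f]
  = G32 `|` G42 `|` G222.
Proof.
move=> n3; apply/seteqP; split=> [f [k]|f [[Gf|Gf]|Gf]].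
- by rewrite n3; case: k => [|[|[]]] //= _ Gf; [left; left | left; right | right].
- by exists 0%N; rewrite ?n3.
- by exists 1%N; rewrite ?n3.
by exists 2%N; rewrite ?n3.
Qed.

Theorem theorem3p1 (R : realType) :
  [/\ (forall lam : seq nat, is_partition lam ->
         mult_is R[i] 3 lam
           (if lam \in [:: [:: 3; 2]; [:: 4; 2]; [:: 2; 2; 2]]%N
            then 1%N else 0%N)),
      (forall m : nat, (2 <= m)%N ->
         [/\ isom_V [:: 3; 2]%N (N32 R[i] m), N32 R[i] m `<=` K R[i] 3 m,
             isom_V [:: 4; 2]%N (N42 R[i] m) & N42 R[i] m `<=` K R[i] 3 m]),
      (forall m : nat, (3 <= m)%N ->
         isom_V [:: 2; 2; 2]%N (N222 R[i] m) /\
         N222 R[i] m `<=` K R[i] 3 m),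
      (forall G32 G42 : set (Falg R[i] 3 2),
         is_basis (N32 R[i] 2) G32 -> is_basis (N42 R[i] 2) G42 ->
         is_min_gen_system (K R[i] 3 2) (G32 `|` G42))
    & (forall m : nat, (3 <= m)%N ->
       forall G32 G42 G222 : set (Falg R[i] 3 m),
         is_basis (N32 R[i] m) G32 -> is_basis (N42 R[i] m) G42 ->
         is_basis (N222 R[i] m) G222 ->
         is_min_gen_system (K R[i] 3 m) (G32 `|` G42 `|` G222))].
Proof.
have natC n : n.+1%:R != 0 :> R[i] by rewrite pnatr_eq0.
pose conj : {rmorphism R[i] -> R[i]} := @Num.conj R[i].
have conjK : involutive conj := @conjCK R[i].
have aniso := @conjC_anisotropic R[i].
have [w w0] := cube_root_exists R[i].
have isomJ m i : (i < nshape m)%N -> isom_V (shape i) (Jmod R[i] m i).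
  exact: (@Jmod_isom_V _ conj conjK natC aniso).
have min_gen m := @min_gen_bases _ conj conjK natC aniso w w0 m.
split.
- exact: (@mult_shapes _ conj conjK natC aniso w w0).
- move=> m m2; split; [|exact: N32_K| |exact: N42_K].
    by apply: (isomJ m 0%N); rewrite nshapeP.
  by apply: (isomJ m 1%N); rewrite nshapeP.
- move=> m m3; split; last exact: N222_K.
  by apply: (isomJ m 2%N); rewrite nshapeP.
- move=> G32 G42 b32 b42; rewrite -bases_union2 //.
  by apply: min_gen => -[|[|[]]].
move=> m m3 G32 G42 G222 b32 b42 b222; rewrite -bases_union3; last first.
  by case: m m3 {G32 G42 G222 b32 b42 b222} => [|[|[]]].
by apply: min_gen => i; rewrite nshapeP; case: i => [|[|[|//]]].
Qed.
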